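(* Let $\mathbb{G}$ be a coamenable locally compact quantum group and let $\omega\in \mathrm{M}(\mathbb{G})$ be a contractive idempotent functional. Then the absolute values $|\omega|_r$ and $|\omega|_l$ are idempotent states, and there exists $v\in \mathrm{C}_0(\mathbb{G})$ such that $\omega=|\omega|_l.v=v.|\omega|_r$ and \[ \Delta(v)-v\otimes v\in N_{|\omega|_r\otimes|\omega|_r}\cap \bigl(N_{|\omega|_l\otimes|\omega|_l}\bigr)^*, \] where $N_{|\omega|_r\otimes|\omega|_r}$ and $N_{|\omega|_l\otimes|\omega|_l}$ are subsets of $M(\mathrm{C}_0(\mathbb{G})\otimes \mathrm{C}_0(\mathbb{G}))$.
   Context: Locally compact quantum groups are in the $C^*$-algebraic sense of Kustermans and Vaes: $\mathbb{G}$ is given by a $C^*$-algebra $\mathrm{C}_0(\mathbb{G})$ with a coassociative nondegenerate $^*$-homomorphism $\Delta:\mathrm{C}_0(\mathbb{G})\to M(\mathrm{C}_0(\mathbb{G})\otimes \mathrm{C}_0(\mathbb{G}))$ (comultiplication) satisfying the cancellation laws $\overline{\mathrm{span}}\,\Delta(\mathrm{C}_0(\mathbb{G}))(\mathrm{C}_0(\mathbb{G})\otimes 1)=\mathrm{C}_0(\mathbb{G})\otimes \mathrm{C}_0(\mathbb{G})=\overline{\mathrm{span}}\,\Delta(\mathrm{C}_0(\mathbb{G}))(1\otimes \mathrm{C}_0(\mathbb{G}))$, and admitting faithful KMS left and right invariant Haar weights. Here $\otimes$ is the spatial tensor product and $M(\cdot)$ the multiplier algebra. $\mathbb{G}$ is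 coamenable if $\mathrm{C}_0(\mathbb{G})$ admits a bounded counit, i.e. a bounded functional $\epsilon$ with $(\epsilon\otimes\mathrm{id})\Delta=(\mathrm{id}\otimes\epsilon)\Delta=\mathrm{id}$. $\mathrm{M}(\mathbb{G})=\mathrm{C}_0(\mathbb{G})^*$ with product $\omega\star\mu=(\omega\otimes\mu)\circ\Delta$. An idempotent functional is a nonzero $\omega\in \mathrm{M}(\mathbb{G})$ with $\omega\star\omega=\omega$; it is contractive if $\|\omega\|\le 1$; an idempotent state is an idempotent functional that is a state. Functionals are extended strictly to multiplier algebras and normally to biduals, with the same notation. For a $C^*$-algebra $A$, $\omega\in A^*$, $x,y\in A^{**}$: $\omega.x(y)=\omega(xy)$ and $x.\omega(y)=\omega(yx)$. The polar decomposition of $\omega$ is the unique $\omega=u.|\omega|_r$ with $|\omega|_r\in A^*$ positive (right absolute value) and $u\in A^{**}$ a partial isometry such that $u^*u$ is the support projection of $|\omega|_r$. The left absolute value is $|\omega|_l=u.|\omega|_r.u^*$; one has $\omega=|\omega|_l.u$. For a state $\sigma$, $N_\sigma=\{a:\sigma(a^*a)=0\}$, and for a set $X$ of operators $X^*=\{x^*:x\in X\}$. *)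

(* Defs.v *)
(* The complex numbers are R[i] for R : realType; norms of complex normed spaces
   take values in R[i], where they are nonnegative reals. *)
From HB Require Import structures.
From mathcomp Require Import all_boot all_order all_algebra complex.
From mathcomp Require Import mathcomp_extra boolp classical_sets reals ereal.
From mathcomp Require Import topology normedtype derive.

Set Implicit Arguments.
Unset Strict Implicit.
Unset Printing Implicit Defensive.

Import Order.TTheory GRing.Theory Num.Theory.
Import numFieldNormedType.Exports.

Local Open Scope classical_set_scope.
Local Open Scope ring_scope.

(* the numFieldType structure on R[i], given by its canonical instance *)
Local Notation CF R := (complex_complex__canonical__Num_NumField R).

Definition closed_span (R : realType) (V : normedModType (CF R)) (S : set V) :
    set V :=
  closure [set x | exists (n : nat) (k : 'I_n -> R[i]) (y : 'I_n -> V),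
                     (forall i, S (y i)) /\ x = \sum_(i < n) k i *: y i].

(* C*-algebras are not assumed to be unital. *)
Record cstarAlgebra (R : realType) := CStarAlgebra {
  cstar_sort :> completeNormedModType (CF R);
  cmul : cstar_sort -> cstar_sort -> cstar_sort;
  cadj : cstar_sort -> cstar_sort;
  cmulA : forall a b c, cmul a (cmul b c) = cmul (cmul a b) c;
  cmul_linearl : forall k a b c,
    cmul (k *: a + b) c = k *: cmul a c + cmul b c;
  cmul_linearr : forall k a b c,
    cmul c (k *: a + b) = k *: cmul c a + cmul c b;
  cadj_semilinear : forall k a b, cadj (k *: a + b) = k^* *: cadj a + cadj b;
  cadjM : forall a b, cadj (cmul a b) = cmul (cadj b) (cadj a);
  cadjK : forall a, cadj (cadj a) = a;
  cnormM_le : forall a b, `|cmul a b| <= `|a| * `|b|;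
  cnorm_cstar : forall a, `|cmul (cadj a) a| = `|a| ^+ 2
}.

Section CStarTheory.
Variables (R : realType) (A : cstarAlgebra R).
Implicit Types a b c : A.

Definition cpositive a : Prop := exists b, a = cmul (cadj b) b.

Lemma cmulDl a b c : cmul (a + b) c = cmul a c + cmul b c.
Proof. by have := cmul_linearl 1 a b c; rewrite !scale1r. Qed.

Lemma cmulDr a b c : cmul c (a + b) = cmul c a + cmul c b.
Proof. by have := cmul_linearr 1 a b c; rewrite !scale1r. Qed.

Lemma cmul0 c : cmul 0 c = 0.
Proof. by apply: (addrI (cmul 0 c)); rewrite -cmulDl !addr0. Qed.

Lemma cmulr0 c : cmul c 0 = 0.
Proof. by apply: (addrI (cmul c 0)); rewrite -cmulDr !addr0. Qed.

Lemma cmulZl k a c : cmul (k *: a) c = k *: cmul a c.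
Proof. by have := cmul_linearl k a 0 c; rewrite cmul0 !addr0. Qed.

Lemma cmulZr k a c : cmul c (k *: a) = k *: cmul c a.
Proof. by have := cmul_linearr k a 0 c; rewrite cmulr0 !addr0. Qed.

Lemma cnorm_le_adj a : `|a| <= `|cadj a|.
Proof.
have [->|a0] := eqVneq a 0; first by rewrite normr0.
rewrite -(ler_pM2r (_ : 0 < `|a|)) ?normr_gt0// -expr2 -cnorm_cstar.
exact: cnormM_le.
Qed.

End CStarTheory.

Definition star_hom (R : realType) (A B : cstarAlgebra R) (f : A -> B) : Prop :=
  [/\ forall k a b, f (k *: a + b) = k *: f a + f b,
      forall a b, f (cmul a b) = cmul (f a) (f b)
    & forall a, f (cadj a) = cadj (f a)].

Record dual (R : realType) (A : cstarAlgebra R) := Dual {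
  dual_fun :> A -> R[i];
  dual_linear : forall k a b, dual_fun (k *: a + b) = k * dual_fun a + dual_fun b;
  dual_bounded : exists2 K : R[i],
    0 <= K & forall a, `|dual_fun a| <= K * `|a|
}.

HB.instance Definition _ (R : realType) (A : cstarAlgebra R) :=
  gen_eqMixin (dual A).
HB.instance Definition _ (R : realType) (A : cstarAlgebra R) :=
  gen_choiceMixin (dual A).

Section Dual.
Variables (R : realType) (A : cstarAlgebra R).
Implicit Types (a b : A) (w : dual A).

Program Definition dual0 : dual A := @Dual R A (fun=> 0) _ _.
Next Obligation. by move=> k a b; rewrite mulr0 addr0. Qed.
Next Obligation. by exists 0 => // a; rewrite normr0 mul0r. Qed.

Definition dnorm w : R :=
  sup [set complex.Re `|w a| | a in [set a : A | `|a| <= 1]].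

Definition dpositive w : Prop := forall a, 0 <= w (cmul (cadj a) a).

Definition is_state w : Prop := dpositive w /\ dnorm w = 1.

(* a.w = w(- a) *)
Program Definition dactl a w : dual A := @Dual R A (fun b => w (cmul b a)) _ _.
Next Obligation. by move=> a w k b c /=; rewrite cmul_linearl dual_linear. Qed.
Next Obligation.
move=> a w; have [K K0 wK] := dual_bounded w; exists (K * `|a|).
  by rewrite mulr_ge0.
move=> b; apply: (le_trans (wK _)); rewrite -mulrA ler_wpM2l// mulrC.
exact: cnormM_le.
Qed.

(* w.a = w(a -) *)
Program Definition dactr w a : dual A := @Dual R A (fun b => w (cmul a b)) _ _.
Next Obligation. by move=> w a k b c /=; rewrite cmul_linearr dual_linear. Qed.
Next Obligation.
move=> w a; have [K K0 wK] := dual_bounded w; exists (K * `|a|).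
  by rewrite mulr_ge0.
by move=> b; apply: (le_trans (wK _)); rewrite -mulrA ler_wpM2l// cnormM_le.
Qed.

Program Definition dadj w : dual A := @Dual R A (fun a => (w (cadj a))^*) _ _.
Next Obligation.
by move=> w k a b /=; rewrite cadj_semilinear dual_linear rmorphD rmorphM /= conjCK.
Qed.
Next Obligation.
move=> w; have [K K0 wK] := dual_bounded w; exists K => // a.
rewrite norm_conjC (le_trans (wK _))// ler_wpM2l//.
by rewrite -{2}(cadjK a) cnorm_le_adj.
Qed.

End Dual.
Arguments dual0 {R A}.

(* The elements of A^**.  Boundedness is with respect to the dual norm:
   |F w| <= C K as soon as K bounds the norm of w.  bidual_linear also says that
   F w only depends on the values of w. *)
Record bidual (R : realType) (A : cstarAlgebra R) := Bidual {
  bidual_fun :> dual A -> R[i];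
  bidual_linear : forall k (w1 w2 w : dual A),
    (forall a, w a = k * w1 a + w2 a) ->
    bidual_fun w = k * bidual_fun w1 + bidual_fun w2;
  bidual_bounded : exists2 C : R[i],
    0 <= C & forall (w : dual A) (K : R[i]), 0 <= K ->
      (forall a, `|w a| <= K * `|a|) -> `|bidual_fun w| <= C * K
}.

Section Bidual.
Variables (R : realType) (A : cstarAlgebra R).
Implicit Types (a b : A) (w : dual A) (x y : bidual A).

(* x.w = w(- x): the normal extension of w satisfies w(a x) = x(w.a) *)
Program Definition lact x w : dual A := @Dual R A (fun a => x (dactr w a)) _ _.
Next Obligation.
move=> x w k a b /=; apply: bidual_linear => c /=.
by rewrite cmul_linearl dual_linear.
Qed.
Next Obligation.
move=> x w; have [K K0 wK] := dual_bounded w; have [C C0 xC] := bidual_bounded x.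
exists (C * K); first by rewrite mulr_ge0.
move=> a; rewrite -mulrA; apply: xC; first by rewrite mulr_ge0.
by move=> b /=; rewrite (le_trans (wK _))// -mulrA ler_wpM2l// cnormM_le.
Qed.

(* w.x = w(x -): the normal extension of w satisfies w(x a) = x(a.w) *)
Program Definition ract w x : dual A := @Dual R A (fun a => x (dactl a w)) _ _.
Next Obligation.
move=> w x k a b /=; apply: bidual_linear => c /=.
by rewrite cmul_linearr dual_linear.
Qed.
Next Obligation.
move=> w x; have [K K0 wK] := dual_bounded w; have [C C0 xC] := bidual_bounded x.
exists (C * K); first by rewrite mulr_ge0.
move=> a; rewrite -mulrA; apply: xC; first by rewrite mulr_ge0.
move=> b /=; rewrite (le_trans (wK _))// -mulrA ler_wpM2l// mulrC.
exact: cnormM_le.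
Qed.

(* The Arens product, which is the product of the enveloping von Neumann
   algebra A^** : w(x y) = x(y.w). *)
Program Definition bmul x y : bidual A := @Bidual R A (fun w => x (lact y w)) _ _.
Next Obligation.
move=> x y k w1 w2 w wE /=; apply: bidual_linear => a /=.
by apply: bidual_linear => b /=; rewrite wE.
Qed.
Next Obligation.
move=> x y; have [C C0 xC] := bidual_bounded x.
have [D D0 yD] := bidual_bounded y; exists (C * D); first by rewrite mulr_ge0.
move=> w K K0 wK; rewrite -mulrA; apply: xC; first by rewrite mulr_ge0.
move=> a /=; rewrite -mulrA; apply: yD; first by rewrite mulr_ge0.
by move=> b /=; rewrite (le_trans (wK _))// -mulrA ler_wpM2l// cnormM_le.
Qed.

Program Definition badj x : bidual A := @Bidual R A (fun w => (x (dadj w))^*) _ _.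
Next Obligation.
move=> x k w1 w2 w wE /=.
rewrite (@bidual_linear _ _ x k^* (dadj w1) (dadj w2)).
  by rewrite rmorphD rmorphM /= conjCK.
by move=> a /=; rewrite wE rmorphD rmorphM.
Qed.
Next Obligation.
move=> x; have [C C0 xC] := bidual_bounded x; exists C => // w K K0 wK.
rewrite norm_conjC; apply: xC => // a /=.
rewrite norm_conjC (le_trans (wK _))// ler_wpM2l//.
by rewrite -{2}(cadjK a) cnorm_le_adj.
Qed.

Definition is_projection (p : bidual A) : Prop := bmul p p = p /\ badj p = p.

(* The support of a positive w: the smallest projection p with w(p) = w(1),
   where w(1) is the norm of w. *)
Definition is_support w (p : bidual A) : Prop :=
  [/\ is_projection p, p w = (dnorm w)%:C%C
    & forall q, is_projection q -> q w = (dnorm w)%:C%C -> bmul q p = p].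

(* The equation w = u.r exhibits r as |w|_r; u is a partial isometry since
   u^* u is a projection. *)
Definition polar_decomposition w (u : bidual A) (r : dual A) : Prop :=
  [/\ dpositive r, is_support r (bmul (badj u) u) & w = lact u r].

Definition left_abs (u : bidual A) (r : dual A) : dual A :=
  ract (lact u r) (badj u).

End Bidual.

(* The elements of M(A) are the double centralizers of A; linearity and
   boundedness of the two maps are automatic. *)
Record multiplier (R : realType) (A : cstarAlgebra R) := Multiplier {
  mleft : A -> A;
  mright : A -> A;
  mcentral : forall a b, cmul a (mleft b) = cmul (mright a) b
}.

Section Multiplier.
Variables (R : realType) (A : cstarAlgebra R).
Implicit Types (a b : A) (m n : multiplier A).

Program Definition mone : multiplier A := @Multiplier R A id id _.
Next Obligation. by []. Qed.

Program Definition mmul m n : multiplier A :=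
  @Multiplier R A (mleft m \o mleft n) (mright n \o mright m) _.
Next Obligation. by move=> m n a b /=; rewrite !mcentral. Qed.

Program Definition madj m : multiplier A :=
  @Multiplier R A (fun a => cadj (mright m (cadj a)))
                  (fun a => cadj (mleft m (cadj a))) _.
Next Obligation.
move=> m a b; apply: (can_inj (@cadjK R A)).
by rewrite !cadjM !cadjK mcentral.
Qed.

Program Definition madd m n : multiplier A :=
  @Multiplier R A (fun a => mleft m a + mleft n a)
                  (fun a => mright m a + mright n a) _.
Next Obligation. by move=> m n a b; rewrite cmulDr cmulDl !mcentral. Qed.

Program Definition mscale (k : R[i]) m : multiplier A :=
  @Multiplier R A (fun a => k *: mleft m a) (fun a => k *: mright m a) _.
Next Obligation. by move=> k m a b; rewrite cmulZr cmulZl mcentral. Qed.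

Definition msub m n : multiplier A := madd m (mscale (-1) n).

Program Definition membed a : multiplier A :=
  @Multiplier R A (cmul a) (fun b => cmul b a) _.
Next Obligation. by move=> a b c; rewrite cmulA. Qed.

(* The trace on A of the filter of strict neighbourhoods of m in M(A). *)
Definition strict_nbhs m : set_system A :=
  [set P | exists (s : seq A) (e : R[i]), 0 < e /\
     forall x : A,
       (forall b, b \in s -> `|cmul x b - mleft m b| < e /\
                             `|cmul b x - mright m b| < e) -> P x].

(* The value at m of the strict extension of w to M(A). *)
Definition dual_ext (w : dual A) m : R[i] :=
  lim ((fun x : A => (w x : R[i]^o)) @ strict_nbhs m).

(* For a state w on A, this is N_w as a subset of M(A). *)
Definition null_space (w : dual A) : set (multiplier A) :=
  [set m | dual_ext w (mmul (madj m) m) = 0].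

End Multiplier.
Arguments mone {R A}.

Definition mstar_hom (R : realType) (A B : cstarAlgebra R)
    (f : A -> multiplier B) : Prop :=
  [/\ forall k a b, f (k *: a + b) = madd (mscale k (f a)) (f b),
      forall a b, f (cmul a b) = mmul (f a) (f b)
    & forall a, f (cadj a) = madj (f a)].

Definition mnondegenerate (R : realType) (A B : cstarAlgebra R)
    (f : A -> multiplier B) : Prop :=
  closed_span [set mleft (f a) b | a in setT & b in setT] = setT.

(* n is the value at m of the strict extension to M(A) of f : A -> M(B). *)
Definition strict_ext (R : realType) (A B : cstarAlgebra R)
    (f : A -> multiplier B) (m : multiplier A) (n : multiplier B) : Prop :=
  forall b : B, (fun x => mleft (f x) b) @ strict_nbhs m --> mleft n b /\
                (fun x => mright (f x) b) @ strict_nbhs m --> mright n b.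

Record hilbertSpace (R : realType) := HilbertSpace {
  hilbert_sort :> completeNormedModType (CF R);
  ip : hilbert_sort -> hilbert_sort -> R[i];
  ip_linear : forall k x y z, ip (k *: x + y) z = k * ip x z + ip y z;
  ip_conj : forall x y, ip y x = (ip x y)^*;
  ip_norm : forall x, ip x x = `|x| ^+ 2
}.

Definition bilinear_map (R : realType) (U V W : normedModType (CF R))
    (f : U -> V -> W) : Prop :=
  (forall k x y z, f (k *: x + y) z = k *: f x z + f y z) /\
  (forall k x y z, f z (k *: x + y) = k *: f z x + f z y).

Definition hilbert_tensor (R : realType) (H K HK : hilbertSpace R)
    (h : H -> K -> HK) : Prop :=
  [/\ bilinear_map h,
      forall x1 y1 x2 y2, ip (h x1 y1) (h x2 y2) = ip x1 x2 * ip y1 y2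
    & closed_span [set h x y | x in setT & y in setT] = setT].

Definition is_rep (R : realType) (A : cstarAlgebra R) (H : hilbertSpace R)
    (pi : A -> H -> H) : Prop :=
  [/\ bilinear_map pi,
      forall a, exists K : R[i], forall x, `|pi a x| <= K * `|x|,
      forall a b x, pi (cmul a b) x = pi a (pi b x)
    & forall a x y, ip (pi a x) y = ip x (pi (cadj a) y)].

Definition faithful_rep (R : realType) (A : cstarAlgebra R)
    (H : hilbertSpace R) (pi : A -> H -> H) : Prop :=
  is_rep pi /\ forall a, (forall x, pi a x = 0) -> a = 0.

(* (T, t) is the spatial tensor product of A and B: up to isomorphism, T is the
   closed span of the operators pi1(a) (x) pi2(b) on the Hilbert space tensor
   product H (x) K, for faithful representations pi1 of A on H and pi2 of B
   on K. *)
Definition spatial_tensor (R : realType) (A B T : cstarAlgebra R)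
    (t : A -> B -> T) : Prop :=
  [/\ bilinear_map t,
      forall a b a' b', cmul (t a b) (t a' b') = t (cmul a a') (cmul b b'),
      forall a b, cadj (t a b) = t (cadj a) (cadj b),
      closed_span [set t a b | a in setT & b in setT] = setT
    & exists (H K HK : hilbertSpace R) (h : H -> K -> HK)
             (pi1 : A -> H -> H) (pi2 : B -> K -> K) (pi : T -> HK -> HK),
        [/\ hilbert_tensor h, faithful_rep pi1, faithful_rep pi2,
            faithful_rep pi
          & forall a b x y, pi (t a b) (h x y) = h (pi1 a x) (pi2 b y)]].

Section TensorMaps.
Variables (R : realType) (A B T : cstarAlgebra R) (t : A -> B -> T).

(* w1 (x) w2 is the unique bounded functional with these values on elementary
   tensors. *)
Definition dual_tensor (w1 : dual A) (w2 : dual B) : dual T :=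
  xget dual0 [set w : dual T | forall a b, w (t a b) = w1 a * w2 b].

(* x = m (x) n in M(A (x) B); x is determined by its values on elementary
   tensors, which span a dense subspace. *)
Definition is_mtensor (m : multiplier A) (n : multiplier B)
    (x : multiplier T) : Prop :=
  forall a b, mleft x (t a b) = t (mleft m a) (mleft n b) /\
              mright x (t a b) = t (mright m a) (mright n b).

Definition bounded_linear_map (U V : cstarAlgebra R) (f : U -> V) : Prop :=
  (forall k x y, f (k *: x + y) = k *: f x + f y) /\
  exists K : R[i], forall x, `|f x| <= K * `|x|.

(* n = (w (x) id)(m), with m in M(A (x) B) and n in M(B) *)
Definition is_lslice (w : dual A) (m : multiplier T) (n : multiplier B) : Prop :=
  exists S : T -> B,
    [/\ bounded_linear_map S, forall a b, S (t a b) = w a *: b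
      & strict_ext (fun x => membed (S x)) m n].

(* n = (id (x) w)(m), with m in M(A (x) B) and n in M(A) *)
Definition is_rslice (w : dual B) (m : multiplier T) (n : multiplier A) : Prop :=
  exists S : T -> A,
    [/\ bounded_linear_map S, forall a b, S (t a b) = w b *: a
      & strict_ext (fun x => membed (S x)) m n].

End TensorMaps.

Section Weights.
Variables (R : realType) (A : cstarAlgebra R).
Implicit Types (a b : A) (phi : A -> \bar R).

(* Only the values of phi on positive elements are relevant. *)
Definition is_weight phi : Prop :=
  [/\ forall a, cpositive a -> (0 <= phi a)%E,
      forall a b, cpositive a -> cpositive b -> phi (a + b) = (phi a + phi b)%E
    & forall (r : R) a, 0 <= r -> cpositive a ->
        phi (r%:C%C *: a) = (r%:E * phi a)%E].

Definition finite_positive phi : set A :=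
  [set a | cpositive a /\ (phi a < +oo)%E].

Definition is_proper_weight phi : Prop :=
  [/\ is_weight phi,
      exists2 a, cpositive a & phi a != 0%E,
      closure (finite_positive phi) = [set a | cpositive a]
    & forall r : R, closed [set a | cpositive a /\ (phi a <= r%:E)%E]].

Definition faithful_weight phi : Prop :=
  forall a, cpositive a -> phi a = 0%E -> a = 0.

Definition is_one_parameter_group (s : R -> A -> A) : Prop :=
  [/\ forall r, star_hom (s r),
      forall a, s 0 a = a,
      forall r r' a, s (r + r') a = s r (s r' a)
    & forall a, continuous (fun r : R => s r a)].

(* a is in the domain of the analytic extension s_{i/2}, and b = s_{i/2}(a) *)
Definition is_half_i_extension (s : R -> A -> A) (a b : A) : Prop :=
  exists f : R[i]^o -> A,
    [/\ {within [set z : R[i]^o | 0 <= complex.Im z <= 2^-1], continuous f},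
        forall z : R[i]^o, 0 < complex.Im z < 2^-1 -> derivable f z 1,
        forall r : R, f r%:C%C = s r a
      & f (0 +i* 2^-1)%C = b].

Definition is_KMS_weight phi : Prop :=
  is_proper_weight phi /\
  exists s : R -> A -> A,
    [/\ is_one_parameter_group s,
        forall r a, cpositive a -> phi (s r a) = phi a
      & forall a b, is_half_i_extension s a b ->
          phi (cmul (cadj a) a) = phi (cmul b (cadj b))].

End Weights.

Section Comultiplication.
Variables (R : realType) (A T : cstarAlgebra R) (t : A -> A -> T)
  (Delta : A -> multiplier T).

(* D1 and D2 are Delta (x) id and id (x) Delta; T3 is the triple tensor product,
   seen as (A (x) A) (x) A through t1 and as A (x) (A (x) A) through t2. *)
Definition coassociative : Prop :=
  exists (T3 : cstarAlgebra R) (t1 : T -> A -> T3) (t2 : A -> T -> T3)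
         (D1 D2 : T -> multiplier T3),
    [/\ [/\ spatial_tensor t1, spatial_tensor t2
          & forall a b c, t1 (t a b) c = t2 a (t b c)],
        [/\ mstar_hom D1, mnondegenerate D1
          & forall a b, is_mtensor t1 (Delta a) (membed b) (D1 (t a b))],
        [/\ mstar_hom D2, mnondegenerate D2
          & forall a b, is_mtensor t2 (membed a) (Delta b) (D2 (t a b))]
      & forall a, exists m : multiplier T3,
          strict_ext D1 (Delta a) m /\ strict_ext D2 (Delta a) m].

(* x = Delta(a)(b (x) 1) *)
Definition is_lcancel (a b : A) (x : T) : Prop :=
  exists2 m, is_mtensor t (membed b) mone m & membed x = mmul (Delta a) m.

(* x = Delta(a)(1 (x) b) *)
Definition is_rcancel (a b : A) (x : T) : Prop :=
  exists2 m, is_mtensor t mone (membed b) m & membed x = mmul (Delta a) m.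

Definition cancellation_laws : Prop :=
  [/\ forall a b, exists x, is_lcancel a b x,
      closed_span [set x | exists a b, is_lcancel a b x] = setT,
      forall a b, exists x, is_rcancel a b x
    & closed_span [set x | exists a b, is_rcancel a b x] = setT].

(* phi((w (x) id) Delta(a)) = w(1) phi(a); the slice belongs to A. *)
Definition left_invariant (phi : A -> \bar R) : Prop :=
  forall (w : dual A) (a : A), dpositive w -> finite_positive phi a ->
    exists2 x : A, is_lslice t w (Delta a) (membed x) &
      phi x = ((complex.Re (dual_ext w mone))%:E * phi a)%E.

Definition right_invariant (phi : A -> \bar R) : Prop :=
  forall (w : dual A) (a : A), dpositive w -> finite_positive phi a ->
    exists2 x : A, is_rslice t w (Delta a) (membed x) &
      phi x = ((complex.Re (dual_ext w mone))%:E * phi a)%E.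

End Comultiplication.

Record lcqg (R : realType) := LCQG {
  C0 : cstarAlgebra R;
  C0xC0 : cstarAlgebra R;
  ctens : C0 -> C0 -> C0xC0;
  ctensP : spatial_tensor ctens;
  comult : C0 -> multiplier C0xC0;
  comult_hom : mstar_hom comult;
  comult_nondegenerate : mnondegenerate comult;
  comult_coassociative : coassociative ctens comult;
  comult_cancellation : cancellation_laws ctens comult;
  left_haar : exists phi : C0 -> \bar R,
    [/\ is_KMS_weight phi, faithful_weight phi
      & left_invariant ctens comult phi];
  right_haar : exists psi : C0 -> \bar R,
    [/\ is_KMS_weight psi, faithful_weight psi
      & right_invariant ctens comult psi]
}.

Section QuantumGroup.
Variables (R : realType) (G : lcqg R).
Implicit Types (w : dual (C0 G)).

Definition coamenable : Prop :=
  exists eps : dual (C0 G), forall a,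
    is_lslice (@ctens R G) eps (comult a) (membed a) /\
    is_rslice (@ctens R G) eps (comult a) (membed a).

Definition convolution w1 w2 (a : C0 G) : R[i] :=
  dual_ext (dual_tensor (@ctens R G) w1 w2) (comult a).

Definition idempotent_functional w : Prop :=
  (exists a, w a != 0) /\ forall a, convolution w w a = w a.

Definition contractive_idempotent w : Prop :=
  idempotent_functional w /\ dnorm w <= 1.

Definition idempotent_state w : Prop :=
  idempotent_functional w /\ is_state w.

End QuantumGroup.

(* Main.v *)
(* Write w for the contractive idempotent, w^* for its adjoint x |-> conj(w(x^* )), and
   r, l for the right and left absolute values of w.  Strict extensions are controlled
   through bounds |f(z)|^2 <= s(z z^* ) with s positive; every functional below has one.

   Riesz's theorem for the semi-inner product r(x y^* ) gives v_n with w close to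
   r(. v_n), and l is the limit of r(v_n^* . v_n).  Hence |w(z)|^2 <= r(z z^* ) and
   |w^* (z)|^2 <= l(z z^* ) once ||r|| <= ||w||, which follows by testing w on the
   contractions 2g(1 + g^* g)^-1 for g approximating the partial isometry.  Conversely,
   as ||w|| = 1, the first bound determines r among the positive functionals of norm at
   most 1.  It passes to convolutions, so r * r satisfies it for w * w = w, and r * r = r;
   the same argument applies to (w^*, l).

   If b = (id (x) w)Delta(x), then w * w = w makes Delta(b^* ) - b^* (x) v_n tend to 0 in
   the seminorm of r (x) r, whence (r.c * r.d)(b^* ) = r(c b^* ) w(d).  By the cancellation
   laws, r(d v) = w(d) w^* (x) for v = (id (x) w^* )Delta(x).  If w^* (x) = 1, then
   w = v.r, r(v^* v) = 1, and (r (x) r)(|Delta(v) - v (x) v|^2) = 1 - 1 - 1 + 1 = 0. *)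
Require Import Defs.
From mathcomp Require Import all_boot all_order all_algebra complex.
From mathcomp Require Import boolp classical_sets reals.
From mathcomp Require Import topology normedtype.
From mathcomp Require Import ring lra.

Set Implicit Arguments.
Unset Strict Implicit.
Unset Printing Implicit Defensive.

Import Order.TTheory GRing.Theory Num.Theory.
Import numFieldNormedType.Exports.

Local Open Scope classical_set_scope.
Local Open Scope ring_scope.
Local Notation "x %:C" := (real_complex _ x) (format "x %:C") : ring_scope.
Local Notation "'i" := (Complex 0 1) : ring_scope.

Local Notation CF R := (complex_complex__canonical__Num_NumField R).

Local Notation "a *c b" := (cmul a b) (at level 40, left associativity).

(** * Real-valued moduli and norms *)

(** The data of the statement are raw: double centralizers, [dual_ext] as the limit of a filter,
    tensor functionals picked by [xget], and [u] as a functional on the dual. No extension is known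
    to exist until an estimate provides it. The usable estimate is |f(z)| <= C |k z| for one fixed
    [k] of the algebra. For positive s, the seminorm s(z z^* )^(1/2) satisfies it by a Cohen-type
    factorization, hence so does whatever it dominates. Domination, unlike the choice of [k], passes
    explicitly to tensor products and convolutions, which is why it is the property carried along.
    The algebras have no unit and the representations in [spatial_tensor] are merely injective. Norm
    estimates therefore rest on the isometry of faithful representations, obtained from a square
    root iteration on polynomials in one self-adjoint element. The partial isometry [u] enters only
    through its values: elements of the algebra approximate its action on the cyclic vector of r,
    and the contraction 2g(1 + g^* g)^-1 takes the place of Kaplansky density. *)

Section ComplexModulus.
Variable R : realType.
Implicit Types (z w : R[i]) (x y : R).

Definition cm z : R := complex.Re `|z|.

Lemma rcD x y : (x + y)%:C = x%:C + y%:C :> R[i].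
Proof. exact: rmorphD. Qed.

Lemma rcN x : (- x)%:C = - x%:C :> R[i].
Proof. exact: rmorphN. Qed.

Lemma rcB x y : (x - y)%:C = x%:C - y%:C :> R[i].
Proof. exact: rmorphB. Qed.

Lemma rcM x y : (x * y)%:C = x%:C * y%:C :> R[i].
Proof. exact: rmorphM. Qed.

Lemma rcX x n : (x ^+ n)%:C = x%:C ^+ n :> R[i].
Proof. exact: rmorphXn. Qed.

Lemma cmE z : `|z| = (cm z)%:C.
Proof. by rewrite /cm RRe_real// normr_real. Qed.

Lemma cm_ge0 z : 0 <= cm z.
Proof. by rewrite -lecR -cmE normr_ge0. Qed.

Lemma cmM z w : cm (z * w) = cm z * cm w.
Proof. by apply: complexI; rewrite rmorphM /= -!cmE normrM. Qed.

Lemma cmD z w : cm (z + w) <= cm z + cm w.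
Proof. by rewrite -lecR rmorphD /= -!cmE ler_normD. Qed.

Lemma cmN z : cm (- z) = cm z.
Proof. by rewrite /cm normrN. Qed.

Lemma cmB z w : cm (z - w) = cm (w - z).
Proof. by rewrite -cmN opprB. Qed.

Lemma cm0 : cm 0 = 0.
Proof. by rewrite /cm normr0. Qed.

Lemma cm_real x : cm x%:C = `|x|.
Proof. by rewrite /cm normc_def /= expr0n /= addr0 sqrtr_sqr. Qed.

Lemma cm_nat n : cm n%:R = n%:R.
Proof. by rewrite -(rmorph_nat (real_complex R)) cm_real ger0_norm. Qed.

Lemma cm_eq0 z : cm z = 0 -> z = 0.
Proof. by move=> z0; apply/eqP; rewrite -normr_eq0 cmE z0. Qed.

Lemma cm_le0 z : cm z <= 0 -> z = 0.
Proof. by move=> z0; apply: cm_eq0; apply/eqP; rewrite eq_le z0 cm_ge0. Qed.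

Lemma cmJ z : cm z^* = cm z.
Proof. by rewrite /cm norm_conjC. Qed.

Lemma cm_sqr z : cm z ^+ 2 = complex.Re (z * z^*).
Proof. by apply: complexI; rewrite rmorphXn /= -cmE -normCK RRe_real ?ger0_real ?exprn_ge0. Qed.

Lemma cm_le_sqr z x : 0 <= x -> cm z ^+ 2 <= x ^+ 2 -> cm z <= x.
Proof. by move=> x0; rewrite ler_sqr ?nnegrE ?cm_ge0. Qed.

Lemma Re_le_cm z : complex.Re z <= cm z.
Proof.
rewrite /cm normc_def /= (le_trans (ler_norm _))// -sqrtr_sqr ler_wsqrtr//.
by rewrite lerDl sqr_ge0.
Qed.

Lemma conjR x : (x%:C : R[i])^* = x%:C.
Proof. exact: conjc_real. Qed.

Lemma conjM z w : (z * w)^* = z^* * w^*.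
Proof. exact: rmorphM. Qed.

Lemma conjB z w : (z - w)^* = z^* - w^*.
Proof. exact: rmorphB. Qed.

Lemma ReJ z : complex.Re z^* = complex.Re z.
Proof. by case: z. Qed.

Lemma ReD z w : complex.Re (z + w) = complex.Re z + complex.Re w.
Proof. by case: z; case: w. Qed.

Lemma ReN z : complex.Re (- z) = - complex.Re z.
Proof. by case: z. Qed.

Lemma ReB z w : complex.Re (z - w) = complex.Re z - complex.Re w.
Proof. by rewrite ReD ReN. Qed.

Lemma ReZ x z : complex.Re (x%:C * z) = x * complex.Re z.
Proof. by case: z => a b /=; rewrite mul0r subr0. Qed.

Lemma Re_ge0 z : 0 <= z -> 0 <= complex.Re z.
Proof. by move=> z0; rewrite -lecR RRe_real// ger0_real. Qed.

Lemma ge0_Re z : 0 <= z -> z = (complex.Re z)%:C.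
Proof. by move=> z0; rewrite RRe_real// ger0_real. Qed.

Lemma ge0_cm z : 0 <= z -> cm z = complex.Re z.
Proof. by move=> z0; rewrite /cm ger0_norm. Qed.

Lemma cm_triangle z1 z2 z3 : cm (z1 - z3) <= cm (z1 - z2) + cm (z2 - z3).
Proof. by rewrite (le_trans _ (cmD _ _))// addrA subrK. Qed.

Lemma cm_phase z : exists2 k : R[i], cm k = 1 & k * z = (cm z)%:C.
Proof.
have [->|z0] := eqVneq z 0; first by exists 1; rewrite ?cm0 ?mulr0// (cm_real 1) normr1.
have cz : cm z != 0 by apply: contra_neq z0 => /cm_eq0.
exists ((cm z)^-1%:C * z^*).
  by rewrite cmM cm_real cmJ ger0_norm ?invr_ge0 ?cm_ge0// mulVf.
rewrite -mulrA [_^* * _]mulrC -normCK cmE -rmorphXn -rmorphM /=.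
by rewrite expr2 mulrA mulVf// mul1r.
Qed.

End ComplexModulus.

Section RealNorm.
Variables (R : realType) (V : normedModType (CF R)).
Implicit Types x y z : V.

Definition nm x : R := complex.Re `|x|.

Lemma nmE x : `|x| = (nm x)%:C.
Proof. by rewrite /nm RRe_real// normr_real. Qed.

Lemma nm_ge0 x : 0 <= nm x.
Proof. by rewrite -lecR -nmE normr_ge0. Qed.

Lemma nm_le0 x : nm x <= 0 -> x = 0.
Proof.
move=> x0; apply/eqP; rewrite -normr_eq0 nmE (_ : nm x = 0)//.
by apply/eqP; rewrite eq_le x0 nm_ge0.
Qed.

Lemma nm0 : nm 0 = 0.
Proof. by rewrite /nm normr0. Qed.

Lemma nmD x y : nm (x + y) <= nm x + nm y.
Proof. by rewrite -lecR rmorphD /= -!nmE ler_normD. Qed.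

Lemma nmN x : nm (- x) = nm x.
Proof. by rewrite /nm normrN. Qed.

Lemma nmB x y : nm (x - y) = nm (y - x).
Proof. by rewrite -nmN opprB. Qed.

Lemma nmZ (k : R[i]) x : nm (k *: x) = cm k * nm x.
Proof. by apply: complexI; rewrite rmorphM /= -nmE -cmE -nmE normrZ. Qed.

Lemma nm_triangle x y z : nm (x - z) <= nm (x - y) + nm (y - z).
Proof. by rewrite (le_trans _ (nmD _ _))// addrA subrK. Qed.

Lemma nm_sum (I : Type) (s : seq I) (F : I -> V) :
  nm (\sum_(i <- s) F i) <= \sum_(i <- s) nm (F i).
Proof.
elim: s => [|i s IH]; first by rewrite !big_nil nm0.
by rewrite !big_cons (le_trans (nmD _ _))// lerD2l.
Qed.

End RealNorm.

(** * Convergence with explicit rates *)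

Section Limits.
Variable R : realType.

Lemma le_eps (x y C : R) :
  (forall e, 0 < e -> x <= y + C * e) -> x <= y.
Proof.
move=> xy; apply/ler_addgt0Pr => e e0.
have C1 : 0 < `|C| + 1 by rewrite ltr_wpDl.
apply: (le_trans (xy (e / (`|C| + 1)) (divr_gt0 e0 C1))); rewrite lerD2l.
rewrite mulrA ler_pdivrMr// mulrDr mulr1 [C * e]mulrC.
by rewrite (le_trans (ler_wpM2l (ltW e0) (ler_norm C)))// lerDl ltW.
Qed.

(** One-sided on purpose: [u] serves as an error bound, to be enlarged, added and scaled without
    absolute values. *)
Definition tends0 (u : nat -> R) :=
  forall e, 0 < e -> exists n0, forall n, (n0 <= n)%N -> u n <= e.

Lemma tends0_le (u v : nat -> R) (C : R) :
  tends0 u -> (forall n, v n <= C * u n) -> 0 <= C -> tends0 v.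
Proof.
move=> u0 vu C0 e e0; have C1 : 0 < C + 1 by rewrite ltr_wpDl.
have [n0 un] := u0 (e / (C + 1)) (divr_gt0 e0 C1).
exists n0 => n /un une; apply: (le_trans (vu n)).
apply: (le_trans (ler_wpM2l C0 une)).
by rewrite mulrA ler_pdivrMr// mulrDr mulr1 [C * e]mulrC lerDl ltW.
Qed.

Lemma tends0D (u v : nat -> R) :
  tends0 u -> tends0 v -> tends0 (fun n => u n + v n).
Proof.
move=> u0 v0 e e0; have e2 : 0 < e / 2 by rewrite divr_gt0.
have [m um] := u0 _ e2; have [n vn] := v0 _ e2.
exists (maxn m n) => k; rewrite geq_max => /andP[mk nk].
by rewrite (splitr e) lerD ?um ?vn.
Qed.

Lemma le_tends0 (u : nat -> R) (x y : R) :
  tends0 u -> (forall n, x <= y + u n) -> x <= y.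
Proof.
move=> u0 xu; apply/ler_addgt0Pr => e /u0[n /(_ n (leqnn n)) une].
by rewrite (le_trans (xu n))// lerD2l.
Qed.

Lemma tends0_inv : tends0 (fun n => n.+1%:R^-1).
Proof.
move=> e e0; have ei : 0 < e^-1 by rewrite invr_gt0.
have := archi_boundP (ltW ei); set n0 := Num.bound _ => n0P; exists n0 => n n0n.
rewrite -[e]invrK lef_pV2 ?posrE ?invr_gt0// ltW// (lt_le_trans n0P)//.
by rewrite ler_nat leqW.
Qed.

Lemma tends0_geo : tends0 (fun n => 2^-1 ^+ n).
Proof.
apply: (tends0_le (C := 1) tends0_inv) => // n; rewrite mul1r exprVn.
by rewrite lef_pV2 ?posrE ?exprn_gt0// -natrX ler_nat ltn_expl.
Qed.

Lemma cvg_rate (V : completeNormedModType (CF R)) (u : nat -> V) (rho : nat -> R) :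
  (forall m n, (m <= n)%N -> nm (u n - u m) <= rho m) -> tends0 rho ->
  exists l, forall n, nm (u n - l) <= rho n.
Proof.
move=> uC rho0.
have cu : cvg (u @ \oo).
  apply/cauchy_cvgP/cauchyP => /= e e0.
  have eR : 0 < complex.Re e by move: e0; rewrite ltcE => /andP[].
  have eE : e = (complex.Re e)%:C by apply: ge0_Re; exact: ltW.
  have [n0 hn0] := rho0 (complex.Re e / 2) (divr_gt0 eR (ltr0Sn _ _)).
  exists (u n0), n0 => // n /= n0n.
  rewrite -ball_normE /= nmE eE ltcR nmB (le_lt_trans (uC _ _ n0n))//.
  by rewrite (le_lt_trans (hn0 _ (leqnn _)))// ltr_pdivrMr// ltr_pMr// ltr1n.
exists (lim (u @ \oo)) => n; apply/ler_addgt0Pr => e e0.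
have /cvgrPdist_lt/(_ e%:C) := cu; rewrite ltcR => /(_ e0)[N _ uN].
have := uN (maxn n N) (leq_maxr _ _); rewrite nmE ltcR => /ltW uN'.
rewrite (le_trans (nm_triangle _ (u (maxn n N)) _))// lerD//.
  by rewrite nmB uC// leq_maxl.
by rewrite nmB.
Qed.

Lemma cvg_rateR (u : nat -> R) (rho : nat -> R) :
  (forall m n, (m <= n)%N -> `|u n - u m| <= rho m) -> tends0 rho ->
  exists l, forall n, `|u n - l| <= rho n.
Proof.
move=> uC rho0.
have cu : cvg (u @ \oo).
  apply/cauchy_cvgP/cauchyP => /= e e0.
  have [n0 hn0] := rho0 (e / 2) (divr_gt0 e0 (ltr0Sn _ _)).
  exists (u n0), n0 => // n /= n0n.
  rewrite -ball_normE /= distrC (le_lt_trans (uC _ _ n0n))//.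
  by rewrite (le_lt_trans (hn0 _ (leqnn _)))// ltr_pdivrMr// ltr_pMr// ltr1n.
exists (lim (u @ \oo)) => n; apply/ler_addgt0Pr => e e0.
have /cvgrPdist_lt/(_ e e0)[N _ uN] := cu.
have := uN (maxn n N) (leq_maxr _ _) => /ltW uN'.
rewrite (le_trans (ler_distD (u (maxn n N)) _ _))// lerD//.
  by rewrite distrC uC// leq_maxl.
by rewrite distrC.
Qed.

(** Real and imaginary parts converge separately; the factor 2 adds their two errors. *)
Lemma cvg_rateC (u : nat -> R[i]) (rho : nat -> R) :
  (forall m n, (m <= n)%N -> cm (u n - u m) <= rho m) -> tends0 rho ->
  exists l, forall n, cm (u n - l) <= 2 * rho n.
Proof.
move=> uC rho0.
have Re_le (z : R[i]) : `|complex.Re z| <= cm z.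
  by rewrite ler_norml Re_le_cm lerNl -ReN -cmN Re_le_cm.
have Im_le (z : R[i]) : `|complex.Im z| <= cm z.
  rewrite /cm normc_def /= -sqrtr_sqr ler_wsqrtr//.
  by rewrite lerDr sqr_ge0.
have ImB (z w : R[i]) : complex.Im (z - w) = complex.Im z - complex.Im w.
  by case: z; case: w.
have [a ua] : exists l, forall n, `|complex.Re (u n) - l| <= rho n.
  apply: cvg_rateR rho0 => m n mn; rewrite -ReB.
  exact: le_trans (Re_le _) (uC _ _ mn).
have [b ub] : exists l, forall n, `|complex.Im (u n) - l| <= rho n.
  apply: cvg_rateR rho0 => m n mn; rewrite -ImB.
  exact: le_trans (Im_le _) (uC _ _ mn).
exists (Complex a b) => n; set z := u n - _.
have -> : z = (complex.Re z)%:C + 'i * (complex.Im z)%:C by exact: complexE.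
rewrite (le_trans (cmD _ _))// cmM !cm_real.
have -> : cm ('i : R[i]) = 1.
  by rewrite /cm normc_def /= expr0n add0r expr1n sqrtr1.
rewrite mul1r mulr_natl mulr2n lerD//.
  by rewrite /z ReB; exact: ua.
by rewrite /z ImB; exact: ub.
Qed.

End Limits.

(* Reflexive decision of identities between linear combinations of atoms of a
   module; the coefficients are compared with ring. *)
Section LinearCombinations.
Variables (K : comNzRingType) (V : lmodType K).

Inductive lexp :=
  LAtom of nat | LZero | LAdd of lexp & lexp | LOpp of lexp | LScale of K & lexp.

Fixpoint leval (env : seq V) e : V :=
  match e with
  | LAtom n => nth 0 env n
  | LZero => 0
  | LAdd e1 e2 => leval env e1 + leval env e2
  | LOpp e1 => - leval env e1
  | LScale k e1 => k *: leval env e1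
  end.

Fixpoint lcoef e n : K :=
  match e with
  | LAtom m => if PeanoNat.Nat.eqb m n then 1 else 0
  | LZero => 0
  | LAdd e1 e2 => lcoef e1 n + lcoef e2 n
  | LOpp e1 => - lcoef e1 n
  | LScale k e1 => k * lcoef e1 n
  end.

Lemma leval_coef (env : seq V) e :
  leval env e = \sum_(i < size env) lcoef e i *: env`_i.
Proof.
elim: e => [m||e1 IH1 e2 IH2|e1 IH|k e1 IH] /=.
- have [ms|ms] := ltnP m (size env); last first.
    rewrite nth_default// big1// => i _.
    case: PeanoNat.Nat.eqb_spec => [mi|_]; last by rewrite scale0r.
    by have := ltn_ord i; rewrite -mi ltnNge ms.
  rewrite (bigD1 (Ordinal ms))//= PeanoNat.Nat.eqb_refl scale1r big1 ?addr0//.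
  move=> i im; case: PeanoNat.Nat.eqb_spec => [mi|_]; last by rewrite scale0r.
  by case/eqP: im; apply: val_inj.
- by rewrite big1// => i _; rewrite scale0r.
- by rewrite IH1 IH2 -big_split; apply: eq_bigr => i _; rewrite scalerDl.
- by rewrite IH -sumrN; apply: eq_bigr => i _; rewrite scaleNr.
- by rewrite IH scaler_sumr; apply: eq_bigr => i _; rewrite scalerA.
Qed.

Fixpoint lcoef_eq e1 e2 n : Prop :=
  if n is m.+1 then lcoef_eq e1 e2 m /\ lcoef e1 m = lcoef e2 m else True.

Lemma leval_eq (env : seq V) e1 e2 :
  lcoef_eq e1 e2 (size env) -> leval env e1 = leval env e2.
Proof.
rewrite !leval_coef; move: (size env) => n; set u := nth 0 env.
elim: n => [|n IH] /=; first by rewrite !big_ord0.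
by rewrite !big_ord_recr /= => -[/IH-> ->].
Qed.

End LinearCombinations.

(** Atoms are compared syntactically; the inner [match goal] lets this test run in the middle of a
    tactic that returns a term. *)
Ltac lmod_mem x l :=
  match l with
  | nil => constr:(false)
  | cons ?y ?t =>
    match goal with
    | _ => let _ := match goal with _ => constr_eq x y end in constr:(true)
    | _ => lmod_mem x t
    end
  end.

Ltac lmod_atoms e l :=
  lazymatch e with
  | ?a + ?b => let l1 := lmod_atoms a l in lmod_atoms b l1
  | - ?a => lmod_atoms a l
  | _ *: ?a => lmod_atoms a l
  | 0 => l
  | _ => let b := lmod_mem e l in
         lazymatch b with true => l | false => constr:(cons e l) end
  end.

Ltac lmod_index x l :=
  match l with
  | cons ?y ?t =>
    match goal with
    | _ => let _ := match goal with _ => constr_eq x y end in constr:(0%N)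
    | _ => let n := lmod_index x t in constr:(S n)
    end
  end.

Ltac lmod_reify K e l :=
  lazymatch e with
  | ?a + ?b => let ea := lmod_reify K a l in let eb := lmod_reify K b l in
               constr:(@LAdd K ea eb)
  | - ?a => let ea := lmod_reify K a l in constr:(@LOpp K ea)
  | ?k *: ?a => let ea := lmod_reify K a l in constr:(@LScale K k ea)
  | 0 => constr:(@LZero K)
  | _ => let n := lmod_index e l in constr:(@LAtom K n)
  end.

Ltac lmodule_over K V :=
  lazymatch goal with
  | |- ?a = ?b =>
    let l0 := lmod_atoms a (@nil V) in
    let l := lmod_atoms b l0 in
    let ea := lmod_reify K a l in
    let eb := lmod_reify K b l in
    refine (@leval_eq K V l ea eb _); cbn [lcoef_eq lcoef size PeanoNat.Nat.eqb];
    repeat split; ring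
  end.

(** * Semi-inner products *)

Section Forms.
Variables (R : realType) (E : lmodType R[i]).
Implicit Types (x y z : E) (k : R[i]).

Record psd (B : E -> E -> R[i]) : Prop := Psd {
  psd_linear : forall k x y z, B (k *: x + y) z = k * B x z + B y z;
  psd_conj : forall x y, B y x = (B x y)^*;
  psd_ge0 : forall x, 0 <= B x x }.

(** Positivity makes the form real at x + y and at ix + y; comparing imaginary parts there yields
    the hermitian symmetry. *)
Lemma psd_sesqui (B : E -> E -> R[i]) :
  (forall k x y z, B (k *: x + y) z = k * B x z + B y z) ->
  (forall k x y z, B z (k *: x + y) = k^* * B z x + B z y) ->
  (forall x, 0 <= B x x) -> psd B.
Proof.
move=> Bl Br B0; split=> // x y.
have exp k : B (k *: x + y) (k *: x + y) =
    k * k^* * B x x + k * B x y + (k^* * B y x + B y y).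
  by rewrite Bl !Br mulrDr mulrA.
have im z : complex.Im (B z z) = 0.
  by rewrite (ger0_Im (B0 z)).
have := im (1 *: x + y); have := im ('i *: x + y).
rewrite !exp; have := im x; have := im y.
have i1 : ('i : R[i])^* = - 'i by apply/eqP; rewrite eq_complex /= oppr0 !eqxx.
rewrite rmorph1 i1.
case: (B x x) => [a1 b1]; case: (B y y) => [a2 b2].
case: (B x y) => [a3 b3]; case: (B y x) => [a4 b4] /= -> -> H1 H2.
apply/eqP; rewrite eq_complex /=; apply/andP; split; apply/eqP; lra.
Qed.

Section Form.
Variable B : E -> E -> R[i].
Hypothesis Bpsd : psd B.

Lemma psdDl x y z : B (x + y) z = B x z + B y z.
Proof. by rewrite -{1}[x]scale1r (psd_linear Bpsd) mul1r. Qed.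

Lemma psd0l z : B 0 z = 0.
Proof. by apply: (addrI (B 0 z)); rewrite -psdDl !addr0. Qed.

Lemma psdZl k x z : B (k *: x) z = k * B x z.
Proof. by rewrite -[k *: x]addr0 (psd_linear Bpsd) psd0l addr0. Qed.

Lemma psdNl x z : B (- x) z = - B x z.
Proof. by rewrite -scaleN1r psdZl mulN1r. Qed.

Lemma psdBl x y z : B (x - y) z = B x z - B y z.
Proof. by rewrite psdDl psdNl. Qed.

Lemma psdDr x y z : B z (x + y) = B z x + B z y.
Proof. by rewrite (psd_conj Bpsd) psdDl rmorphD /= -!(psd_conj Bpsd). Qed.

Lemma psd0r z : B z 0 = 0.
Proof. by rewrite (psd_conj Bpsd) psd0l rmorph0. Qed.

Lemma psdZr k x z : B z (k *: x) = k^* * B z x.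
Proof. by rewrite (psd_conj Bpsd) psdZl rmorphM /= -(psd_conj Bpsd). Qed.

Lemma psdNr x z : B z (- x) = - B z x.
Proof. by rewrite (psd_conj Bpsd) psdNl rmorphN /= -(psd_conj Bpsd). Qed.

Lemma psdBr x y z : B z (x - y) = B z x - B z y.
Proof. by rewrite psdDr psdNr. Qed.

Lemma psd_suml (I : Type) (s : seq I) (F : I -> E) z :
  B (\sum_(i <- s) F i) z = \sum_(i <- s) B (F i) z.
Proof.
elim: s => [|i s IH]; first by rewrite !big_nil psd0l.
by rewrite !big_cons psdDl IH.
Qed.

Lemma psd_sumr (I : Type) (s : seq I) (F : I -> E) z :
  B z (\sum_(i <- s) F i) = \sum_(i <- s) B z (F i).
Proof.
elim: s => [|i s IH]; first by rewrite !big_nil psd0r.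
by rewrite !big_cons psdDr IH.
Qed.

Definition sq x : R := complex.Re (B x x).

Lemma sq_ge0 x : 0 <= sq x.
Proof. exact/Re_ge0/(psd_ge0 Bpsd). Qed.

Lemma sqE x : B x x = (sq x)%:C.
Proof. exact/ge0_Re/(psd_ge0 Bpsd). Qed.

Lemma sqD x y : sq (x + y) = sq x + 2 * complex.Re (B x y) + sq y.
Proof.
rewrite /sq psdDl !psdDr !ReD (psd_conj Bpsd x y) ReJ; lra.
Qed.

Lemma sqN x : sq (- x) = sq x.
Proof. by rewrite /sq psdNl psdNr opprK. Qed.

Lemma sqB x y : sq (x - y) = sq x - 2 * complex.Re (B x y) + sq y.
Proof. by rewrite sqD sqN psdNr ReN mulrN. Qed.

Lemma sqZ k x : sq (k *: x) = cm k ^+ 2 * sq x.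
Proof.
rewrite /sq psdZl psdZr mulrA sqE -normCK cmE -rmorphXn -rmorphM /=.
by [].
Qed.

Lemma psd_CS x y : cm (B x y) ^+ 2 <= sq x * sq y.
Proof.
set b := B x y.
have key (t : R) : 0 <= sq x - 2 * t * cm b ^+ 2 + t ^+ 2 * cm b ^+ 2 * sq y.
  apply: le_trans (sq_ge0 (x - (t%:C * b) *: y)) _.
  rewrite sqB sqZ psdZr -/b rmorphM /= conjR -mulrA [_^* * _]mulrC -normCK.
  rewrite cmE -rmorphXn -rmorphM /= cmM cm_real exprMn real_normK ?num_real//.
  by rewrite mulrA.
have [y0|y0] := eqVneq (sq y) 0; last first.
  have ygt : 0 < sq y by rewrite lt0r y0 sq_ge0.
  have := key (sq y)^-1.
  have -> : sq x - 2 * (sq y)^-1 * cm b ^+ 2 + (sq y)^-1 ^+ 2 * cm b ^+ 2 * sq y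
     = (sq x * sq y - cm b ^+ 2) / sq y by field.
  by rewrite pmulr_lge0 ?invr_gt0// subr_ge0.
rewrite y0 mulr0; have [b0|b0] := eqVneq (cm b ^+ 2) 0; first by rewrite b0.
have bgt : 0 < cm b ^+ 2 by rewrite lt0r b0 sqr_ge0.
(* With y null the quadratic term is gone, and this [t] turns the rest into - sq x - 2. *)
have := key ((sq x + 1) / cm b ^+ 2).
rewrite y0 mulr0 addr0 -mulrA divfK// => h.
by exfalso; have := sq_ge0 x; lra.
Qed.

Definition sn x : R := Num.sqrt (sq x).

Lemma sn_ge0 x : 0 <= sn x. Proof. exact: sqrtr_ge0. Qed.

Lemma sn_sqr x : sn x ^+ 2 = sq x.
Proof. by rewrite sqr_sqrtr ?sq_ge0. Qed.

Lemma sn_CS x y : cm (B x y) <= sn x * sn y.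
Proof.
apply: cm_le_sqr; first by rewrite mulr_ge0 ?sn_ge0.
by rewrite exprMn !sn_sqr psd_CS.
Qed.

Lemma snD x y : sn (x + y) <= sn x + sn y.
Proof.
rewrite -ler_sqr ?nnegrE ?addr_ge0 ?sn_ge0// sqrrD !sn_sqr sqD.
have := le_trans (Re_le_cm _) (sn_CS x y); lra.
Qed.

Lemma sn_le x (M : R) : 0 <= M -> (sn x <= M) = (sq x <= M ^+ 2).
Proof. by move=> M0; rewrite -sn_sqr ler_sqr ?nnegrE ?sn_ge0. Qed.

Lemma psd_zero x y : sq y = 0 -> B x y = 0.
Proof.
move=> y0; apply: cm_le0; apply: (le_trans (sn_CS x y)).
by rewrite /sn y0 sqrtr0 mulr0.
Qed.

(* Minimizing |v|^2 - 2 Re F(v) gives an approximate Riesz vector without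
   completing E. *)
Lemma riesz_approx (F : E -> R[i]) (K e : R) :
  (forall k x y, F (k *: x + y) = k * F x + F y) -> 0 <= K -> 0 < e ->
  (forall x, cm (F x) <= K * sn x) ->
  exists v, sn v <= K + e /\ forall x, cm (F x - B x v) <= e * sn x.
Proof.
move=> Fl K0 e0 FK.
pose J v := sq v - 2 * complex.Re (F v).
have Jlb v : - K ^+ 2 <= J v.
  have : complex.Re (F v) <= K * sn v := le_trans (Re_le_cm _) (FK v).
  have := sqr_ge0 (sn v - K); rewrite /J -sn_sqr; nra.
have hJ : has_inf (range J).
  by split; [exists (J 0), 0 | exists (- K ^+ 2) => _ [v _ <-]; exact: Jlb].
have [_ [v _ <-] hv] := inf_adherent (exprn_gt0 2 e0) hJ.
have Jmin w : J v <= J w + e ^+ 2.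
  rewrite (le_trans (ltW hv))// lerD2r; apply: ge_inf; last by exists w.
  by case: hJ.
have F0 : F 0 = 0 by have := Fl 1 0 0; rewrite scale1r addr0 mul1r => /esym /(canRL (addrK _)); rewrite subrr.
have FZ k x : F (k *: x) = k * F x by rewrite -[k *: x]addr0 Fl F0 addr0.
have key x : cm (F x - B x v) <= e * sn x.
  pose g := F x - B x v.
  (* Moving v by s conj(g) x gains 2 s |g|^2 in the linear terms and costs s^2 |g|^2 |x|^2;
     near-minimality lets the gain exceed the cost by at most e^2. *)
  have pert (s : R) : 2 * s * cm g ^+ 2 <= s ^+ 2 * cm g ^+ 2 * sq x + e ^+ 2.
    have := Jmin ((s%:C * g^*) *: x + v).
    rewrite /J Fl sqD sqZ psdZl ReD.
    have -> : s%:C * g^* * F x = s%:C * (g * g^*) + s%:C * g^* * B x v.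
      by rewrite /g; ring.
    rewrite ReD ReZ -cm_sqr cmM cm_real cmJ exprMn real_normK ?num_real//; lra.
  have [x0|x0] := eqVneq (sq x) 0.
    have : cm g ^+ 2 <= 0.
      apply/ler_addgt0Pr => d d0; rewrite add0r.
      (* A null direction costs nothing, so a large s = e^2 / d forces g = 0. *)
      have := pert (e ^+ 2 / d); rewrite x0 mulr0 add0r => h.
      have e2 : 0 < e ^+ 2 by exact: exprn_gt0.
      have : 2 * (e ^+ 2 / d) * cm g ^+ 2 = (2 * cm g ^+ 2 / d) * e ^+ 2.
        by ring.
      move=> hh; move: h; rewrite hh -[leRHS]mul1r ler_pM2r// ler_pdivrMr// mul1r.
      have := sqr_ge0 (cm g); lra.
    move=> g0; rewrite (_ : cm _ = 0) ?mulr_ge0 ?sn_ge0 ?(ltW e0)//.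
    by apply/eqP; rewrite -sqrf_eq0 eq_le g0 sqr_ge0.
  have xgt : 0 < sq x by rewrite lt0r x0 sq_ge0.
  apply: cm_le_sqr; first by rewrite mulr_ge0 ?sn_ge0 ?ltW.
  rewrite exprMn sn_sqr -/g; have := pert (sq x)^-1.
  have -> : (sq x)^-1 ^+ 2 * cm g ^+ 2 * sq x = cm g ^+ 2 / sq x by field.
  rewrite -mulrA mulrC -ler_pdivrMr// mulrC; lra.
exists v; split=> //.
have [->|v0] := eqVneq (sn v) 0; first by rewrite addr_ge0// ltW.
have vgt : 0 < sn v by rewrite lt0r v0 sn_ge0.
rewrite -(ler_pM2r vgt) -expr2 sn_sqr mulrDl.
have -> : sq v = complex.Re (F v) - complex.Re (F v - B v v) by rewrite ReB /sq; ring.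
rewrite lerD ?(le_trans (Re_le_cm _) (FK v))//.
by rewrite -ReN (le_trans (Re_le_cm _))// cmN key.
Qed.

End Form.

(** Cauchy-Schwarz for the positive form B(Sx, y) at x and Sx, followed by the upper bound at Sx. It
    gives S^2 <= M S for 0 <= S <= M without a square root of S. *)
Lemma psd_pos_sqr (B : E -> E -> R[i]) (S : E -> E) (M : R) x :
  psd B -> (forall k x y, S (k *: x + y) = k *: S x + S y) ->
  (forall x y, B (S x) y = B x (S y)) ->
  (forall x, 0 <= complex.Re (B (S x) x) <= M * sq B x) ->
  sq B (S x) <= M * complex.Re (B (S x) x).
Proof.
move=> Bpsd Sl Ss SM; have Spsd : psd (fun x y => B (S x) y).
  split=> [k u v w|u v|u]; first by rewrite Sl (psd_linear Bpsd).
    by rewrite Ss (psd_conj Bpsd).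
  have /complex_realP[r rE] : B (S u) u \is Num.real.
    by rewrite CrealE -(psd_conj Bpsd) Ss.
  by rewrite rE ler0c; have /andP[+ _] := SM u; rewrite rE.
have [->|x0] := eqVneq (sq B (S x)) 0.
  have /andP[b0 bM] := SM x; have [x0|x0] := eqVneq (sq B x) 0.
    by move: b0 bM; rewrite x0 mulr0 => b0 bM; rewrite (_ : complex.Re _ = 0) ?mulr0//; lra.
  have M0 : 0 <= M.
    by have := le_trans b0 bM; rewrite pmulr_lge0// lt0r x0 sq_ge0.
  exact: mulr_ge0.
have xgt : 0 < sq B (S x) by rewrite lt0r x0 sq_ge0.
have : cm (B (S x) (S x)) ^+ 2 <=
    complex.Re (B (S x) x) * complex.Re (B (S (S x)) (S x)).
  exact: (psd_CS Spsd).
rewrite (sqE Bpsd) cm_real ger0_norm ?(sq_ge0 Bpsd)//.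
have /andP[_ h] := SM (S x); have /andP[h0 _] := SM x.
move=> h1; rewrite -(ler_pM2r xgt) -expr2 (le_trans h1)// -mulrA mulrCA.
by rewrite ler_wpM2l.
Qed.

End Forms.

(** The Schur product theorem by Gaussian elimination, one vector at a time. If al = B1(a, a) is
    nonzero, subtracting from each first component its projection on [a] splits off the square al
    B2(c, c); if al = 0, Cauchy-Schwarz kills every term that involves [a]. *)
Lemma schur_psd (R : realType) (E1 E2 : lmodType R[i])
    (B1 : E1 -> E1 -> R[i]) (B2 : E2 -> E2 -> R[i]) (s : seq (E1 * E2)) :
  psd B1 -> psd B2 ->
  0 <= \sum_(p <- s) \sum_(q <- s) B1 p.1 q.1 * B2 p.2 q.2.
Proof.
move=> H1 H2; move: {2}(size s) (erefl (size s)) => n; elim: n s => [|n IH].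
  by case=> // _; rewrite big_nil.
case=> [//|[a b] s] /= [sn]; set al := B1 a a.
have step : \sum_(p <- (a, b) :: s) \sum_(q <- (a, b) :: s) B1 p.1 q.1 * B2 p.2 q.2
  = al * B2 b b + \sum_(q <- s) B1 a q.1 * B2 b q.2
    + \sum_(p <- s) B1 p.1 a * B2 p.2 b
    + \sum_(p <- s) \sum_(q <- s) B1 p.1 q.1 * B2 p.2 q.2.
  rewrite big_cons big_cons /= -!addrA; congr (_ + (_ + _)).
  by rewrite -big_split; apply: eq_bigr => p _; rewrite big_cons.
rewrite step; have [al0|al0] := eqVneq al 0.
  have z1 x : B1 x a = 0 by apply: (psd_zero H1); rewrite /sq -/al al0.
  have z2 x : B1 a x = 0 by rewrite (psd_conj H1) z1 rmorph0.
  rewrite al0 mul0r add0r big1 => [|q _]; last by rewrite z2 mul0r.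
  rewrite add0r big1 => [|q _]; last by rewrite z1 mul0r.
  by rewrite add0r IH.
have alr : al^* = al by rewrite -(psd_conj H1).
pose k x := B1 x a / al.
pose c := b + \sum_(q <- s) k q.1 *: q.2.
pose s' := [seq (p.1 - k p.1 *: a, p.2) | p <- s].
have alge : 0 <= al by exact: psd_ge0.
suff -> : al * B2 b b + \sum_(q <- s) B1 a q.1 * B2 b q.2
    + \sum_(p <- s) B1 p.1 a * B2 p.2 b
    + \sum_(p <- s) \sum_(q <- s) B1 p.1 q.1 * B2 p.2 q.2
   = al * B2 c c + \sum_(p <- s') \sum_(q <- s') B1 p.1 q.1 * B2 p.2 q.2.
  rewrite addr_ge0// ?mulr_ge0// ?(psd_ge0 H2)// IH// size_map.
  by rewrite sn.
have -> : \sum_(p <- s') \sum_(q <- s') B1 p.1 q.1 * B2 p.2 q.2 =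
  \sum_(p <- s) \sum_(q <- s) B1 p.1 q.1 * B2 p.2 q.2 -
  \sum_(p <- s) \sum_(q <- s) al * (k p.1 * (k q.1)^* * B2 p.2 q.2).
  rewrite -sumrB big_map; apply: eq_bigr => p _.
  rewrite -sumrB big_map; apply: eq_bigr => q _ /=.
  rewrite (psdBl H1) !(psdBr H1) !(psdZl H1) !(psdZr H1) -/al.
  rewrite /k rmorphM /= fmorphV /= alr -(psd_conj H1).
  by field.
rewrite /c (psdDl H2) !(psdDr H2) (psd_sumr H2) !(psd_suml H2).
have -> : \sum_(i <- s) B2 (k i.1 *: i.2) (\sum_(q <- s) k q.1 *: q.2) =
  \sum_(p <- s) \sum_(q <- s) (k p.1 * (k q.1)^* * B2 p.2 q.2).
  apply: eq_bigr => p _; rewrite (psd_sumr H2); apply: eq_bigr => q _.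
  by rewrite (psdZl H2) (psdZr H2) mulrA.
have -> : \sum_(q <- s) B1 a q.1 * B2 b q.2 = al * \sum_(i <- s) B2 b (k i.1 *: i.2).
  rewrite mulr_sumr; apply: eq_bigr => q _.
  rewrite (psdZr H2) /k rmorphM /= fmorphV /= alr -(psd_conj H1).
  by field.
have -> : \sum_(p <- s) B1 p.1 a * B2 p.2 b = al * \sum_(i <- s) B2 (k i.1 *: i.2) b.
  by rewrite mulr_sumr; apply: eq_bigr => q _; rewrite (psdZl H2) /k; field.
have -> : \sum_(p <- s) \sum_(q <- s) al * (k p.1 * (k q.1)^* * B2 p.2 q.2) =
  al * \sum_(p <- s) \sum_(q <- s) (k p.1 * (k q.1)^* * B2 p.2 q.2).
  by rewrite mulr_sumr; apply: eq_bigr => p _; rewrite mulr_sumr.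
ring.
Qed.

(** * Polynomials in an operator *)

Section PolyOperator.
Variables (R : realType) (E : normedModType (CF R)) (T : E -> E).
Hypothesis Tlin : forall (k : R[i]) x y, T (k *: x + y) = k *: T x + T y.
Implicit Types (p q g : {poly R}) (x y z : E).

Definition pev p z : E := \sum_(i < size p) (p`_i)%:C *: iter i T z.

Lemma pev_widen p z n : (size p <= n)%N ->
  pev p z = \sum_(i < n) (p`_i)%:C *: iter i T z.
Proof.
move=> pn; rewrite /pev -!(big_mkord xpredT (fun i => (p`_i)%:C *: iter i T z)).
rewrite (big_cat_nat (n := size p) (p := n))//= [X in _ = _ + X]big_nat_cond.
rewrite [X in _ = _ + X]big1 ?addr0// => i /andP[/andP[pi _] _].
by rewrite nth_default// scale0r.
Qed.

Lemma pevD p q z : pev (p + q) z = pev p z + pev q z.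
Proof.
set n := maxn (size p) (size q).
rewrite (@pev_widen _ _ n) ?(leq_trans (size_polyD _ _))//.
rewrite (@pev_widen p _ n) ?leq_maxl// (@pev_widen q _ n) ?leq_maxr//.
rewrite -big_split; apply: eq_bigr => i _.
by rewrite coefD rmorphD scalerDl.
Qed.

Lemma pevZ (c : R) p z : pev (c *: p) z = c%:C *: pev p z.
Proof.
rewrite (@pev_widen _ _ (size p)) ?size_scale_leq// /pev scaler_sumr.
by apply: eq_bigr => i _; rewrite coefZ rmorphM scalerA.
Qed.

Lemma pevN p z : pev (- p) z = - pev p z.
Proof. by rewrite -scaleN1r pevZ rmorphN1 scaleN1r. Qed.

Lemma pevB p q z : pev (p - q) z = pev p z - pev q z.
Proof. by rewrite pevD pevN. Qed.

Lemma pevC (c : R) z : pev c%:P z = c%:C *: z.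
Proof.
by rewrite (@pev_widen _ _ 1) ?size_polyC_leq1// big_ord1 coefC eqxx.
Qed.

Lemma pev1 z : pev 1 z = z.
Proof. by rewrite -polyC1 pevC scale1r. Qed.

Lemma T0 : T 0 = 0.
Proof. by apply: (addrI (T 0)); rewrite -{1}[T 0]scale1r -Tlin !addr0 scaler0. Qed.

Lemma Tsum n (F : 'I_n -> E) (c : 'I_n -> R[i]) :
  T (\sum_(i < n) c i *: F i) = \sum_(i < n) c i *: T (F i).
Proof.
elim: n F c => [|n IH] F c; first by rewrite !big_ord0 T0.
by rewrite !big_ord_recl Tlin IH.
Qed.

Lemma pevMX p z : pev (p * 'X) z = T (pev p z).
Proof.
have [->|p0] := eqVneq p 0; first by rewrite mul0r /pev size_poly0 !big_ord0 T0.
rewrite {1}/pev size_mulX// big_ord_recl coefMX eqxx scale0r add0r /pev Tsum.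
by apply: eq_bigr => i _; rewrite coefMX /=.
Qed.

Lemma pevX z : pev 'X z = T z.
Proof. by rewrite -[X in pev X]mul1r pevMX pev1. Qed.

Lemma pevM p q z : pev (p * q) z = pev p (pev q z).
Proof.
elim/poly_ind: p => [|p c IH]; first by rewrite mul0r -polyC0 !pevC !scale0r.
by rewrite mulrDl mulrAC pevD pevMX IH pevD pevMX mul_polyC pevZ pevC.
Qed.

Lemma pev_comm p z : pev p (T z) = T (pev p z).
Proof. by rewrite -pevX -pevM pevMX. Qed.

Lemma pev_linear p (k : R[i]) x y : pev p (k *: x + y) = k *: pev p x + pev p y.
Proof.
elim/poly_ind: p => [|p c IH]; first by rewrite -polyC0 !pevC !scale0r scaler0 addr0.
rewrite !pevD !pevMX IH Tlin !pevC !scalerDr !scalerA [c%:C * k]mulrC.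
by rewrite addrACA.
Qed.

Definition pevb p (M : R) := forall z, nm (pev p z) <= M * nm z.

Lemma pevb_le p M N : M <= N -> pevb p M -> pevb p N.
Proof. by move=> MN pM z; rewrite (le_trans (pM z))// ler_wpM2r// nm_ge0. Qed.

Lemma pevbD p q M N : pevb p M -> pevb q N -> pevb (p + q) (M + N).
Proof. by move=> pM qN z; rewrite pevD mulrDl (le_trans (nmD _ _))// lerD. Qed.

Lemma pevbN p M : pevb p M -> pevb (- p) M.
Proof. by move=> pM z; rewrite pevN nmN. Qed.

Lemma pevbZ (c : R) p M : pevb p M -> pevb (c *: p) (`|c| * M).
Proof. by move=> pM z; rewrite pevZ nmZ cm_real -mulrA ler_wpM2l. Qed.

Lemma pevbM p q M N : 0 <= M -> pevb p M -> pevb q N -> pevb (p * q) (M * N).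
Proof.
by move=> M0 pM qN z; rewrite pevM (le_trans (pM _))// -mulrA ler_wpM2l.
Qed.

Lemma pevb1 : pevb 1 1.
Proof. by move=> z; rewrite pev1 mul1r. Qed.

Lemma pevb_lim p (u : nat -> R) (M : R) :
  tends0 u -> (forall n, pevb p (M + u n)) -> pevb p M.
Proof.
move=> u0 pu z; apply: (@le_tends0 _ (fun n => nm z * u n)).
  by apply: (tends0_le (C := nm z) u0) => [n|]; [exact: lexx | exact: nm_ge0].
move=> n; by rewrite [nm z * _]mulrC -mulrDl pu.
Qed.

End PolyOperator.

(* The iteration for 1 - sqrt(1 - g); sigma is its scalar majorant. *)
Section SqrtIteration.
Variable R : realType.

Fixpoint sqiter (g : {poly R}) n : {poly R} :=
  if n is m.+1 then 2^-1 *: (g + sqiter g m ^+ 2) else 0.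

Fixpoint sigma n : R := if n is m.+1 then 2^-1 * (1 + sigma m ^+ 2) else 0.

Lemma sigma_bounds n : 0 <= sigma n <= 1.
Proof.
by elim: n => [|n /andP[s0 s1]] /=; [rewrite lexx ler01|apply/andP; split; nra].
Qed.

Lemma sigma_incr n : sigma n <= sigma n.+1.
Proof. by have := sqr_ge0 (1 - sigma n); rewrite /=; lra. Qed.

Lemma sigma_mono m n : (m <= n)%N -> sigma m <= sigma n.
Proof.
move=> /subnK <-; elim: (n - m)%N => [|k IH]; first by rewrite add0n.
by rewrite addSn (le_trans IH)// sigma_incr.
Qed.

(** The gap d = 1 - sigma obeys d' = d - d^2 / 2, whence d <= 2 / (n + 2), with equality at n =
    0. *)
Lemma sigma_tends : tends0 (fun n => 1 - sigma n).
Proof.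
have sg n : 1 - sigma n <= 2 / (n.+2)%:R.
  elim: n => [|n IH]; first by rewrite subr0 divff// pnatr_eq0.
  have /andP[s0 s1] := sigma_bounds n.
  set d := 1 - sigma n in IH.
  have -> : 1 - sigma n.+1 = d - d ^+ 2 / 2 by rewrite /d /=; field.
  have n2 : (n.+2)%:R = n%:R + 2 :> R by rewrite -addn2 natrD.
  have n3 : (n.+3)%:R = n%:R + 3 :> R by rewrite -addn3 natrD.
  have n0 : 0 <= n%:R :> R by [].
  rewrite n3; move: IH; rewrite n2; set N := n%:R => IH.
  have N2 : 0 < N + 2 by rewrite ltr_wpDl.
  have N3 : 0 < N + 3 by rewrite ltr_wpDl.
  have d0 : 0 <= d by rewrite subr_ge0.
  have d1 : 2 / (N + 2) <= 1 by rewrite ler_pdivrMr// mul1r lerDr.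
  set c := 2 / (N + 2) in IH d1.
  have cE : c * (N + 2) = 2 by rewrite /c divfK// gt_eqF.
  (* d - d^2 / 2 increases for d <= 1, so d may be replaced by its bound c. *)
  apply: (@le_trans _ _ (c - c ^+ 2 / 2)); first by nra.
  rewrite ler_pdivlMr//; nra.
apply: (tends0_le (C := 2) (@tends0_inv R)) => // n.
apply: (le_trans (sg n)); rewrite ler_wpM2l// lef_pV2 ?posrE//.
by rewrite ler_nat.
Qed.

(** The increment of the iteration is also its error: (1 - q)^2 misses 1 - g by twice the next
    increment, which [sqiter_step_tends] bounds. *)
Lemma sqiter_sqr g n :
  (1 - sqiter g n) ^+ 2 = 1 - g + 2 *: (sqiter g n.+1 - sqiter g n).
Proof.
rewrite /= scalerBr scalerA divff ?pnatr_eq0// scale1r -[2 *: sqiter g n]mul_polyC.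
by rewrite (_ : (2%:P : {poly R}) = 2) ?rmorph_nat//; ring.
Qed.

Lemma sqiter_sqr_sub g n :
  2 *: (sqiter g n.+1 - sqiter g n) = (1 - sqiter g n) ^+ 2 - (1 - g).
Proof. by rewrite sqiter_sqr addrAC subrr add0r. Qed.

Lemma sqiter_coef0 (g : {poly R}) n : g`_0 = 0 -> (sqiter g n)`_0 = 0.
Proof.
by move=> g0; elim: n => [|n IH] /=; rewrite ?coef0// coefZ coefD g0 coef0M IH mulr0 addr0 mulr0.
Qed.

(** This is the case g = 1 - c of a root of c: the constant term 1 - sigma of 1 - q is nonzero but
    tends to 0, so the limit needs no unit. *)
Lemma sqiter_coef0_sigma (g : {poly R}) n : g`_0 = 1 -> (sqiter g n)`_0 = sigma n.
Proof.
by move=> g0; elim: n => [|n IH] /=; rewrite ?coef0// coefZ coefD g0 coef0M IH.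
Qed.

Section Bounds.
Variables (E : normedModType (CF R)) (T : E -> E).
Hypothesis Tlin : forall (k : R[i]) x y, T (k *: x + y) = k *: T x + T y.
Variable g : {poly R}.
Hypothesis gb : pevb T g 1.

Lemma sqiter_bound n : pevb T (sqiter g n) (sigma n).
Proof.
elim: n => [|n IH] /=; first by move=> z; rewrite -polyC0 pevC scale0r nm0 mul0r.
have /andP[s0 _] := sigma_bounds n.
rewrite -[X in X * (_ + _)]ger0_norm ?invr_ge0//.
by apply/pevbZ/pevbD => //; rewrite !expr2; exact: pevbM.
Qed.

Lemma sqiter_step n : pevb T (sqiter g n.+1 - sqiter g n) (sigma n.+1 - sigma n).
Proof.
elim: n => [|n IH].
  have := sqiter_bound 1; rewrite /= !subr0.
  by apply: pevb_le.
have -> : sqiter g n.+2 - sqiter g n.+1 =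
    2^-1 *: ((sqiter g n.+1 - sqiter g n) * (sqiter g n.+1 + sqiter g n)).
  transitivity (2^-1 *: (g + sqiter g n.+1 ^+ 2) - 2^-1 *: (g + sqiter g n ^+ 2)).
    by [].
  by rewrite -scalerBr; congr (_ *: _); ring.
have -> : sigma n.+2 - sigma n.+1 =
    `|2^-1| * ((sigma n.+1 - sigma n) * (sigma n.+1 + sigma n)).
  rewrite ger0_norm ?invr_ge0//.
  transitivity (2^-1 * (1 + sigma n.+1 ^+ 2) - 2^-1 * (1 + sigma n ^+ 2)).
    by [].
  by ring.
apply/pevbZ/(pevbM Tlin) => //; first by rewrite subr_ge0 sigma_incr.
by apply: pevbD; exact: sqiter_bound.
Qed.

(** The scalar iteration dominates the operator one; as sigma <= 1, the rate depends on [m]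
    alone. *)
Lemma sqiter_cauchy m n : (m <= n)%N ->
  pevb T (sqiter g n - sqiter g m) (1 - sigma m).
Proof.
move=> mn; apply: (@pevb_le _ _ _ _ (sigma n - sigma m)).
  by have /andP[_ s1] := sigma_bounds n; rewrite lerD2r.
elim: n mn => [|n IH].
  by rewrite leqn0 => /eqP->; rewrite !subrr => z; rewrite -polyC0 pevC scale0r nm0 mul0r.
rewrite leq_eqVlt => /orP[/eqP->|].
  by rewrite !subrr => z; rewrite -polyC0 pevC scale0r nm0 mul0r.
rewrite ltnS => /IH IHn.
have -> : sqiter g n.+1 - sqiter g m =
  (sqiter g n.+1 - sqiter g n) + (sqiter g n - sqiter g m) by rewrite addrA subrK.
have -> : sigma n.+1 - sigma m = (sigma n.+1 - sigma n) + (sigma n - sigma m) by lra.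
by apply: pevbD => //; exact: sqiter_step.
Qed.

Lemma sqiter_step_tends n :
  pevb T (2 *: (sqiter g n.+1 - sqiter g n)) (2 * (1 - sigma n)).
Proof.
rewrite -[X in X * _]ger0_norm//; apply: pevbZ.
exact: sqiter_cauchy.
Qed.

End Bounds.

Section CstarCondition.
Variables (E : normedModType (CF R)) (T : E -> E).
Hypothesis Tlin : forall (k : R[i]) x y, T (k *: x + y) = k *: T x + T y.
(* This is the C*-identity applied to the normal operator p(T) + i q(T). *)
Hypothesis Tcstar : forall (p q : {poly R}) (k : R), 0 <= k ->
  pevb T (p ^+ 2 + q ^+ 2) (k ^+ 2) -> pevb T p k.

(* If (1 - q)^2 = 1 - p^2 / 2 and p is self-adjoint, the real part 1 - p^2 of the
   unitary (1 - q + i p / sqrt 2)^2 is a contraction. *)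
Lemma pevb_1Bsqr (p : {poly R}) : pevb T (2^-1 *: p ^+ 2) 1 -> pevb T (1 - p ^+ 2) 1.
Proof.
move=> pb; have p2 : pevb T (p ^+ 2) 2.
  have := pevbZ 2 pb; rewrite scalerA mulfV ?pnatr_eq0// scale1r.
  by rewrite ger0_norm// mulr1.
apply: (@pevb_lim _ _ _ _ (fun n => 8 * (1 - sigma n))).
  by apply: (tends0_le (C := 8) (sigma_tends)) => //.
move=> n; set q := sqiter (2^-1 *: p ^+ 2) n; set q' := sqiter (2^-1 *: p ^+ 2) n.+1.
have /andP[_ s1] := sigma_bounds n.
apply: (Tcstar (q := (Num.sqrt 2)%:P * p * (1 - q))).
  by rewrite addr_ge0// mulr_ge0// subr_ge0.
(* The left side is the squared modulus of (1 - q + i p / sqrt 2)^2, where the real part uses the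
   ideal value 1 - p^2 / 2 of (1 - q)^2; the right side exhibits the resulting error. *)
have -> : (1 - p ^+ 2) ^+ 2 + ((Num.sqrt 2)%:P * p * (1 - q)) ^+ 2 =
   1 + 2 *: p ^+ 2 * (2 *: (q' - q)).
  rewrite !exprMn [in RHS]sqiter_sqr_sub -/q -rmorphXn /= sqr_sqrtr//.
  have e : (2%:P : {poly R}) * (2^-1)%:P = 1.
    by rewrite -rmorphM mulfV ?pnatr_eq0// rmorph1.
  have e2 : (2%:P : {poly R}) = 2 by rewrite rmorph_nat.
  rewrite -!mul_polyC; rewrite e2 in e *.
  transitivity (1 + 2 * p ^+ 2 * (1 - q) ^+ 2 - 2 * p ^+ 2 + (2 * (2^-1)%:P) * p ^+ 4).
    by rewrite e; ring.
  by ring.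
(* This is 1 + 8 d with d = 1 - sigma, at most the required (1 + 8 d)^2. *)
apply: (@pevb_le _ _ _ _ (1 + `|2| * 2 * (2 * (1 - sigma n)))).
  rewrite ger0_norm//; have d0 : 0 <= 1 - sigma n by rewrite subr_ge0.
  set d := 1 - _ in d0 *; have := sqr_ge0 d; rewrite sqrrD expr1n mul1r; nra.
apply: pevbD; first exact: pevb1.
apply: (pevbM Tlin); first by rewrite mulr_ge0.
  exact: pevbZ.
exact: sqiter_step_tends.
Qed.

End CstarCondition.
End SqrtIteration.

(** * C*-algebras *)

Section CstarBasics.
Variables (R : realType) (A : cstarAlgebra R).
Implicit Types (a b c h x y z : A) (k : R[i]) (p q : {poly R}).

Lemma cadjD a b : cadj (a + b) = cadj a + cadj b.
Proof. by have := cadj_semilinear 1 a b; rewrite !scale1r rmorph1 scale1r. Qed.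

Lemma cadj0 : cadj 0 = 0 :> A.
Proof. by apply: (addrI (cadj 0)); rewrite -cadjD !addr0. Qed.

Lemma cadjZ k a : cadj (k *: a) = k^* *: cadj a.
Proof. by have := cadj_semilinear k a 0; rewrite cadj0 !addr0. Qed.

Lemma cadjZR (r : R) a : cadj (r%:C *: a) = r%:C *: cadj a.
Proof. by rewrite cadjZ conjR. Qed.

Lemma cadjN a : cadj (- a) = - cadj a.
Proof. by rewrite -scaleN1r cadjZ rmorphN1 scaleN1r. Qed.

Lemma cadjB a b : cadj (a - b) = cadj a - cadj b.
Proof. by rewrite cadjD cadjN. Qed.

Lemma cadj_sum (I : Type) (s : seq I) (F : I -> A) :
  cadj (\sum_(i <- s) F i) = \sum_(i <- s) cadj (F i).
Proof. by rewrite (big_morph _ cadjD cadj0). Qed.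

Lemma cmulNl a b : (- a) *c b = - (a *c b).
Proof. by rewrite -scaleN1r cmulZl scaleN1r. Qed.

Lemma cmulNr a b : a *c (- b) = - (a *c b).
Proof. by rewrite -scaleN1r cmulZr scaleN1r. Qed.

Lemma cmulBl a b c : (a - b) *c c = a *c c - b *c c.
Proof. by rewrite cmulDl cmulNl. Qed.

Lemma cmulBr a b c : c *c (a - b) = c *c a - c *c b.
Proof. by rewrite cmulDr cmulNr. Qed.

Lemma cmul_suml (I : Type) (s : seq I) (F : I -> A) c :
  (\sum_(i <- s) F i) *c c = \sum_(i <- s) F i *c c.
Proof.
elim: s => [|i s IH]; first by rewrite !big_nil cmul0.
by rewrite !big_cons cmulDl IH.
Qed.

Lemma cmul_sumr (I : Type) (s : seq I) (F : I -> A) c :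
  c *c (\sum_(i <- s) F i) = \sum_(i <- s) c *c F i.
Proof.
elim: s => [|i s IH]; first by rewrite !big_nil cmulr0.
by rewrite !big_cons cmulDr IH.
Qed.

Definition cstarE := (cmulBl, cmulBr, cmulDl, cmulDr, cmulNl, cmulNr, cmulZl, cmulZr,
  cmul0, cmulr0, cmulA, cadjM, cadjK, cadjD, cadjN, cadjB, cadjZ, cadj0).

End CstarBasics.

Ltac calg A :=
  lazymatch type of A with
  | cstarAlgebra ?R => rewrite ?(@cstarE R A);
      lmodule_over constr:((R[i])%R : comNzRingType) constr:(A : lmodType (R[i]))
  end.

Section CstarNorm.
Variables (R : realType) (A : cstarAlgebra R).
Implicit Types (a b c h x y z : A) (k : R[i]) (p q : {poly R}).

Lemma nm_cmul a b : nm (a *c b) <= nm a * nm b.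
Proof. by rewrite -lecR rmorphM /= -!nmE cnormM_le. Qed.

Lemma nm_cadj a : nm (cadj a) = nm a.
Proof.
have le b : nm b <= nm (cadj b) by rewrite -lecR -!nmE cnorm_le_adj.
by apply/eqP; rewrite eq_le -{2}(cadjK a) !le.
Qed.

Lemma nm_cstar a : nm (cadj a *c a) = nm a ^+ 2.
Proof. by apply: complexI; rewrite rmorphXn /= -!nmE cnorm_cstar. Qed.

Lemma nm_cstar' a : nm (a *c cadj a) = nm a ^+ 2.
Proof. by rewrite -{1}(cadjK a) nm_cstar nm_cadj. Qed.

(** The test element is z = a^*. This turns bounds on the operators [pev (cmul h) p] into norm
    bounds in an algebra without unit. *)
Lemma nm_opl a (M : R) : 0 <= M -> (forall z, nm (a *c z) <= M * nm z) -> nm a <= M.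
Proof.
move=> M0 aM; have := aM (cadj a); rewrite nm_cstar' nm_cadj expr2.
by have [->|a0] := eqVneq (nm a) 0; rewrite // ler_pM2r// lt0r a0 nm_ge0.
Qed.

Lemma cmul_injl a b : (forall z, a *c z = b *c z) -> a = b.
Proof.
move=> ab; apply/eqP; rewrite -subr_eq0; apply/eqP/nm_le0/nm_opl => // z.
by rewrite cmulBl ab subrr nm0 mul0r.
Qed.

Lemma cmul_injr a b : (forall z, z *c a = z *c b) -> a = b.
Proof.
move=> ab; apply: (can_inj (@cadjK R A)); apply: cmul_injl => z.
by rewrite -(cadjK z) -!cadjM ab.
Qed.

Section SelfAdjoint.
Variable h : A.

Lemma cmul_lin k x y : h *c (k *: x + y) = k *: (h *c x) + h *c y.
Proof. exact: cmul_linearr. Qed.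

(** p(h) - p(0), which lies in the algebra even in the absence of a unit. *)
Definition cpoly p : A := pev (cmul h) (drop_poly 1 p) h.

Lemma pev_cmul p z y : pev (cmul h) p (z *c y) = pev (cmul h) p z *c y.
Proof.
elim/poly_ind: p => [|p c IH]; first by rewrite -polyC0 !pevC !scale0r cmul0.
by rewrite !pevD !pevMX ?IH; try exact: cmul_lin; rewrite !pevC cmulDl cmulA cmulZl.
Qed.

Lemma cpolyE p z : pev (cmul h) p z = (p`_0)%:C *: z + cpoly p *c z.
Proof.
rewrite -{1}[p](poly_take_drop 1) pevD (_ : take_poly 1 p = (p`_0)%:P).
  rewrite pevC; congr (_ + _).
  by rewrite expr1 pevM ?pevX ?pev_cmul//; exact: cmul_lin.
by apply/polyP => -[|i]; rewrite coef_take_poly coefC.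
Qed.

Hypothesis hsa : cadj h = h.

Lemma pev_adj p x y :
  cadj (pev (cmul h) p x) *c y = cadj x *c pev (cmul h) p y.
Proof.
elim/poly_ind: p x y => [|p c IH] x y.
  by rewrite -polyC0 !pevC !scale0r cadj0 cmul0 cmulr0.
rewrite !pevD !pevMX; try exact: cmul_lin.
rewrite !pevC cadjD cadjM hsa cadjZR cmulDl cmulDr cmulZl cmulZr -cmulA IH.
by rewrite pev_comm//; exact: cmul_lin.
Qed.

Lemma cpoly_sa p : cadj (cpoly p) = cpoly p.
Proof.
apply: cmul_injl => z; apply: cmul_injr => y.
have := pev_adj p (cadj y) z; rewrite !cpolyE cadjD cadjZR cadjM !cadjK.
rewrite cmulDl cmulDr cmulZl cmulZr => /addrI <-.
by rewrite cmulA.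
Qed.

(** For e = i or e = -i, the operator p(h) + e q(h) has squared modulus p^2 + q^2, since everything
    commutes; p(h) is the mean of the two. *)
Lemma cmul_cstar p q (k : R) : 0 <= k ->
  pevb (cmul h) (p ^+ 2 + q ^+ 2) (k ^+ 2) -> pevb (cmul h) p k.
Proof.
move=> k0 pq z; set P := pev (cmul h).
have Pz r s y : cadj (P r z) *c P s y = cadj z *c P (r * s) y.
  by rewrite pev_adj -pevM//; exact: cmul_lin.
have bound (e : R[i]) : e * e^* = 1 -> e + e^* = 0 -> nm (P p z + e *: P q z) <= k * nm z.
  move=> e1 e2; rewrite -ler_sqr ?nnegrE ?nm_ge0 ?mulr_ge0 ?nm_ge0//.
  rewrite -nm_cstar cadjD cadjZ cmulDl !cmulDr !cmulZl !cmulZr !Pz scalerA.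
  rewrite [_^* * e]mulrC e1 scale1r (mulrC q p : q * p = p * q :> {poly R}) (_ : e^* = - e); last first.
    by apply/eqP; rewrite -addr_eq0 addrC e2.
  rewrite (_ : _ + _ = cadj z *c P (p ^+ 2 + q ^+ 2) z); last first.
    by rewrite /P pevD !expr2; calg A.
  rewrite (le_trans (nm_cmul _ _))// nm_cadj exprMn.
  rewrite [X in _ <= X]mulrC expr2 -mulrA ler_wpM2l ?nm_ge0//.
  by rewrite (le_trans (pq z))// mulrC.
have i1 : ('i : R[i])^* = - 'i by apply/eqP; rewrite eq_complex /= oppr0 !eqxx.
have ii : 'i * - 'i = 1 :> R[i].
  by apply/eqP; rewrite eq_complex /=; apply/andP; split; apply/eqP; ring.
have B1 := bound 'i; have B2 := bound (- 'i).
rewrite rmorphN /= i1 opprK in B1 B2.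
have := B1 ii (subrr _); have := B2; rewrite mulNr -mulrN ii addNr => /(_ erefl erefl).
rewrite scaleNr -/P => b2 b1.
have : nm (P p z + P p z) <= 2 * (k * nm z).
  apply: le_trans (_ : nm (P p z + 'i *: P q z) + nm (P p z - 'i *: P q z) <= _).
    by rewrite (le_trans _ (nmD _ _))// addrACA subrr addr0.
  by rewrite mulr_natl mulr2n lerD.
by rewrite -mulr2n -scaler_nat nmZ cm_nat ler_pM2l.
Qed.

End SelfAdjoint.

Lemma cadj_lim (u : nat -> A) l (rho : nat -> R) :
  tends0 rho -> (forall n, nm (u n - l) <= rho n) ->
  (forall n, cadj (u n) = u n) -> cadj l = l.
Proof.
move=> r0 ul ua; apply/eqP; rewrite -subr_eq0; apply/eqP/nm_le0.
apply: (@le_tends0 _ (fun n => rho n + rho n)); first exact: tends0D.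
move=> n; rewrite add0r (le_trans (nm_triangle _ (u n) _))// lerD//.
by rewrite nmB -{1}(ua n) -cadjB nm_cadj.
Qed.

(* 1 - h = (1 - s)^2, stated without a unit *)
Lemma sqrt_1B h : cadj h = h -> nm h <= 1 ->
  exists2 s, cadj s = s & h = s + s - s *c s.
Proof.
move=> hsa h1; pose g : {poly R} := 'X; have lin := @cmul_lin h.
have gb : pevb (cmul h) g 1.
  move=> z; rewrite pevX// (le_trans (nm_cmul _ _))//.
  by rewrite ler_wpM2r ?nm_ge0.
have q0 n : (sqiter g n)`_0 = 0 by apply: sqiter_coef0; rewrite coefX.
pose s n := cpoly h (sqiter g n).
have sE n z : s n *c z = pev (cmul h) (sqiter g n) z.
  by rewrite cpolyE q0 scale0r add0r.
have sB m n : (m <= n)%N -> nm (s n - s m) <= 1 - sigma R m.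
  move=> mn; apply: nm_opl; first by rewrite subr_ge0; have /andP[] := sigma_bounds R m.
  move=> z; rewrite cmulBl !sE -pevB; exact: sqiter_cauchy.
have [l sl] := cvg_rate sB (@sigma_tends R).
have s1 n : nm (s n) <= 1.
  apply: nm_opl => // z; rewrite sE (le_trans (sqiter_bound lin gb n z))//.
  by rewrite ler_wpM2r ?nm_ge0//; have /andP[] := sigma_bounds R n.
exists l.
  by apply: (cadj_lim (@sigma_tends R) sl) => n; exact: cpoly_sa.
have rec n : s n.+1 + s n.+1 = h + s n *c s n.
  apply: cmul_injl => z; rewrite !cmulDl -cmulA !sE /= pevZ pevD expr2 pevM// pevX//.
  rewrite -scalerDl -rmorphD /= (_ : 2^-1 + 2^-1 = 1); last by field.
  by rewrite rmorph1 scale1r.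
apply/eqP; rewrite -subr_eq0; apply/eqP/nm_le0.
have sig0 := @sigma_tends R.
apply: (@le_tends0 _ (fun n => 4 * (1 - sigma R n))).
  by apply: (tends0_le (C := 4) sig0).
move=> n; rewrite add0r.
have -> : h - (l + l - l *c l) =
    ((s n.+1 - l) + (s n.+1 - l)) - ((s n - l) *c s n + l *c (s n - l)).
  have -> : h = (s n.+1 + s n.+1) - s n *c s n by rewrite rec addrK.
  by calg A.
have l1 : nm l <= 1.
  apply: (le_tends0 sig0) => k; rewrite -[l](subrK (s k)) addrC.
  by rewrite (le_trans (nmD _ _))// lerD// nmB.
have h1n : nm (s n.+1 - l) <= 1 - sigma R n.
  by rewrite (le_trans (sl _))// lerD2l lerN2 sigma_incr.
rewrite (le_trans (nmD _ _))// nmN (_ : 4 * _ = (1 - sigma R n + (1 - sigma R n)) + (1 - sigma R n + (1 - sigma R n))); last by ring.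
rewrite lerD// (le_trans (nmD _ _))// lerD// (le_trans (nm_cmul _ _))//.
  by rewrite -[leRHS]mulr1 ler_pM ?nm_ge0.
by rewrite -[leRHS]mul1r ler_pM ?nm_ge0.
Qed.

End CstarNorm.

(** * Representations *)

Section StarAction.
Variables (R : realType) (A : cstarAlgebra R) (V : lmodType R[i]).
Variables (B : V -> V -> R[i]) (act : A -> V -> V).

(** A star-representation on a semi-inner product space, with no continuity required. It covers
    Hilbert spaces, GNS forms on the algebra and its unitization, and multiplier actions;
    [act_contr] makes all of them contractive. *)
Record star_action : Prop := StarAction {
  act_psd : psd B;
  act_linear : forall (k : R[i]) a b x, act (k *: a + b) x = k *: act a x + act b x;
  actM : forall a b x, act (a *c b) x = act a (act b x);
  act_adj : forall a x y, B (act a x) y = B x (act (cadj a) y) }.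

Hypothesis HS : star_action.
Let HB := act_psd HS.

Lemma actD a b x : act (a + b) x = act a x + act b x.
Proof. by have := act_linear HS 1 a b x; rewrite !scale1r. Qed.

Lemma act0 x : act 0 x = 0.
Proof. by apply: (addrI (act 0 x)); rewrite -actD !addr0. Qed.

Lemma actZ (k : R[i]) a x : act (k *: a) x = k *: act a x.
Proof. by have := act_linear HS k a 0 x; rewrite act0 !addr0. Qed.

Lemma actN a x : act (- a) x = - act a x.
Proof. by rewrite -[- a]scaleN1r actZ scaleN1r. Qed.

Lemma actB a b x : act (a - b) x = act a x - act b x.
Proof. by rewrite actD actN. Qed.

Lemma act_sum (I : Type) (s : seq I) (F : I -> A) x :
  act (\sum_(i <- s) F i) x = \sum_(i <- s) act (F i) x.
Proof.
elim: s => [|i s IH]; first by rewrite !big_nil act0.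
by rewrite !big_cons actD IH.
Qed.

(** With h = a^* a / |a|^2 and 1 - h = (1 - s)^2, the difference |x|^2 - <hx, x> is |x - sx|^2. *)
Lemma act_contr a x : sq B (act a x) <= nm a ^+ 2 * sq B x.
Proof.
have [a0|a0] := eqVneq (nm a) 0.
  rewrite (nm_le0 (_ : nm a <= 0)) ?a0// act0 nm0 expr0n mul0r.
  by rewrite /sq (psd0l HB).
have agt : 0 < nm a by rewrite lt0r a0 nm_ge0.
pose c := (nm a)^-1 ^+ 2; pose h := c%:C *: (cadj a *c a).
have hsa : cadj h = h by rewrite /h cadjZR cadjM cadjK.
have h1 : nm h <= 1.
  by rewrite /h nmZ cm_real nm_cstar ger0_norm ?sqr_ge0// /c -exprMn mulVf// expr1n.
have [s ssa hE] := sqrt_1B hsa h1.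
have := sq_ge0 HB (x - act s x); rewrite (sqB HB).
have -> : sq B (act s x) = complex.Re (B x (act (s *c s) x)).
  by rewrite /sq (act_adj HS) ssa (actM HS).
have : c * sq B (act a x) = complex.Re (B x (act h x)).
  by rewrite /h actZ (psdZr HB) conjR ReZ (actM HS) -(act_adj HS).
rewrite hE actB actD (psdBr HB) (psdDr HB) ReB ReD => h2 h3.
rewrite -(ler_pM2l (_ : 0 < c)) ?exprn_gt0 ?invr_gt0//.
by rewrite mulrA -exprMn mulVf// expr1n mul1r h2; lra.
Qed.

Lemma act_sn a x : sn B (act a x) <= nm a * sn B x.
Proof.
rewrite (sn_le HB) ?mulr_ge0 ?nm_ge0 ?sn_ge0// exprMn (sn_sqr HB).
exact: act_contr.
Qed.

End StarAction.

Section Hilbert.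
Variables (R : realType) (H : hilbertSpace R).
Implicit Types x y z : H.

Lemma ip_psd : psd (@ip R H).
Proof.
split; [exact: ip_linear | exact: ip_conj |].
by move=> x; rewrite ip_norm exprn_ge0.
Qed.

Lemma sq_ip x : sq (@ip R H) x = nm x ^+ 2.
Proof. by rewrite /sq ip_norm nmE -rmorphXn. Qed.

Lemma sn_ip x : sn (@ip R H) x = nm x.
Proof. by rewrite /sn sq_ip sqrtr_sqr ger0_norm ?nm_ge0. Qed.

Lemma ip_CS x y : cm (ip x y) <= nm x * nm y.
Proof. by rewrite -!sn_ip; exact: (sn_CS ip_psd). Qed.

End Hilbert.

(** * Faithful representations are isometric *)

Section Representation.
Variables (R : realType) (A : cstarAlgebra R) (H : hilbertSpace R).
Variable pi : A -> H -> H.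
Hypothesis Hpi : is_rep pi.
Implicit Types (a b h : A) (x y : H) (p q : {poly R}).

Lemma rep_action : star_action (@ip R H) pi.
Proof.
have [[pl _] _ pM padj] := Hpi.
by split=> //; exact: ip_psd.
Qed.

Lemma rep_linear a (k : R[i]) x y : pi a (k *: x + y) = k *: pi a x + pi a y.
Proof. by have [[_ pl] _ _ _] := Hpi. Qed.

Lemma repBr a x y : pi a (x - y) = pi a x - pi a y.
Proof. by rewrite addrC -scaleN1r rep_linear scaleN1r addrC. Qed.

Lemma rep_contr a x : nm (pi a x) <= nm a * nm x.
Proof. by have := act_sn rep_action a x; rewrite !sn_ip. Qed.

Lemma rep_pev h p a x : pi (pev (cmul h) p a) x = pev (pi h) p (pi a x).
Proof.
elim/poly_ind: p => [|p c IH].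
  by rewrite -polyC0 !pevC !scale0r (act0 rep_action).
rewrite !pevD !pevMX; [|exact: rep_linear|exact: cmul_lin].
by rewrite (actD rep_action) (actM rep_action) IH !pevC (actZ rep_action).
Qed.

Lemma rep_cpoly h p x : p`_0 = 0 -> pi (cpoly h p) x = pev (pi h) p x.
Proof.
move=> p0; rewrite /cpoly rep_pev -{2}[p](poly_take_drop 1) pevD.
rewrite (_ : take_poly 1 p = 0); last first.
  by apply/polyP => -[|i]; rewrite coef_take_poly coefC ?p0//= if_same.
rewrite -polyC0 pevC scale0r add0r expr1 pevM ?pevX//; exact: rep_linear.
Qed.

Section SelfAdjoint.
Variable h : A.
Hypothesis hsa : cadj h = h.
Let lin := @rep_linear h.

Lemma pev_ip p x y : ip (pev (pi h) p x) y = ip x (pev (pi h) p y).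
Proof.
have P := @ip_psd R H.
elim/poly_ind: p x y => [|p c IH] x y.
  by rewrite -polyC0 !pevC !scale0r (psd0l P) (psd0r P).
rewrite !pevD !pevMX// !pevC (psdDl P) (psdDr P) (psdZl P) (psdZr P) conjR.
by rewrite (act_adj rep_action) hsa IH pev_comm.
Qed.

Lemma rep_cstar p q (k : R) : 0 <= k ->
  pevb (pi h) (p ^+ 2 + q ^+ 2) (k ^+ 2) -> pevb (pi h) p k.
Proof.
move=> k0 pq x; rewrite -ler_sqr ?nnegrE ?mulr_ge0 ?nm_ge0//.
have e r : nm (pev (pi h) r x) ^+ 2 = complex.Re (ip x (pev (pi h) (r ^+ 2) x)).
  by rewrite -sq_ip /sq pev_ip expr2 pevM.
have : nm (pev (pi h) p x) ^+ 2 + nm (pev (pi h) q x) ^+ 2 <= k ^+ 2 * nm x ^+ 2.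
  rewrite !e -ReD -(psdDr (@ip_psd R H)) -pevD (le_trans (Re_le_cm _))//.
  rewrite (le_trans (ip_CS _ _))// [nm x ^+ 2]expr2 mulrCA mulrC.
  by rewrite mulrC ler_wpM2l ?nm_ge0.
by rewrite exprMn; have := sqr_ge0 (nm (pev (pi h) q x)); lra.
Qed.

Hypothesis hpi : forall x, nm (pi h x) <= nm x.
(** [sqiter g n] approaches 1 minus the absolute value of t, so [d n] approaches t - |t| with t = 1
    - h^2. This limit vanishes where h^2 <= 1, and [d n] has no constant term. *)
Let t : {poly R} := 1 - 'X ^+ 2.
Let g : {poly R} := 1 - t ^+ 2.
Let d n : {poly R} := sqiter g n - 'X ^+ 2.

Let half_sqr (E : normedModType (CF R)) (T : E -> E) (r : {poly R}) :
  (forall (k : R[i]) (u v : E), T (k *: u + v) = k *: T u + T v) ->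
  pevb T r 1 -> pevb T (2^-1 *: r ^+ 2) 1.
Proof.
move=> Tl r1; apply: (@pevb_le _ _ _ _ (`|2^-1| * (1 * 1))).
  by rewrite ger0_norm ?invr_ge0//; lra.
by apply: pevbZ; rewrite expr2; exact: pevbM.
Qed.

Let X1 : pevb (pi h) 'X 1.
Proof. by move=> x; rewrite pevX// mul1r. Qed.

Let X21 : pevb (pi h) ('X ^+ 2) 1.
Proof. by rewrite -[1 : R]mulr1 expr2; exact: pevbM. Qed.

Let gH : pevb (pi h) g 1.
Proof.
have c := @rep_cstar.
by apply: pevb_1Bsqr => //; apply: half_sqr => //; apply: pevb_1Bsqr => //; exact: half_sqr.
Qed.

(* 1 - sqiter g n and 1 - h^2 are positive with nearly equal squares, and the
   positive square root is unique. *)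
Let dH n x : nm (pev (pi h) (d n) x) ^+ 4 <= 16 * (1 - sigma R n) * nm x ^+ 4.
Proof.
have P := @ip_psd R H; set rho := 1 - sigma R n; set q := sqiter g n.
have /andP[s0 s1] := sigma_bounds R n; have r0 : 0 <= rho by rewrite subr_ge0.
have q1 : pevb (pi h) q 1 := pevb_le s1 (sqiter_bound lin gH n).
set y := pev (pi h) (d n) x.
have y2 : nm y <= 2 * nm x.
  by apply: (pevbD q1 (pevbN X21)).
have pos r u : pevb (pi h) r 1 ->
    0 <= complex.Re (ip (pev (pi h) (1 - r) u) u) <= 2 * sq (@ip R H) u.
  move=> r1; rewrite pevB pev1 (psdBl P) ReB -/(sq _ u) sq_ip.
  have : cm (ip (pev (pi h) r u) u) <= nm u ^+ 2.
    rewrite (le_trans (ip_CS _ _))// expr2 ler_wpM2r ?nm_ge0//.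
    by rewrite (le_trans (r1 u))// mul1r.
  have := Re_le_cm (ip (pev (pi h) r u) u).
  have := Re_le_cm (- ip (pev (pi h) r u) u); rewrite ReN cmN; lra.
have psqr r u : pevb (pi h) r 1 ->
    nm (pev (pi h) (1 - r) u) ^+ 2 <= 2 * complex.Re (ip (pev (pi h) (1 - r) u) u).
  move=> r1; rewrite -sq_ip.
  apply: (@psd_pos_sqr _ _ _ (pev (pi h) (1 - r))) => // [k v w|v w|v].
  - exact: pev_linear.
  - exact: pev_ip.
  - exact: pos.
(* The sum of 1 - q and 1 - h^2 times their difference [d n] is the difference of their squares, up
   to sign twice an increment of the iteration, hence small. *)
have PQ : complex.Re (ip (pev (pi h) (1 - q) y) y) +
          complex.Re (ip (pev (pi h) (1 - 'X ^+ 2) y) y) <= 4 * rho * nm x ^+ 2.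
  rewrite -ReD -(psdDl P) -pevD -pevM//.
  have -> : (1 - q + (1 - 'X ^+ 2)) * d n = - (2 *: (sqiter g n.+1 - q)).
    by rewrite /q sqiter_sqr_sub /d -/q /g /t; ring.
  rewrite pevN (psdNl P) ReN -ReN (le_trans (Re_le_cm _))// cmN.
  rewrite (le_trans (ip_CS _ _))//.
  have := sqiter_step_tends lin gH n x; rewrite -/rho -/q => st.
  rewrite (_ : 4 * rho * _ = (2 * rho * nm x) * (2 * nm x)); last by ring.
  by rewrite ler_pM ?nm_ge0.
have dy : nm (pev (pi h) (d n) y) ^+ 2 <= 16 * rho * nm x ^+ 2.
  have -> : d n = (1 - 'X ^+ 2) - (1 - q) by rewrite /d -/q; ring.
  rewrite pevB; have := nmD (pev (pi h) (1 - 'X^2) y) (- pev (pi h) (1 - q) y).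
  rewrite nmN -ler_sqr ?nnegrE ?addr_ge0 ?nm_ge0// => /le_trans; apply.
  have := psqr _ y q1; have := psqr _ y X21.
  have := sqr_ge0 (nm (pev (pi h) (1 - 'X^2) y) - nm (pev (pi h) (1 - q) y)).
  rewrite sqrrB sqrrD; lra.
have y2' : nm y ^+ 2 <= nm (pev (pi h) (d n) y) * nm x.
  rewrite -sq_ip /sq {1}/y pev_ip -/y (le_trans (Re_le_cm _))//.
  by rewrite (le_trans (ip_CS _ _))// mulrC.
have : (nm y ^+ 2) ^+ 2 <= (nm (pev (pi h) (d n) y) * nm x) ^+ 2.
  by rewrite ler_sqr ?nnegrE ?mulr_ge0 ?sqr_ge0 ?nm_ge0.
rewrite -exprM exprMn => /le_trans; apply.
rewrite (_ : nm x ^+ 4 = nm x ^+ 2 * nm x ^+ 2); last by rewrite -exprD.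
by rewrite [leRHS]mulrA ler_wpM2r ?sqr_ge0.
Qed.

(** As |h|^2 <= 2, t and then g act as contractions on the algebra, so the elements [a n] = d_n(h)
    converge there. In H they tend to 0 because pi(h) is a contraction; injectivity makes their
    limit vanish in the algebra too. *)
Lemma faithful_norm_le1 : (forall a, (forall x, pi a x = 0) -> a = 0) ->
  nm h ^+ 2 <= 2 -> nm h <= 1.
Proof.
move=> inj h2; have linA := @cmul_lin _ _ h; have cA := @cmul_cstar _ _ h hsa.
have tA : pevb (cmul h) t 1.
  apply: pevb_1Bsqr => // z; rewrite pevZ expr2 pevM// !pevX// nmZ cm_real.
  rewrite ger0_norm ?invr_ge0// mul1r cmulA.
  have : nm (h *c h *c z) <= 2 * nm z.
    rewrite (le_trans (nm_cmul _ _))// ler_wpM2r ?nm_ge0//.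
    by rewrite (le_trans (nm_cmul _ _))// -expr2.
  lra.
have gA : pevb (cmul h) g 1 by apply: pevb_1Bsqr => //; exact: half_sqr.
have t0 : t`_0 = 1 by rewrite /t coefB coef1 coefXn subr0.
have g0 : g`_0 = 0 by rewrite /g coefB coef1 expr2 coef0M t0 mulr1 subrr.
have d0 n : (d n)`_0 = 0 by rewrite /d coefB sqiter_coef0// coefXn subr0.
pose a n := cpoly h (d n).
have aE n z : a n *c z = pev (cmul h) (d n) z by rewrite cpolyE d0 scale0r add0r.
have aB m n : (m <= n)%N -> nm (a n - a m) <= 1 - sigma R m.
  move=> mn; apply: nm_opl => [|z].
    by rewrite subr_ge0; have /andP[] := sigma_bounds R m.
  rewrite cmulBl !aE -pevB (_ : d n - d m = sqiter g n - sqiter g m).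
    exact: sqiter_cauchy.
  by rewrite /d; ring.
have [l al] := cvg_rate aB (@sigma_tends R).
have l0 : l = 0.
  apply: inj => x; apply: nm_le0; apply: (@le_eps _ _ _ (2 * nm x)) => e e0.
  have [n1 r1] := @sigma_tends R e e0.
  have [n2 r2] := @sigma_tends R (e ^+ 4 / 16) (divr_gt0 (exprn_gt0 4 e0) (ltr0Sn _ _)).
  set n := maxn n1 n2; rewrite add0r -[l](subrK (a n)) (actD rep_action).
  rewrite (le_trans (nmD _ _))// (_ : 2 * _ * e = e * nm x + e * nm x); last by ring.
  rewrite lerD//.
    rewrite (le_trans (rep_contr _ _))// ler_wpM2r ?nm_ge0// nmB.
    by rewrite (le_trans (al n))// r1// leq_maxl.
  rewrite rep_cpoly// -(@ler_pXn2r _ 4) ?nnegrE ?nm_ge0 ?mulr_ge0 ?nm_ge0 ?(ltW e0)//.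
  rewrite exprMn (le_trans (dH n x))// ler_wpM2r ?exprn_ge0 ?nm_ge0//.
  by rewrite mulrC -ler_pdivlMr// r2// leq_maxr.
(* At index 0 the rate is 1 and the approximant is - h^2, so |h|^2 <= 1. *)
have := al 0%N; rewrite l0 subr0 /= subr0 (_ : a 0%N = - (h *c h)).
  by rewrite nmN -{1}hsa nm_cstar => h1; rewrite -ler_sqr ?nnegrE ?nm_ge0// expr1n.
apply: cmul_injl => z; rewrite aE /d sub0r pevN expr2 pevM// !pevX//.
by rewrite cmulNl cmulA.
Qed.

End SelfAdjoint.
End Representation.

Section Faithful.
Variables (R : realType) (A : cstarAlgebra R) (H : hilbertSpace R).
Variable pi : A -> H -> H.
Hypothesis Hpi : faithful_rep pi.
Implicit Types (a b c h : A) (x y : H).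
Let rep := Hpi.1.
Let act := rep_action rep.

(** A bootstrap around the restriction |k|^2 <= 2: rescaling by the larger of M and 4/5 |h| gives
    |k| <= 5/4, and the outcome |h| <= 4/5 |h| is possible only for h = 0. *)
Let isometry_sa h (M : R) : cadj h = h -> 0 <= M ->
  (forall x, nm (pi h x) <= M * nm x) -> nm h <= M.
Proof.
move=> hsa M0 hM; pose N := Num.max M (4 / 5 * nm h).
have MN : M <= N by rewrite le_max lexx.
have hN : nm h <= 5 / 4 * N.
  have : 4 / 5 * nm h <= N by rewrite le_max lexx orbT.
  lra.
suff hN1 : nm h <= N.
  move: hN1; rewrite /N le_max => /orP[//|h0].
  by have := nm_ge0 h; lra.
have [N0|N0] := eqVneq N 0; first by move: hN; rewrite N0 mulr0.
have Ngt : 0 < N by rewrite lt0r N0 (le_trans M0).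
pose k := N^-1%:C *: h.
have kn : nm k = nm h / N.
  by rewrite nmZ cm_real ger0_norm ?invr_ge0 ?(ltW Ngt)// mulrC.
rewrite -[N]mul1r -ler_pdivrMr// -kn.
apply: (@faithful_norm_le1 _ _ _ pi rep k) => // [|x||].
- by rewrite cadjZR hsa.
- rewrite (actZ act) nmZ cm_real ger0_norm ?invr_ge0 ?(ltW Ngt)//.
  rewrite mulrC ler_pdivrMr// mulrC (le_trans (hM x))// ler_wpM2r ?nm_ge0//.
- by case: Hpi.
- have : nm k <= 5 / 4 by rewrite kn ler_pdivrMr.
  by have := nm_ge0 k; nra.
Qed.

(** The C*-identity reduces to the self-adjoint a^* a, as pi(a^* ) inherits the bound on pi(a). *)
Lemma faithful_norm a (M : R) : 0 <= M ->
  (forall x, nm (pi a x) <= M * nm x) -> nm a <= M.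
Proof.
move=> M0 aM; rewrite -ler_sqr ?nnegrE ?nm_ge0// -nm_cstar.
apply: isometry_sa; rewrite ?sqr_ge0 ?cadjM ?cadjK// => x.
have adjM y : nm (pi (cadj a) y) <= M * nm y.
  have : nm (pi (cadj a) y) ^+ 2 <= nm (pi (cadj a) y) * (M * nm y).
    rewrite -sq_ip /sq (act_adj act) cadjK (le_trans (Re_le_cm _))//.
    rewrite (le_trans (ip_CS _ _))// mulrC.
    by have := aM (pi (cadj a) y); have := nm_ge0 y; nra.
  have := nm_ge0 (pi (cadj a) y); rewrite le0r => /orP[/eqP->|n0].
    by rewrite mulr_ge0 ?nm_ge0.
  by rewrite expr2 ler_pM2l.
by rewrite (actM act) (le_trans (adjM _))// expr2 -mulrA ler_wpM2l.
Qed.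

Lemma faithful_norm_ip a (M : R) : 0 <= M ->
  (forall x y, cm (ip (pi a x) y) <= M * nm x * nm y) -> nm a <= M.
Proof.
move=> M0 aM; apply: faithful_norm => // x.
have := aM x (pi a x); rewrite ip_norm nmE -rmorphXn cm_real ger0_norm ?sqr_ge0//.
have := nm_ge0 (pi a x); rewrite le0r => /orP[/eqP->|n0].
  by rewrite mulr_ge0 ?nm_ge0.
by rewrite expr2 ler_pM2r.
Qed.

(** Positivity tested in the representation is visibly additive, which [cpositive] is not. *)
Definition opos h := cadj h = h /\ forall x, 0 <= complex.Re (ip (pi h x) x).

Lemma opos_sqr h (M : R) x : opos h -> nm h <= M ->
  nm (pi h x) ^+ 2 <= M * complex.Re (ip (pi h x) x).
Proof.
move=> [hsa h0] hM; rewrite -sq_ip.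
apply: (@psd_pos_sqr _ _ _ (pi h)) => [|k u v|u v|u].
- exact: ip_psd.
- exact: rep_linear.
- by rewrite (act_adj act) hsa.
- rewrite h0 sq_ip (le_trans (Re_le_cm _))// (le_trans (ip_CS _ _))//.
  rewrite expr2 mulrA ler_wpM2r ?nm_ge0// (le_trans (rep_contr rep _ _))//.
  by rewrite ler_wpM2r ?nm_ge0.
Qed.

(** It follows from h^2 <= M h, and drives the iterations for both the resolvent and the square
    root. *)
Lemma opos_sub h (M : R) z : opos h -> nm h <= M -> nm (M%:C *: z - h *c z) <= M * nm z.
Proof.
move=> hp hM; have M0 : 0 <= M := le_trans (nm_ge0 h) hM.
apply: faithful_norm => [|x]; first by rewrite mulr_ge0 ?nm_ge0.
rewrite -mulrA (le_trans _ (ler_wpM2l M0 (rep_contr rep z x)))//.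
rewrite (actB act) (actZ act) (actM act); set y := pi z x.
rewrite -ler_sqr ?nnegrE ?mulr_ge0 ?nm_ge0// -sq_ip (sqB (@ip_psd R H)).
rewrite (psdZl (@ip_psd R H)) ReZ (sqZ (@ip_psd R H)) cm_real ger0_norm// !sq_ip.
have h0 : 0 <= complex.Re (ip (pi h y) y) by have [_] := hp.
have -> : complex.Re (ip y (pi h y)) = complex.Re (ip (pi h y) y).
  by rewrite (psd_conj (@ip_psd R H)) ReJ.
have := opos_sqr y hp hM; rewrite exprMn; nra.
Qed.

Lemma opos_cstar a : opos (cadj a *c a).
Proof.
split=> [|x]; first by rewrite cadjM cadjK.
by rewrite (actM act) (act_adj act) cadjK -/(sq _ _) (sq_ge0 (@ip_psd R H)).
Qed.

Lemma oposD a b : opos a -> opos b -> opos (a + b).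
Proof.
move=> [asa a0] [bsa b0]; split=> [|x]; first by rewrite cadjD asa bsa.
by rewrite (actD act) (psdDl (@ip_psd R H)) ReD addr_ge0.
Qed.

Lemma oposZ (r : R) a : 0 <= r -> opos a -> opos (r%:C *: a).
Proof.
move=> r0 [asa a0]; split=> [|x]; first by rewrite cadjZR asa.
by rewrite (actZ act) (psdZl (@ip_psd R H)) ReZ mulr_ge0.
Qed.

Lemma opos0 : opos 0.
Proof. by split=> [|x]; rewrite ?cadj0// (act0 act) (psd0l (@ip_psd R H)). Qed.

End Faithful.

(** * Resolvents and approximate units *)

Section Resolvent.
Variables (R : realType) (A : cstarAlgebra R) (H : hilbertSpace R).
Variable pi : A -> H -> H.
Hypothesis Hpi : faithful_rep pi.
Implicit Types (a b c h : A) (x y : H).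
Let rep := Hpi.1.
Let act := rep_action rep.
Let P := @ip_psd R H.

Lemma tends0_exp (q : R) : 0 <= q < 1 -> tends0 (fun n => q ^+ n).
Proof.
move=> /andP[q0 q1] e e0.
have [n0 n0P] : exists n : nat, (e * (1 - q))^-1 < n%:R.
  by have /archi_boundP : 0 <= (e * (1 - q))^-1; [rewrite invr_ge0 mulr_ge0 ?subr_ge0 ?ltW | exists (Num.bound (e * (1 - q))^-1)].
have bern n : q ^+ n * (n%:R * (1 - q)) <= 1.
  have : q ^+ n * (1 + n%:R * (1 - q)) <= 1.
    elim: n => [|n IH]; first by rewrite mul0r addr0 mulr1.
    apply: le_trans IH; rewrite exprSr -mulrA ler_wpM2l ?exprn_ge0// -natr1.
    rewrite (_ : q * _ = 1 + n%:R * (1 - q) - (n%:R + 1) * (1 - q) ^+ 2); last by ring.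
    by rewrite lerBlDr lerDl mulr_ge0 ?addr_ge0 ?sqr_ge0.
  by rewrite mulrDr mulr1; have := exprn_ge0 n q0; lra.
exists n0 => n n0n; have e1 : 0 < e * (1 - q) by rewrite mulr_gt0 ?subr_gt0.
have : 1 <= n%:R * (e * (1 - q)).
  rewrite -ler_pdivrMr// div1r (le_trans (ltW n0P))// ler_nat//.
have := bern n; have := exprn_ge0 n q0; set Q := q ^+ n; set N := n%:R => Q0 b1 b2.
have N0 : 0 < N * (1 - q).
  by rewrite -(pmulr_rgt0 _ e0) mulrCA (lt_le_trans ltr01).
by rewrite -(ler_pM2r N0) (le_trans b1)// mulrCA.
Qed.

(** m = h (1 + h)^-1 is the fixed point of z |-> (Mz - hz + h) / (1 + M), a contraction of ratio M /
    (1 + M). *)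
Lemma resolvent h : opos pi h -> exists m, [/\ cadj m = m, h = m + h *c m & h = m + m *c h].
Proof.
move=> hp; have hsa := hp.1; pose M := nm h; have M0 : 0 <= M := nm_ge0 h.
have M1 : 0 < 1 + M by rewrite ltr_wpDr.
pose q := M / (1 + M).
have q01 : 0 <= q < 1.
  by rewrite divr_ge0 ?(ltW M1)//= ltr_pdivrMr// mul1r ltrDr.
have [q0 q1] := andP q01.
pose step z := (1 + M)^-1%:C *: (M%:C *: z - h *c z + h).
pose s n := iter n step 0.
have stepB z w : nm (step z - step w) <= q * nm (z - w).
  have -> : step z - step w = (1 + M)^-1%:C *: (M%:C *: (z - w) - h *c (z - w)).
    by rewrite /step; calg A.
  rewrite nmZ cm_real ger0_norm ?invr_ge0 ?(ltW M1)// /q [M / _]mulrC -mulrA.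
  by rewrite ler_wpM2l ?invr_ge0 ?(ltW M1)// (opos_sub Hpi).
have sM n : nm (s n) <= M.
  elim: n => [|n IH]; first by rewrite nm0.
  rewrite /s iterS -/(s n) /step nmZ cm_real ger0_norm ?invr_ge0 ?(ltW M1)//.
  rewrite mulrC ler_pdivrMr// (le_trans (nmD _ _))// mulrDr mulr1 addrC lerD//.
  by rewrite (le_trans (opos_sub Hpi _ hp (lexx _)))// ler_wpM2l.
have sB m n : (m <= n)%N -> nm (s n - s m) <= q ^+ m * M.
  move=> /subnK <-; move: (n - m)%N => k.
  elim: m => [|m IH]; first by rewrite addn0 subr0 mul1r.
  rewrite addnS -[s (k + m).+1]/(step (s (k + m)%N)) -[s m.+1]/(step (s m)).
  by rewrite (le_trans (stepB _ _))// exprS -mulrA ler_wpM2l.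
have r0 : tends0 (fun n => q ^+ n * M).
  by apply: (tends0_le (C := M) (tends0_exp q01)) => // n; rewrite mulrC.
have [l sl] := cvg_rate sB r0.
have hl : h = l + h *c l.
  apply/eqP; rewrite -subr_eq0; apply/eqP/nm_le0.
  apply: (@le_tends0 _ (fun n => (1 + M) * (q ^+ n * M) + (1 + M) * (q ^+ n * M) + M * (q ^+ n * M))).
    have C1 : 0 <= 1 + M by exact: ltW.
    by do ?apply: tends0D; apply: (tends0_le r0) => //.
  move=> n; rewrite add0r.
  have -> : h - (l + h *c l) = (1 + M)%:C *: (s n.+1 - l)
      - M%:C *: (s n - l) + h *c (s n - l).
    rewrite /s iterS -/(s n) /step scalerBr scalerA -rmorphM mulfV ?gt_eqF// rmorph1.
    by rewrite scale1r rmorphD rmorph1; calg A.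
  rewrite (le_trans (nmD _ _))// lerD//; last first.
    by rewrite (le_trans (nm_cmul _ _))// ler_wpM2l.
  rewrite (le_trans (nmD _ _))// nmN !nmZ !cm_real !ger0_norm ?(ltW M1)// lerD//.
    rewrite ler_wpM2l ?(ltW M1)// (le_trans (sl _))// exprS -mulrA.
    by rewrite -[leRHS]mul1r ler_wpM2r ?(ltW q1)// mulr_ge0 ?exprn_ge0.
  by rewrite ler_pM ?nm_ge0// lerDr.
exists l; have lh : h = cadj l + cadj l *c h.
  by rewrite -{1}hsa {1}hl cadjD cadjM hsa.
(* Both sides are l^* (1 + h) l; their equality makes l self-adjoint. *)
have e : h *c l = cadj l *c h.
  rewrite {1}lh cmulDl -cmulA -cmulDr -hl.
  by [].
have lsa : cadj l = l.
  by apply: (addIr (cadj l *c h)); rewrite -lh -e.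
by split => //; rewrite {1}lh lsa.
Qed.

Section ResolventBounds.
Variables h m : A.
Hypothesis hp : opos pi h.
Hypothesis hm : h = m + h *c m.

Let kx x : H := x - pi m x.

Lemma resolvent_ip x :
  complex.Re (ip (pi h (kx x)) (kx x)) = complex.Re (ip (pi m x) x) - nm (pi m x) ^+ 2.
Proof.
have -> : pi h (kx x) = pi m x.
  rewrite (repBr rep) -(actM act) -(actB act) {1}hm addrK//.
by rewrite (psdBr P) ReB -/(sq _ _) sq_ip.
Qed.

Lemma resolvent_le x : nm (pi m x) ^+ 2 <= complex.Re (ip (pi m x) x).
Proof. by have := hp.2 (kx x); rewrite resolvent_ip; lra. Qed.

Lemma nm_resolvent : nm m <= 1.
Proof.
apply: (faithful_norm Hpi) => // x; rewrite mul1r.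
have : nm (pi m x) ^+ 2 <= nm (pi m x) * nm x.
  by rewrite (le_trans (resolvent_le x))// (le_trans (Re_le_cm _))// ip_CS.
have := nm_ge0 (pi m x); rewrite le0r => /orP[/eqP->|n0]; first by rewrite nm_ge0.
by rewrite expr2 ler_pM2l.
Qed.

(** (1 - m) h (1 - m) = m - m^2 = 1/4 - (1/2 - m)^2. *)
Lemma resolvent_quarter x : complex.Re (ip (pi h (kx x)) (kx x)) <= nm x ^+ 2 / 4.
Proof.
rewrite resolvent_ip; have := sq_ge0 P ((2^-1)%:C *: x - pi m x).
rewrite (sqB P) (psdZl P) ReZ (sqZ P) cm_real ger0_norm ?invr_ge0// !sq_ip.
rewrite (psd_conj P (pi m x)) ReJ; lra.
Qed.

End ResolventBounds.

(** The classical u = h (1 + h)^-1, where h is [la] times the sum of the a^* a. By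
    [resolvent_quarter], la |a (1 - u) x|^2 <= |x|^2 / 4, whence the choice la = 1 / (4 e^2). *)
Lemma approx_unit_right (s : seq A) (e : R) : 0 < e ->
  exists u, [/\ cadj u = u, nm u <= 1 & forall a, a \in s -> nm (a - a *c u) <= e].
Proof.
move=> e0; pose la := (4 * e ^+ 2)^-1; have la0 : 0 < la by rewrite invr_gt0 mulr_gt0 ?exprn_gt0.
pose S := \sum_(a <- s) cadj a *c a.
have sumE x (t : seq A) : complex.Re (ip (pi (\sum_(a <- t) cadj a *c a) x) x) =
    \sum_(a <- t) nm (pi a x) ^+ 2.
  elim: t => [|a t IH]; first by rewrite !big_nil (act0 act) (psd0l P).
  rewrite !big_cons (actD act) (psdDl P) ReD IH (actM act) (act_adj act) cadjK.
  by rewrite -/(sq _ _) sq_ip.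
have Sp : opos pi S.
  rewrite /S; elim/big_rec: _ => [|a b _ IH]; first exact: opos0.
  by apply: oposD => //; exact: opos_cstar.
have hp : opos pi (la%:C *: S) by apply: oposZ => //; exact: ltW.
have [m [msa hm _]] := resolvent hp.
exists m; split=> //; first exact: (nm_resolvent hp hm).
move=> a sa; apply: (faithful_norm Hpi) => [|x]; first exact: ltW.
have := resolvent_quarter hm x; rewrite (actZ act) (psdZl P) ReZ sumE.
rewrite (actB act) (actM act); set y := x - pi m x => yb.
rewrite -(repBr rep) -/y.
rewrite -ler_sqr ?nnegrE ?mulr_ge0 ?nm_ge0 ?(ltW e0)//.
have : nm (pi a y) ^+ 2 <= \sum_(a <- s) nm (pi a y) ^+ 2.
  rewrite (big_rem a)//= lerDl sumr_ge0// => i _; exact: sqr_ge0.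
move=> /le_trans; apply; rewrite -(ler_pM2l la0) (le_trans yb)//.
have laE : la * e ^+ 2 = 4^-1 by rewrite /la; field; rewrite gt_eqF.
by rewrite exprMn mulrA laE mulrC.
Qed.

Lemma approx_unit (s : seq A) (e : R) : 0 < e ->
  exists u, [/\ cadj u = u, nm u <= 1 &
    forall a, a \in s -> nm (a - a *c u) <= e /\ nm (a - u *c a) <= e].
Proof.
move=> e0; have [u [usa u1 ua]] := approx_unit_right (s ++ map (@cadj R A) s) e0.
exists u; split=> // a sa; split; first by apply: ua; rewrite mem_cat sa.
by rewrite -nm_cadj cadjB cadjM usa; apply: ua; rewrite mem_cat map_f ?orbT.
Qed.

(** The iteration is run for g = 1 - c. Removing from 1 - q its constant term [rho n], which tends
    to 0, puts the approximants of the root in the algebra. *)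
Lemma sqrt_opos c : opos pi c -> nm c <= 1 -> exists2 k, cadj k = k & k *c k = c.
Proof.
move=> cp c1; have lin := @cmul_lin _ _ c; pose g : {poly R} := 1 - 'X.
have gb : pevb (cmul c) g 1.
  move=> z; rewrite pevB pev1 pevX//.
  by have := opos_sub Hpi z cp c1; rewrite rmorph1 scale1r.
have g0 : g`_0 = 1 by rewrite /g coefB coef1 coefX subr0.
pose k n := cpoly c (- sqiter g n).
pose rho n := 1 - sigma R n.
have r0 n : 0 <= rho n by rewrite subr_ge0; have /andP[] := sigma_bounds R n.
have kE n z : pev (cmul c) (1 - sqiter g n) z = (rho n)%:C *: z + k n *c z.
  rewrite pevB pev1 -pevN cpolyE coefN (sqiter_coef0_sigma _ g0).
  by rewrite /rho /k rcB rcN rmorph1; calg A.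
have kB m n : (m <= n)%N -> nm (k n - k m) <= 2 * rho m.
  move=> mn; apply: nm_opl => [|z]; first by rewrite mulr_ge0.
  have -> : (k n - k m) *c z = pev (cmul c) (- (sqiter g n - sqiter g m)) z
      + (rho m - rho n)%:C *: z.
    rewrite (_ : - (_ - _) = (1 - sqiter g n) - (1 - sqiter g m)); last by ring.
    by rewrite pevB !kE (rcB (rho m) (rho n)); calg A.
  rewrite (le_trans (nmD _ _))// [2 * _]mulrC mulr_natr mulr2n mulrDl lerD//.
    exact/pevbN/sqiter_cauchy.
  have rmn : 0 <= rho m - rho n by rewrite subr_ge0 lerD2l lerN2 sigma_mono.
  rewrite nmZ cm_real ler_wpM2r ?nm_ge0// (ger0_norm rmn).
  by have := r0 n; lra.
have rho0 := @sigma_tends R.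
have r20 : tends0 (fun n => 2 * rho n) by apply: (tends0_le (C := 2) rho0).
have [l kl] := cvg_rate kB r20.
exists l; first by apply: (cadj_lim r20 kl) => n; apply: cpoly_sa; exact: cp.1.
have k3 n : nm (k n) <= 3.
  apply: nm_opl => // z.
  have -> : k n *c z = z - pev (cmul c) (sqiter g n) z - (rho n)%:C *: z.
    by have := kE n z; rewrite pevB pev1 => ->; rewrite addrC addKr.
  have s1 : sigma R n <= 1 by have /andP[] := sigma_bounds R n.
  rewrite (le_trans (nmD _ _))// nmN (_ : 3 * _ = (nm z + nm z) + nm z); last by ring.
  rewrite lerD//; last first.
    rewrite nmZ cm_real ger0_norm// -[leRHS]mul1r ler_wpM2r ?nm_ge0//.
    by rewrite /rho lerBlDr lerDl; have /andP[] := sigma_bounds R n.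
  rewrite (le_trans (nmD _ _))// lerD// nmN (le_trans (sqiter_bound lin gb n z))//.
  by rewrite -[leRHS]mul1r ler_wpM2r ?nm_ge0.
have l3 : nm l <= 3.
  apply: (le_tends0 r20) => n; rewrite -[l](subrK (k n)) addrC.
  by rewrite (le_trans (nmD _ _))// lerD// nmB.
have kk n : nm (k n *c k n - c) <= 9 * rho n.
  apply: nm_opl => [|z]; first by rewrite mulr_ge0.
  have -> : (k n *c k n - c) *c z = pev (cmul c) (2 *: (sqiter g n.+1 - sqiter g n)) z
     - (rho n)%:C *: ((rho n)%:C *: z + k n *c z + k n *c z).
    have -> : 2 *: (sqiter g n.+1 - sqiter g n) = (1 - sqiter g n) ^+ 2 - 'X.
      by rewrite sqiter_sqr_sub {2}/g; ring.
    by rewrite pevB expr2 pevM// pevX// !kE; calg A.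
  rewrite (le_trans (nmD _ _))// nmN nmZ cm_real ger0_norm//.
  rewrite (_ : 9 * _ * nm z = 2 * rho n * nm z + rho n * (7 * nm z)); last by ring.
  rewrite lerD//; first exact: (sqiter_step_tends lin gb n z).
  have kz : nm (k n *c z) <= 3 * nm z.
    by rewrite (le_trans (nm_cmul _ _))// ler_wpM2r ?nm_ge0.
  rewrite ler_wpM2l// (_ : 7 * _ = nm z + 3 * nm z + 3 * nm z); last by ring.
  rewrite (le_trans (nmD _ _))// lerD// (le_trans (nmD _ _))// lerD//.
  rewrite nmZ cm_real ger0_norm// -[leRHS]mul1r ler_wpM2r ?nm_ge0//.
  by rewrite /rho lerBlDr lerDl; have /andP[] := sigma_bounds R n.
apply/eqP; rewrite -subr_eq0; apply/eqP/nm_le0.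
apply: (@le_tends0 _ (fun n => 21 * rho n)); first by apply: (tends0_le (C := 21) rho0).
move=> n; rewrite add0r.
have -> : l *c l - c = (k n *c k n - c) - ((k n - l) *c k n + l *c (k n - l)).
  by calg A.
rewrite (le_trans (nmD _ _))// nmN (_ : 21 * _ = 9 * rho n + (2 * rho n * 3 + 3 * (2 * rho n))); last by ring.
rewrite lerD// (le_trans (nmD _ _))// lerD// (le_trans (nm_cmul _ _))// ler_pM ?nm_ge0//.
Qed.

End Resolvent.

(** * Positive functionals *)

Section Functionals.
Variables (R : realType) (A : cstarAlgebra R).
Implicit Types (w r f : dual A) (a b x y : A) (k : R[i]).

Lemma dualD w a b : w (a + b) = w a + w b.
Proof. by have := dual_linear w 1 a b; rewrite scale1r mul1r. Qed.

Lemma dualw0 w : w 0 = 0.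
Proof. by apply: (addrI (w 0)); rewrite -dualD !addr0. Qed.

Lemma dualZ w k a : w (k *: a) = k * w a.
Proof. by have := dual_linear w k a 0; rewrite dualw0 !addr0. Qed.

Lemma dualN w a : w (- a) = - w a.
Proof. by rewrite -scaleN1r dualZ mulN1r. Qed.

Lemma dualB w a b : w (a - b) = w a - w b.
Proof. by rewrite dualD dualN. Qed.

Lemma dual_sum w (I : Type) (s : seq I) (F : I -> A) :
  w (\sum_(i <- s) F i) = \sum_(i <- s) w (F i).
Proof. by rewrite (big_morph _ (dualD w) (dualw0 w)). Qed.

Lemma dual_ext_eq w1 w2 : (forall a, w1 a = w2 a) -> w1 = w2.
Proof.
case: w1 w2 => [f1 l1 b1] [f2 l2 b2] /= /funext e; subst f2.
by congr Dual; exact: Prop_irrelevance.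
Qed.

Definition dle (f : A -> R[i]) (K : R) := forall a, cm (f a) <= K * nm a.

Lemma dual_dle w : exists2 K, 0 <= K & dle w K.
Proof.
have [K K0 wK] := dual_bounded w; exists (complex.Re K); first exact: Re_ge0.
by move=> a; rewrite -lecR -cmE rcM -nmE -(ge0_Re K0).
Qed.

Definition mkdual (f : A -> R[i]) (fl : forall k a b, f (k *: a + b) = k * f a + f b)
  (fb : exists2 K, 0 <= K & dle f K) : dual A.
Proof.
refine (@Dual R A f fl _); have [K K0 fK] := fb; exists K%:C; first by rewrite lecR.
by move=> a; rewrite cmE nmE -rcM lecR.
Defined.

Lemma dnorm_has_sup w : has_sup [set complex.Re `|w a| | a in [set a : A | `|a| <= 1]].
Proof.
split; first by exists (complex.Re `|w 0|), 0 => //=; rewrite normr0.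
have [K K0 wK] := dual_dle w; exists K => _ [a /= a1 <-].
rewrite -/(cm _) (le_trans (wK a))// -[leRHS]mulr1 ler_wpM2l//.
by move: a1; rewrite nmE -[1 : CF R]/(1%:C) lecR.
Qed.

Lemma dnorm_ub w a : nm a <= 1 -> cm (w a) <= dnorm w.
Proof.
move=> a1; apply: sup_ubound; first by case: (dnorm_has_sup w).
by exists a => //=; rewrite nmE -[1 : CF R]/(1%:C) lecR.
Qed.

Lemma dnorm_ge0 w : 0 <= dnorm w.
Proof. by rewrite -(cm0 R) -(dualw0 w) dnorm_ub// nm0. Qed.

Lemma dnorm_dle w : dle w (dnorm w).
Proof.
move=> a; have [a0|a0] := eqVneq (nm a) 0.
  by rewrite (nm_le0 (_ : nm a <= 0)) ?a0// dualw0 cm0 nm0 mulr0.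
have agt : 0 < nm a by rewrite lt0r a0 nm_ge0.
have ai : 0 <= (nm a)^-1 by rewrite invr_ge0 ltW.
have := @dnorm_ub w ((nm a)^-1%:C *: a).
rewrite nmZ dualZ cmM !cm_real (ger0_norm ai) mulVf// => /(_ (lexx _)).
by rewrite mulrC ler_pdivrMr.
Qed.

Lemma dnorm_le w (K : R) : 0 <= K -> dle w K -> dnorm w <= K.
Proof.
move=> K0 wK; apply: ge_sup; first by case: (dnorm_has_sup w).
move=> _ [a /= a1 <-]; rewrite -/(cm _) (le_trans (wK a))//.
rewrite -[leRHS]mulr1 ler_wpM2l//.
by move: a1; rewrite nmE -[1 : CF R]/(1%:C) lecR.
Qed.

Lemma dnorm_approx w (e : R) : 0 < e ->
  exists a, nm a <= 1 /\ exists2 t : R, dnorm w - e < t & w a = t%:C.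
Proof.
move=> e0; have [_ [a /= a1 <-] wa] := sup_adherent e0 (dnorm_has_sup w).
have [k k1 kw] := cm_phase (w a); exists (k *: a); split.
  by rewrite nmZ k1 mul1r; move: a1; rewrite nmE -[1 : CF R]/(1%:C) lecR.
by exists (cm (w a)) => //; rewrite dualZ.
Qed.

Definition formL (r : A -> R[i]) x y := r (cadj y *c x).
Definition formR (r : A -> R[i]) x y := r (x *c cadj y).

Lemma formL_psd r : dpositive r -> psd (formL r).
Proof.
move=> r0; apply: psd_sesqui => [k x y z|k x y z|x]; rewrite /formL//.
- by rewrite cmulDr cmulZr dual_linear.
- by rewrite cadj_semilinear cmulDl cmulZl dual_linear.
Qed.

Lemma formR_psd r : dpositive r -> psd (formR r).
Proof.
move=> r0; apply: psd_sesqui => [k x y z|k x y z|x]; rewrite /formR//.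
- by rewrite cmulDl cmulZl dual_linear.
- by rewrite cadj_semilinear cmulDr cmulZr dual_linear.
- by rewrite -{1}(cadjK x).
Qed.

Lemma formR_adj r x : sq (formR r) x = sq (formL r) (cadj x).
Proof. by rewrite /sq /formR /formL cadjK. Qed.

Lemma formL_action r : dpositive r -> star_action (formL r) (@cmul R A).
Proof.
move=> r0; split=> [|k a b x|a b x|a x y].
- exact: formL_psd.
- by rewrite cmulDl cmulZl.
- by rewrite cmulA.
- by rewrite /formL cadjM cadjK cmulA.
Qed.

Lemma formL_bound r (K : R) x : dpositive r -> 0 <= K -> dle r K ->
  sq (formL r) x <= K * nm x ^+ 2.
Proof.
by move=> r0 K0 rK; rewrite /sq /formL (le_trans (Re_le_cm _))// -nm_cstar rK.
Qed.

Definition representable := exists (H : hilbertSpace R) (pi : A -> H -> H), faithful_rep pi.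

Hypothesis Arep : representable.

Lemma has_approx_unit (s : seq A) (e : R) : 0 < e ->
  exists u, [/\ cadj u = u, nm u <= 1 &
    forall a, a \in s -> nm (a - a *c u) <= e /\ nm (a - u *c a) <= e].
Proof. by have [H [pi Hpi]] := Arep; exact: (approx_unit Hpi). Qed.

(** A self-adjoint approximate unit u reduces this to the symmetry of [formL r] at a and u. *)
Lemma dpos_herm r a : dpositive r -> r (cadj a) = (r a)^*.
Proof.
move=> r0; have [K K0 rK] := dual_dle r.
apply/eqP; rewrite -subr_eq0; apply/eqP/cm_le0.
apply: (@le_eps _ _ _ (K + K)) => e e0; rewrite add0r.
have [u [usa u1 /(_ a)]] := has_approx_unit [:: a] e0.
rewrite mem_head => /(_ isT)[_ ua].
have e1 : r (cadj a *c u) = (r (u *c a))^*.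
  by have := psd_conj (formL_psd r0) a u; rewrite /formL usa.
rewrite (_ : _ - _ = r (cadj (a - u *c a)) - (r (a - u *c a))^*); last first.
  by rewrite cadjB cadjM usa !dualB rmorphB /= e1; ring.
rewrite (le_trans (cmD _ _))// cmN cmJ mulrDl lerD// (le_trans (rK _))// ?nm_cadj ler_wpM2l//.
Qed.

Lemma dpos_CS r (K : R) a : dpositive r -> 0 <= K -> dle r K ->
  cm (r a) <= Num.sqrt K * sn (formL r) a.
Proof.
move=> r0 K0 rK; have F := formL_psd r0.
apply: (@le_eps _ _ _ K) => e e0.
have [u [usa u1 /(_ a)]] := has_approx_unit [:: a] e0.
rewrite mem_head => /(_ isT)[_ ua].
rewrite -[a in r a](subrK (u *c a)) dualD addrC (le_trans (cmD _ _))// lerD//.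
  have -> : r (u *c a) = formL r a u by rewrite /formL usa.
  rewrite (le_trans (sn_CS F _ _))// mulrC ler_wpM2r ?sn_ge0//.
  rewrite /sn ler_wsqrtr// (le_trans (formL_bound _ r0 K0 rK))//.
  by rewrite -[leRHS]mulr1 ler_wpM2l// expr_le1 ?nm_ge0.
by rewrite (le_trans (rK _))// ler_wpM2l.
Qed.

Lemma dpos_CS' r (K : R) a : dpositive r -> 0 <= K -> dle r K ->
  cm (r a) <= Num.sqrt K * sn (formR r) a.
Proof.
move=> r0 K0 rK; rewrite /sn formR_adj -/(sn _ _) -cmJ -dpos_herm//.
exact: dpos_CS.
Qed.

(* the extension of r to the unitization, with value rho at the unit *)
Definition uform (r : A -> R[i]) (rho : R) (p q : R[i]^o * A) : R[i] :=
  p.1 * q.1^* * rho%:C + q.1^* * r p.2 + p.1 * (r q.2)^* + r (cadj q.2 *c p.2).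

Definition uact a (p : R[i]^o * A) : R[i]^o * A := (0, p.1 *: a + a *c p.2).

(** Positivity amounts to |r(a)|^2 <= rho r(a^* a). The vector (1, 0) is the cyclic vector that a
    non-unital algebra lacks, with squared norm rho. *)
Lemma uform_action r (rho : R) : dpositive r -> 0 <= rho -> dle r rho ->
  star_action (uform r rho) uact.
Proof.
move=> r0 rho0 rr; have F := formL_psd r0; split=> [|k a b x|a b x|a x y].
- split=> [k x y z|x y|[l a]].
  + rewrite /uform /= !dual_linear cmulDr cmulZr dual_linear.
    by rewrite -[k *: x.1]/(k * x.1); ring.
  + rewrite /uform !rmorphD !rmorphM /= conjR !conjCK.
    have -> : (r (cadj y.2 *c x.2))^* = r (cadj x.2 *c y.2).
      by rewrite -dpos_herm// cadjM cadjK.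
    by ring.
  + rewrite /uform /= -[r (_ *c _)]/(formL r a a) (sqE F).
    set z := l^* * r a; have -> : l * (r a)^* = z^* by rewrite /z rmorphM /= conjCK.
    rewrite -normCK cmE -rcX -rcM -[_ + z + _]addrA.
    have -> : z + z^* = (2 * complex.Re z)%:C.
      by case: z => c d; apply/eqP; rewrite eq_complex /=; apply/andP; split; apply/eqP; ring.
    rewrite -!rcD lecR.
    have : - complex.Re z <= cm l * (Num.sqrt rho * sn (formL r) a).
      rewrite -ReN (le_trans (Re_le_cm _))// cmN /z cmM cmJ ler_wpM2l ?cm_ge0//.
      exact: dpos_CS.
    rewrite -{2}(sqr_sqrtr rho0) -(sn_sqr F).
    have := sqr_ge0 (cm l * Num.sqrt rho - sn (formL r) a); nra.
- congr pair => /=; first by rewrite scaler0 addr0.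
  by calg A.
- by congr pair => /=; calg A.
- rewrite /uform /= rmorph0 cadjD cadjZ cadjM cadjK cmulDr cmulDl !cmulZr !cmulZl.
  rewrite !dualD !dualZ !rmorphD !rmorphM /= -!dpos_herm// !cadjM !cadjK !cmulA.
  by ring.
Qed.

End Functionals.

(** * Strict continuity of positive functionals *)

Section Cut.
Variables (R : realType) (A : cstarAlgebra R).
Implicit Types (r : dual A) (a e x y : A).

Fact dcut_linear r e (k : R[i]) a b :
  (fun a => r (a - e *c a - (a - e *c a) *c e)) (k *: a + b) =
  k * r (a - e *c a - (a - e *c a) *c e) + r (b - e *c b - (b - e *c b) *c e).
Proof. by rewrite -dual_linear; congr (r _); calg A. Qed.

Fact dcut_bounded r e :
  exists2 K, 0 <= K & dle (fun a => r (a - e *c a - (a - e *c a) *c e)) K.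
Proof.
have [K K0 rK] := dual_dle r.
have e1 : 0 <= 1 + nm e by rewrite addr_ge0 ?nm_ge0.
exists (K * ((1 + nm e) * (1 + nm e))); first by rewrite !mulr_ge0.
move=> a; rewrite (le_trans (rK _))// -mulrA ler_wpM2l//.
have a1 : nm (a - e *c a) <= (1 + nm e) * nm a.
  by rewrite (le_trans (nmD _ _))// nmN mulrDl mul1r lerD2l nm_cmul.
rewrite (le_trans (nmD _ _))// nmN [X in _ <= X]mulrAC mulrC mulrDl mul1r.
have : nm ((a - e *c a) *c e) <= nm e * ((1 + nm e) * nm a).
  by rewrite (le_trans (nm_cmul _ _))// mulrC ler_wpM2l ?nm_ge0.
by move=> h; rewrite lerD// (le_trans h)// mulrC.
Qed.

(* the functional r((1 - e) . (1 - e)) *)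
Definition dcut r e : dual A := mkdual (dcut_linear r e) (dcut_bounded r e).

Lemma sq_dcut r e x : cadj e = e -> sq (formL (dcut r e)) x = sq (formL r) (x - x *c e).
Proof. by move=> ee; rewrite /sq /formL /=; congr (complex.Re (r _)); rewrite cadjB cadjM ee; calg A. Qed.

Lemma dcut_pos r e : cadj e = e -> dpositive r -> dpositive (dcut r e).
Proof.
move=> ee r0 a; rewrite /=; have := r0 (a - a *c e).
rewrite cadjB cadjM ee (_ : (_ - _) *c (_ - _) = cadj a *c a - e *c (cadj a *c a) -
   (cadj a *c a - e *c (cadj a *c a)) *c e)//; by calg A.
Qed.

Hypothesis Arep : representable A.

(** For y nearly norming r and e = y y^*, the vector 1 - e of the unitization has squared norm rho -
    2 r(e) + r(e^2) <= rho - r(e), which is small since |r(y)|^2 <= rho r(e). The cut functional is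
    the vector functional of 1 - e. *)
Lemma dcut_small r (de : R) : dpositive r -> 0 < de ->
  exists y, nm y <= 1 /\ dle (dcut r (y *c cadj y)) de.
Proof.
move=> r0 de0; have F := formL_psd r0.
have r0' := dnorm_ge0 r; have rr := dnorm_dle r.
have [y [y1 [t rt ry]]] := dnorm_approx r (divr_gt0 de0 (ltr0Sn _ 1)).
exists y; split=> //; set e := y *c cadj y; set rho := dnorm r in r0' rr rt.
have ee : cadj e = e by rewrite /e cadjM cadjK.
have re0 : 0 <= complex.Re (r e) by exact: (sq_ge0 (formR_psd r0) y).
have tre : t ^+ 2 <= rho * complex.Re (r e).
  have := dpos_CS' Arep y r0 r0' rr.
  rewrite -ler_sqr ?nnegrE ?cm_ge0 ?mulr_ge0 ?sqrtr_ge0//.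
  by rewrite exprMn sqr_sqrtr// (sn_sqr (formR_psd r0)) ry cm_real real_normK ?num_real.
have ree : complex.Re (r (e *c e)) <= complex.Re (r e).
  have := act_contr (formL_action r0) y (cadj y).
  rewrite -/e /sq /formL ee cadjK -/e => /le_trans; apply.
  by rewrite -[leRHS]mul1r ler_wpM2r// expr_le1 ?nm_ge0.
have U := uform_action Arep r0 r0' rr; have UP := act_psd U.
set xi : R[i]^o * A := (1, - e).
have xi1 : sq (uform r rho) xi <= de.
  rewrite /sq /uform /= rmorph1 !mul1r cadjN ee cmulNl cmulNr opprK !dualN.
  have rJ : (r e)^* = r e by rewrite -(dpos_herm Arep _ r0) ee.
  rewrite rmorphN /= rJ.
  have -> : complex.Re (rho%:C - r e - r e + r (e *c e)) =
     rho - 2 * complex.Re (r e) + complex.Re (r (e *c e)).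
    by rewrite !(ReD, ReN) /=; ring.
  have [rho1|rho1] := leP rho (complex.Re (r e)); first by lra.
  have : rho - de <= complex.Re (r e).
    have rhogt : 0 < rho by exact: le_lt_trans re0 rho1.
    have [t0|t0] := leP 0 t; last by lra.
    rewrite -(ler_pM2l rhogt) (le_trans _ tre)//.
    have [d0|d0] := leP (rho - de / 2) 0.
      have d1 : rho - de <= 0 by lra.
      by have := sqr_ge0 t; nra.
    have : (rho - de / 2) ^+ 2 <= t ^+ 2 by rewrite ler_sqr ?nnegrE ?(ltW rt)// ltW.
    by have := sqr_ge0 de; lra.
  lra.
move=> a; have -> : dcut r e a = uform r rho (uact a xi) xi.
  rewrite /uform /uact /= rmorph1 !mul0r mul1r add0r addr0 -dualD.
  by rewrite scale1r cadjN ee; congr (r _); calg A.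
rewrite (le_trans (sn_CS UP _ _))//.
have xs : sn (uform r rho) xi ^+ 2 <= de by rewrite (sn_sqr UP).
rewrite (le_trans (ler_wpM2r (sn_ge0 _ _) (act_sn U a xi)))// -mulrA mulrC -expr2.
by rewrite ler_wpM2r ?nm_ge0.
Qed.

End Cut.

Section StrictBound.
Variables (R : realType) (A : cstarAlgebra R) (H : hilbertSpace R).
Variable pi : A -> H -> H.
Hypothesis Hpi : faithful_rep pi.
Implicit Types (x y z : A).
Let Arep : representable A. Proof. by exists H, pi. Qed.
Let act := rep_action Hpi.1.
Let P := @ip_psd R H.

Variable r : dual A.
Hypothesis r0 : dpositive r.

Let i2 : 0 <= 2^-1 :> R. Proof. by rewrite invr_ge0. Qed.
Let i16 : 0 <= 16^-1 :> R. Proof. by rewrite invr_ge0. Qed.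
Let i4 : 0 <= 4^-1 :> R. Proof. by rewrite invr_ge0. Qed.

Let cutsel (s : dual A) (n : nat) : A :=
  xget 0 [set y | nm y <= 1 /\ dle (dcut s (y *c cadj y)) (16^-1 ^+ n)].

Let rs := fix rs n : dual A :=
  if n is m.+1 then dcut (rs m) (cutsel (rs m) m *c cadj (cutsel (rs m) m)) else r.

Let y n := cutsel (rs n) n.
Let e n := y n *c cadj (y n).

Let esa n : cadj (e n) = e n.
Proof. by rewrite /e cadjM cadjK. Qed.

Let rs_pos n : dpositive (rs n).
Proof. by elim: n => [//|n IH]; apply: dcut_pos => //; exact: esa. Qed.

Let yP n : nm (y n) <= 1 /\ dle (rs n.+1) (16^-1 ^+ n).
Proof.
rewrite /= -/(y n); rewrite /y /cutsel.
case: xgetP => [z _ //|none].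
have i16' : 0 < 16^-1 :> R by rewrite invr_gt0.
have [z zP] := dcut_small Arep (rs_pos n) (exprn_gt0 n i16').
by case: (none z).
Qed.

Let e1 n : nm (e n) <= 1.
Proof. by rewrite /e nm_cstar' expr_le1 ?nm_ge0//; have [] := yP n. Qed.

Let epos n : opos pi (e n).
Proof. by rewrite /e -{1}(cadjK (y n)); exact: opos_cstar. Qed.

Let S n := \sum_(i < n) (2^-1 ^+ i.+1)%:C *: e i.

Let geo m n : (m <= n)%N -> \sum_(m <= i < n) 2^-1 ^+ i.+1 <= 2^-1 ^+ m :> R.
Proof.
move=> mn; have : \sum_(m <= i < n) 2^-1 ^+ i.+1 = 2^-1 ^+ m - 2^-1 ^+ n :> R.
  elim: n mn => [|n IH].
    by rewrite leqn0 => /eqP->; rewrite big_geq// subrr.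
  rewrite leq_eqVlt => /orP[/eqP->|]; first by rewrite big_geq// subrr.
  by rewrite ltnS => mn; rewrite big_nat_recr//= IH// exprS; field.
by move=> ->; rewrite lerBlDr lerDl exprn_ge0.
Qed.

Let SB m n : (m <= n)%N -> nm (S n - S m) <= 2^-1 ^+ m.
Proof.
move=> mn; rewrite /S -!(big_mkord xpredT (fun i => (2^-1 ^+ i.+1)%:C *: e i)).
rewrite (big_cat_nat (n := m))//= addrAC subrr add0r (le_trans (nm_sum _ _))//.
rewrite (le_trans _ (geo mn))// ler_sum// => i _.
by rewrite nmZ cm_real ger0_norm ?exprn_ge0// ler_piMr ?exprn_ge0.
Qed.

(** k is the root of c, the sum of the 2^-(i+1) e_i. From c >= 2^-(n+1) e_n and e_n^2 <= e_n one
    gets |e_n x|^2 <= 2^(n+1) |k x|^2, so the seminorm lost at stage n is a constant times (16^-n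
    2^n)^(1/2) |k x|. The decay 16^-n is chosen to beat the weights 2^n. *)
Lemma strict_bound : exists k (C : R), [/\ cadj k = k, 0 <= C &
  forall x, sn (formR r) x <= C * nm (k *c x)].
Proof.
have [c Sc] := cvg_rate SB (@tends0_geo R).
have Ssa n : cadj (S n) = S n.
  by rewrite /S cadj_sum; apply: eq_bigr => i _; rewrite cadjZR esa.
have SE n (x : H) : complex.Re (ip (pi (S n) x) x) =
    \sum_(i < n) 2^-1 ^+ i.+1 * complex.Re (ip (pi (e i) x) x).
  rewrite /S; elim: n => [|n IH].
    by rewrite !big_ord0 (act0 act) (psd0l P).
  by rewrite !big_ord_recr /= (actD act) (psdDl P) ReD IH (actZ act) (psdZl P) ReZ.
have term_ge0 i (x : H) : 0 <= 2^-1 ^+ i.+1 * complex.Re (ip (pi (e i) x) x).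
  by rewrite mulr_ge0 ?exprn_ge0//; case: (epos i).
have Slim n (x : H) : complex.Re (ip (pi (S n) x) x) <=
    complex.Re (ip (pi c x) x) + 2^-1 ^+ n * nm x ^+ 2.
  rewrite -lerBlDl -ReB -(psdBl P) -(actB act) (le_trans (Re_le_cm _))//.
  rewrite (le_trans (ip_CS _ _))// expr2 mulrA ler_wpM2r ?nm_ge0//.
  by rewrite (le_trans (rep_contr Hpi.1 _ _))// ler_wpM2r ?nm_ge0.
have ge (x : H) i : 2^-1 ^+ i.+1 * complex.Re (ip (pi (e i) x) x) <= complex.Re (ip (pi c x) x).
  apply: (@le_tends0 _ (fun n => nm x ^+ 2 * 2^-1 ^+ (i.+1 + n))).
    apply: (tends0_le (C := nm x ^+ 2) (@tends0_geo R)) => [n|]; last exact: sqr_ge0.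
    by rewrite ler_wpM2l ?sqr_ge0// exprD ger_pMl ?exprn_gt0 ?invr_gt0// exprn_ile1// invf_le1// ler1n.
  move=> n; rewrite [nm x ^+ 2 * _]mulrC (le_trans _ (Slim _ _))// SE.
  rewrite (bigD1 (Ordinal (ltn_addr n (ltnSn i))))//= lerDl.
  by rewrite sumr_ge0// => j _; exact: term_ge0.
have cpos : opos pi c.
  split=> [|x]; first exact: (cadj_lim (@tends0_geo R) Sc).
  exact: le_trans (term_ge0 0%N x) (ge x 0%N).
have c1 : nm c <= 1.
  apply: (le_tends0 (@tends0_geo R)) => n.
  rewrite -[c](subrK (S n)) addrC (le_trans (nmD _ _))// lerD//; last by rewrite nmB.
  by have := SB (leq0n n); rewrite /S big_ord0 subr0.
have [k ksa kk] := sqrt_opos Hpi cpos c1.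
have ek n x : nm (e n *c x) ^+ 2 <= 2 ^+ n.+1 * nm (k *c x) ^+ 2.
  have K0 : 0 <= 2 ^+ n.+1 * nm (k *c x) ^+ 2 by rewrite mulr_ge0 ?sqr_ge0 ?exprn_ge0.
  rewrite -[leRHS](sqr_sqrtr K0) ler_sqr ?nnegrE ?nm_ge0 ?sqrtr_ge0//.
  apply: (faithful_norm Hpi) => [|z]; first exact: sqrtr_ge0.
  rewrite -ler_sqr ?nnegrE ?mulr_ge0 ?nm_ge0 ?sqrtr_ge0// exprMn sqr_sqrtr//.
  rewrite (actM act) (le_trans (opos_sqr Hpi _ (epos n) (e1 n)))// mul1r.
  have := ge (pi x z) n; rewrite exprVn ler_pdivrMl ?exprn_gt0// => /le_trans; apply.
  rewrite -kk (actM act) (act_adj act) ksa -(actM act) -/(sq _ _) sq_ip -mulrA.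
  rewrite ler_wpM2l ?exprn_ge0// -exprMn ler_sqr ?nnegrE ?mulr_ge0 ?nm_ge0//.
  exact: rep_contr Hpi.1 _ _.
have [K K0 rK] := dual_dle r.
have step n x (L : R) : 0 <= L -> dle (rs n) L ->
  sn (formR (rs n)) x <= sn (formR (rs n.+1)) x + Num.sqrt (L * 2 ^+ n.+1) * nm (k *c x).
  move=> L0 nL; have Fn := formL_psd (rs_pos n).
  rewrite /sn !formR_adj /= -/(y n) -/(e n) (sq_dcut _ _ (esa n)) -!/(sn _ _).
  (* x^* = x^* (1 - e_n) + x^* e_n; the first part carries the seminorm of the next functional. *)
  rewrite -{1}[cadj x](subrK (cadj x *c e n)) (le_trans (snD Fn _ _))// lerD2l.
  rewrite -[nm (k *c x)]ger0_norm ?nm_ge0// -sqrtr_sqr -sqrtrM ?mulr_ge0 ?exprn_ge0//.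
  rewrite /sn ler_wsqrtr// (le_trans (formL_bound _ (rs_pos n) L0 nL))//.
  by rewrite -nm_cadj cadjM esa cadjK -mulrA ler_wpM2l.
pose C := Num.sqrt (K * 2 ^+ 1) + 4.
have tele n x : sn (formR r) x <= sn (formR (rs n.+1)) x +
    (Num.sqrt (K * 2 ^+ 1) + \sum_(0 <= i < n) 4 * 2^-1 ^+ i.+1) * nm (k *c x).
  elim: n => [|n IH]; first by rewrite big_geq// addr0; exact: (step 0%N x K K0 rK).
  have [_ yn] := yP n; rewrite big_nat_recr//= addrA [in leRHS]mulrDl.
  have h := step n.+1 x _ (exprn_ge0 n i16) yn.
  suff q : Num.sqrt (16^-1 ^+ n * 2 ^+ n.+2) <= 4 * 2^-1 ^+ n.+1 :> R.
    have := ler_wpM2r (nm_ge0 (k *c x)) q; move: IH h; lra.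
  have q0 : 0 <= 4 * 2^-1 ^+ n.+1 :> R by rewrite mulr_ge0 ?exprn_ge0.
  rewrite -[leRHS]ger0_norm// -sqrtr_sqr ler_wsqrtr// exprMn -exprM mulnC exprM.
  rewrite (_ : 2^-1 ^+ 2 = 4^-1 :> R); last by field.
  rewrite !exprS expr0 mulr1.
  have : 16^-1 ^+ n * 2 ^+ n <= 4^-1 ^+ n :> R.
    by rewrite -exprMn lerXn2r ?nnegrE//; lra.
  set a := 16^-1 ^+ n; set b := 2 ^+ n; set d := 4^-1 ^+ n; lra.
exists k, C; split=> //; first by rewrite addr_ge0 ?sqrtr_ge0.
move=> x; apply: (@le_tends0 _ (fun n => nm x * 2^-1 ^+ n)).
  by apply: (tends0_le (C := nm x) (@tends0_geo R)) => [n|]; [exact: lexx|exact: nm_ge0].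
move=> n; rewrite (le_trans (tele n x))// addrC lerD//.
  rewrite ler_wpM2r ?nm_ge0// lerD2l -mulr_sumr -[leRHS]mulr1 ler_wpM2l//.
  by have := geo (leq0n n); rewrite expr0.
have [_ yn] := yP n.
rewrite /sn formR_adj -[nm x]ger0_norm ?nm_ge0// -[2^-1 ^+ n]ger0_norm ?exprn_ge0//.
rewrite -!sqrtr_sqr -sqrtrM ?sqr_ge0// ler_wsqrtr//.
rewrite (le_trans (formL_bound _ (rs_pos n.+1) (exprn_ge0 _ _) yn))//.
rewrite nm_cadj mulrC ler_wpM2l ?sqr_ge0// -exprM mulnC exprM lerXn2r ?nnegrE//; lra.
Qed.

End StrictBound.

(** * Multipliers and strict extensions *)

Section MultiplierBasics.
Variables (R : realType) (A : cstarAlgebra R).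
Implicit Types (m n : multiplier A) (a b x z : A) (k : R[i]).

Lemma multiplier_eq m n :
  (forall a, mleft m a = mleft n a) -> (forall a, mright m a = mright n a) -> m = n.
Proof.
case: m n => [l1 r1 c1] [l2 r2 c2] /= /funext el /funext er; subst l2 r2.
by congr Multiplier; exact: Prop_irrelevance.
Qed.

Lemma mleft_linear m k a b : mleft m (k *: a + b) = k *: mleft m a + mleft m b.
Proof. by apply: cmul_injr => z; rewrite cmulDr cmulZr !mcentral cmulDr cmulZr. Qed.

Lemma mright_linear m k a b : mright m (k *: a + b) = k *: mright m a + mright m b.
Proof. by apply: cmul_injl => z; rewrite cmulDl cmulZl -!mcentral cmulDl cmulZl. Qed.

Lemma mleftM m a b : mleft m (a *c b) = mleft m a *c b.
Proof. by apply: cmul_injr => z; rewrite cmulA !mcentral cmulA. Qed.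

Lemma mrightM m a b : mright m (a *c b) = a *c mright m b.
Proof. by apply: cmul_injl => z; rewrite -cmulA -!mcentral cmulA. Qed.

Lemma mleftB m a b : mleft m (a - b) = mleft m a - mleft m b.
Proof. by have := mleft_linear m (-1) b a; rewrite !scaleN1r addrC => ->; rewrite addrC. Qed.

Lemma mrightB m a b : mright m (a - b) = mright m a - mright m b.
Proof. by have := mright_linear m (-1) b a; rewrite !scaleN1r addrC => ->; rewrite addrC. Qed.

Lemma mleftD m a b : mleft m (a + b) = mleft m a + mleft m b.
Proof. by have := mleft_linear m 1 a b; rewrite !scale1r. Qed.

Lemma mrightD m a b : mright m (a + b) = mright m a + mright m b.
Proof. by have := mright_linear m 1 a b; rewrite !scale1r. Qed.

Lemma mleft0 m : mleft m 0 = 0.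
Proof. by apply: (addrI (mleft m 0)); rewrite -mleftD !addr0. Qed.

Lemma mright0 m : mright m 0 = 0.
Proof. by apply: (addrI (mright m 0)); rewrite -mrightD !addr0. Qed.

Lemma mleftZ m k a : mleft m (k *: a) = k *: mleft m a.
Proof. by have := mleft_linear m k a 0; rewrite mleft0 !addr0. Qed.

Lemma mrightZ m k a : mright m (k *: a) = k *: mright m a.
Proof. by have := mright_linear m k a 0; rewrite mright0 !addr0. Qed.

Definition mbound m (M : R) := forall b, nm (mleft m b) <= M * nm b.

Lemma mbound_right m (M : R) b : mbound m M -> nm (mright m b) <= M * nm b.
Proof.
move=> mM; set c := mright m b.
have : nm c ^+ 2 <= M * nm b * nm c.
  rewrite -nm_cstar' -mcentral (le_trans (nm_cmul _ _))//.
  have := mM (cadj c); rewrite nm_cadj => /(ler_wpM2l (nm_ge0 b)) /le_trans; apply.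
  by rewrite mulrCA mulrA.
have := nm_ge0 c; rewrite le0r => /orP[/eqP c0|c0]; last by rewrite expr2 ler_pM2r.
move=> _; rewrite c0; have [->|b0] := eqVneq (nm b) 0; first by rewrite mulr0.
have M0 : 0 <= M.
  by have := le_trans (nm_ge0 _) (mM b); rewrite pmulr_lge0// lt0r b0 nm_ge0.
by rewrite mulr_ge0 ?nm_ge0.
Qed.

Lemma mbound_madj m (M : R) : mbound m M -> mbound (madj m) M.
Proof. by move=> mM b; rewrite /= nm_cadj -[nm b]nm_cadj; exact: mbound_right. Qed.

Lemma mbound_membed a : mbound (membed a) (nm a).
Proof. by move=> b; exact: nm_cmul. Qed.

Lemma mbound_mmul m n (M N : R) : 0 <= M -> mbound m M -> mbound n N ->
  mbound (mmul m n) (M * N).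
Proof. by move=> M0 mM nN b; rewrite (le_trans (mM _))// -mulrA ler_wpM2l. Qed.

Lemma mbound_madd m n (M N : R) : mbound m M -> mbound n N -> mbound (madd m n) (M + N).
Proof. by move=> mM nN b; rewrite (le_trans (nmD _ _))// mulrDl lerD. Qed.

Lemma mbound_mscale k m (M : R) : mbound m M -> mbound (mscale k m) (cm k * M).
Proof. by move=> mM b; rewrite /= nmZ -mulrA ler_wpM2l ?cm_ge0. Qed.

Lemma madjK m : madj (madj m) = m.
Proof. by apply: multiplier_eq => a /=; rewrite !cadjK. Qed.

Definition mnear m (s : seq A) (e : R) z := forall b, b \in s ->
  nm (z *c b - mleft m b) <= e /\ nm (b *c z - mright m b) <= e.

Hypothesis Arep : representable A.

(** Strict density with control of the norm: z = m u for an approximate unit u adapted to [s] and to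
    its image under m. *)
Lemma mnear_exists m (M : R) (s : seq A) (e : R) : 0 <= M -> mbound m M -> 0 < e ->
  exists z, nm z <= M /\ mnear m s e z.
Proof.
move=> M0 mM e0; have M1 : 0 < M + 1 by rewrite ltr_wpDl.
have [u [usa u1 us]] := has_approx_unit Arep (s ++ map (mright m) s) (divr_gt0 e0 M1).
have eM : e / (M + 1) <= e by rewrite ler_pdivrMr// ler_peMr ?(ltW e0)// lerDr.
exists (mleft m u); split.
  by rewrite (le_trans (mM u))// -[leRHS]mulr1 ler_wpM2l.
move=> b sb; split.
  have [_ bu] := us b ltac:(by rewrite mem_cat sb).
  rewrite -mleftM -mleftB (le_trans (mM _))// nmB.
  rewrite (le_trans (ler_wpM2l M0 bu))// mulrCA ler_piMr ?(ltW e0)//.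
  by rewrite ler_pdivrMr// mul1r lerDl.
have [bu _] := us (mright m b) ltac:(by rewrite mem_cat map_f ?orbT).
by rewrite mcentral nmB (le_trans bu).
Qed.

(** Being bounded, one z serves both m and m m^*. The product is controlled on one side only, which
    is what bounds through [k *c z] call for. *)
Lemma mnear_mmul_adj m (M : R) (s : seq A) (e : R) : 0 <= M -> mbound m M -> 0 < e ->
  exists z, [/\ nm z <= M, mnear m s e z &
    forall b, b \in s -> nm (b *c (z *c cadj z) - mright (mmul m (madj m)) b) <= e].
Proof.
move=> M0 mM e0; have M1 : 0 < M + 1 by rewrite ltr_wpDl.
have [z [z1 zs]] := @mnear_exists m M (s ++ map (fun b => cadj (mright m b)) s) _ M0 mM
   (divr_gt0 e0 M1).
have eM : e / (M + 1) <= e by rewrite ler_pdivrMr// ler_peMr ?(ltW e0)// lerDr.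
exists z; split=> // [b sb|b sb].
  have [h1 h2] := zs b ltac:(by rewrite mem_cat sb).
  by split; exact: le_trans eM.
have [_ h1] := zs b ltac:(by rewrite mem_cat sb).
have [h2 _] := zs (cadj (mright m b))
  ltac:(by rewrite mem_cat (map_f (fun b => cadj (mright m b))) ?orbT).
rewrite /= -[X in nm X](subrK (mright m b *c cadj z)).
have -> : b *c (z *c cadj z) - cadj (mleft m (cadj (mright m b))) - mright m b *c cadj z
    + mright m b *c cadj z = (b *c z - mright m b) *c cadj z +
      cadj (z *c cadj (mright m b) - mleft m (cadj (mright m b))).
  by calg A.
rewrite (le_trans (nmD _ _))// nm_cadj.
have eE : e / (M + 1) * M + e / (M + 1) = e by field; rewrite gt_eqF.
rewrite -eE.
rewrite lerD// (le_trans (nm_cmul _ _))// nm_cadj ler_pM ?nm_ge0//.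
Qed.

End MultiplierBasics.

Section DualExt.
Variables (R : realType) (A : cstarAlgebra R).
Hypothesis Arep : representable A.
Implicit Types (m n : multiplier A) (a b x z : A) (w s : dual A).

Lemma strict_filter m (M : R) : 0 <= M -> mbound m M -> ProperFilter (strict_nbhs m).
Proof.
move=> M0 mM; split.
  case=> l [e [e0 le]].
  have eR : 0 < complex.Re e by move: e0; rewrite ltcE => /andP[].
  have [z [_ zl]] := mnear_exists Arep l M0 mM (divr_gt0 eR (ltr0Sn _ 1)).
  apply: (le z) => b /zl[h1 h2]; rewrite !nmE (ge0_Re (ltW e0)) !ltcR.
  by rewrite !(le_lt_trans h1, le_lt_trans h2)// ltr_pdivrMr// ltr_pMr// ltr1n.
split.
- by exists [::], 1.
- move=> P Q [l [e [e0 le]]] [l' [e' [e0' le']]].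
  have eR : 0 < complex.Re e by move: e0; rewrite ltcE => /andP[].
  have eR' : 0 < complex.Re e' by move: e0'; rewrite ltcE => /andP[].
  exists (l ++ l'), (Num.min (complex.Re e) (complex.Re e'))%:C; split.
    by rewrite ltcR lt_min eR.
  move=> x xl; split.
    apply: le => b bl; have := xl b ltac:(by rewrite mem_cat bl).
    rewrite !nmE (ge0_Re (ltW e0)) !ltcR => -[h1 h2]; move: h1 h2.
    by rewrite !lt_min => /andP[-> _] /andP[-> _].
  apply: le' => b bl; have := xl b ltac:(by rewrite mem_cat bl orbT).
  rewrite !nmE (ge0_Re (ltW e0')) !ltcR => -[h1 h2]; move: h1 h2.
  by rewrite !lt_min => /andP[_ ->] /andP[_ ->].
- by move=> P Q PQ [l [e [e0 le]]]; exists l, e; split=> // x xl; exact/PQ/le.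
Qed.

(** This makes [w] strictly continuous, and the error of an approximation of a multiplier is read
    off at [k] alone. *)
Definition strict_dom w (k : A) (C : R) := 0 <= C /\ forall z, cm (w z) <= C * nm (k *c z).

Definition dominated w s := dpositive s /\ forall z, cm (w z) <= sn (formR s) z.

Lemma dominated_strict w s : dominated w s -> exists k C, strict_dom w k C.
Proof.
move=> [s0 ws]; have [H [pi Hpi]] := Arep.
have [k [C [ksa C0 kC]]] := strict_bound Hpi s0.
by exists k, C; split=> // z; exact: le_trans (ws z) (kC z).
Qed.

Lemma ext_value w k (C M : R) m : strict_dom w k C -> 0 <= M -> mbound m M ->
  exists l, forall z, cm (w z - l) <= C * nm (k *c z - mright m k).
Proof.
move=> [C0 wk] M0 mM.
pose u (n : nat) : A := xget 0 [set z | nm (k *c z - mright m k) <= 2^-1 ^+ n].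
have uP (n : nat) : nm (k *c u n - mright m k) <= 2^-1 ^+ n.
  rewrite /u; case: xgetP => [z _ //|none].
  have h2 : 0 < 2^-1 ^+ n :> R by rewrite exprn_gt0// invr_gt0.
  have [z [_ /(_ k)]] := mnear_exists Arep [:: k] M0 mM h2.
  by rewrite mem_head => /(_ isT)[_ zP]; case: (none z).
have wB z z' : cm (w z - w z') <= C * nm (k *c z - k *c z').
  by rewrite -dualB -cmulBr.
have uC (p n : nat) : (p <= n)%N -> cm (w (u n) - w (u p)) <= 2 * C * 2^-1 ^+ p.
  move=> pn; rewrite (le_trans (wB _ _))// [2 * C]mulrC -mulrA ler_wpM2l//.
  rewrite (le_trans (nm_triangle _ (mright m k) _))// mulr_natl mulr2n lerD//.
    rewrite (le_trans (uP n))// ler_wiXn2l// ?invr_ge0// invf_le1// ler1n//.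
  by rewrite nmB.
have r0 : tends0 (fun n : nat => 2 * C * 2^-1 ^+ n : R).
  by apply: (tends0_le (C := 2 * C) (@tends0_geo R)) => //; rewrite mulr_ge0.
have [l ul] := cvg_rateC uC r0.
exists l => z; apply: (@le_tends0 _ (fun n : nat => 2 * (2 * C * 2^-1 ^+ n) + C * 2^-1 ^+ n)).
  apply: tends0D; first by apply: (tends0_le (C := 2) r0).
  by apply: (tends0_le (C := C) (@tends0_geo R)).
move=> n; have h1 := le_trans (cm_triangle (w z) (w (u n)) l) (lerD (wB z (u n)) (ul n)).
have h2 := nm_triangle (k *c z) (mright m k) (k *c u n); rewrite (nmB (mright m k)) in h2.
have := ler_wpM2l C0 (le_trans h2 (lerD (lexx _) (uP n))).
by rewrite [in X in X -> _]mulrDr; lra.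
Qed.

(** An explicit error in place of the limit over strict neighbourhoods: the later rules for
    [dual_ext] all come from it. *)
Lemma dual_ext_spec w k (C M : R) m : strict_dom w k C -> 0 <= M -> mbound m M ->
  forall z, cm (w z - dual_ext w m) <= C * nm (k *c z - mright m k).
Proof.
move=> wk M0 mM; have [l lP] := ext_value wk M0 mM.
have PF := strict_filter M0 mM.
suff -> : dual_ext w m = l by [].
suff wl : (fun x : A => (w x : R[i]^o)) @ strict_nbhs m --> (l : R[i]^o).
  exact: (@cvg_lim (R[i]^o) (@norm_hausdorff (CF R) (R[i]^o)) _ _ PF _ _ wl).
apply/cvgrPdist_lt => e e0.
have eR : 0 < complex.Re e by move: e0; rewrite ltcE => /andP[].
have [C0 _] := wk; have C1 : 0 < C + 1 by rewrite ltr_wpDl.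
exists [:: k], (complex.Re e / (C + 1))%:C; split; first by rewrite ltcR divr_gt0.
move=> x /(_ k); rewrite mem_head => /(_ isT)[_].
rewrite nmE ltcR => h; rewrite /= cmE (ge0_Re (ltW e0)) ltcR cmB.
rewrite (le_lt_trans (lP x))// (@le_lt_trans _ _ (C * (complex.Re e / (C + 1))))//.
  by rewrite ler_wpM2l ?(ltW h).
by rewrite mulrCA gtr_pMr// ltr_pdivrMr// mul1r ltrDl.
Qed.

Lemma dual_ext_uniq w k (C M : R) m l : strict_dom w k C -> 0 <= M -> mbound m M ->
  (forall e, 0 < e -> exists2 z, nm (k *c z - mright m k) <= e & cm (w z - l) <= e) ->
  dual_ext w m = l.
Proof.
move=> wk M0 mM ap; apply/eqP; rewrite -subr_eq0; apply/eqP/cm_le0.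
have [C0 _] := wk; apply: (@le_eps _ _ _ (C + 1)) => e /ap[z z1 z2].
rewrite add0r (le_trans (cm_triangle _ (w z) _))// mulrDl mul1r lerD// cmB.
by rewrite (le_trans (dual_ext_spec wk M0 mM z))// ler_wpM2l.
Qed.

Section Rules.
Variables (w s : dual A).
Hypothesis ws : dominated w s.

Lemma dual_ext_near m (M : R) (l : seq A) (e : R) : 0 <= M -> mbound m M -> 0 < e ->
  exists z, [/\ nm z <= M, mnear m l e z & cm (w z - dual_ext w m) <= e].
Proof.
move=> M0 mM e0; have [k [C kC]] := dominated_strict ws; have [C0 _] := kC.
have C1 : 0 < C + 1 by rewrite ltr_wpDl.
have [z [z1 zn]] := mnear_exists Arep (k :: l) M0 mM (divr_gt0 e0 C1).
have eC : e / (C + 1) <= e by rewrite ler_pdivrMr// ler_peMr ?(ltW e0)// lerDr.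
exists z; split=> // [b bl|].
  by have [h1 h2] := zn b ltac:(by rewrite inE bl orbT); split; exact: le_trans eC.
have [_ h] := zn k (mem_head _ _).
rewrite (le_trans (dual_ext_spec kC M0 mM z))// (le_trans (ler_wpM2l C0 h))//.
by rewrite mulrCA ler_piMr ?(ltW e0)// ler_pdivrMr// mul1r lerDl.
Qed.

Lemma dual_ext_membed a : dual_ext w (membed a) = w a.
Proof.
have [k [C kC]] := dominated_strict ws.
apply: (dual_ext_uniq kC (nm_ge0 a) (@mbound_membed _ _ a)) => e e0.
by exists a; rewrite ?subrr ?nm0 ?cm0 ltW.
Qed.

Lemma dual_ext_madd m n (M N : R) : 0 <= M -> mbound m M -> 0 <= N -> mbound n N ->
  dual_ext w (madd m n) = dual_ext w m + dual_ext w n.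
Proof.
move=> M0 mM N0 nN; have [k [C kC]] := dominated_strict ws.
apply: (dual_ext_uniq kC (addr_ge0 M0 N0) (mbound_madd mM nN)) => e e0.
have e2 : 0 < e / 2 by rewrite divr_gt0.
have [z [_ /(_ k (mem_head _ _))[_ z1] z2]] := dual_ext_near [:: k] M0 mM e2.
have [t [_ /(_ k (mem_head _ _))[_ t1] t2]] := dual_ext_near [:: k] N0 nN e2.
exists (z + t) => /=.
  rewrite (_ : _ - _ = (k *c z - mright m k) + (k *c t - mright n k)); last by calg A.
  by rewrite (le_trans (nmD _ _))// (splitr e) lerD.
rewrite dualD (_ : _ - _ = (w z - dual_ext w m) + (w t - dual_ext w n)); last by ring.
by rewrite (le_trans (cmD _ _))// (splitr e) lerD.
Qed.

Lemma dual_ext_mscale (c : R[i]) m (M : R) : 0 <= M -> mbound m M ->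
  dual_ext w (mscale c m) = c * dual_ext w m.
Proof.
move=> M0 mM; have [k [C kC]] := dominated_strict ws.
have cM : 0 <= cm c * M by rewrite mulr_ge0 ?cm_ge0.
apply: (dual_ext_uniq kC cM (mbound_mscale c mM)) => e e0.
have c1 : 0 < cm c + 1 by rewrite ltr_wpDl ?cm_ge0.
have cc : cm c * (e / (cm c + 1)) <= e.
  by rewrite mulrCA ler_piMr ?(ltW e0)// ler_pdivrMr// mul1r lerDl.
have [z [_ /(_ k (mem_head _ _))[_ z1] z2]] := dual_ext_near [:: k] M0 mM (divr_gt0 e0 c1).
exists (c *: z) => /=.
  rewrite cmulZr -scalerBr nmZ (le_trans _ cc)// ler_wpM2l ?cm_ge0//.
by rewrite dualZ -mulrBr cmM (le_trans _ cc)// ler_wpM2l ?cm_ge0.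
Qed.

Lemma dual_ext_le m (M K : R) : 0 <= M -> mbound m M -> 0 <= K -> dle w K ->
  cm (dual_ext w m) <= K * M.
Proof.
move=> M0 mM K0 wK; apply: (@le_eps _ _ _ 1) => e e0; rewrite mul1r.
have [z [z1 _ z2]] := dual_ext_near [::] M0 mM e0.
rewrite -[dual_ext w m](subrK (w z)) addrC (le_trans (cmD _ _))// lerD//.
  by rewrite (le_trans (wK z))// ler_wpM2l.
by rewrite cmB.
Qed.

End Rules.

Lemma ge0_approx (l : R[i]) :
  (forall e, 0 < e -> exists2 t, 0 <= t & cm (t - l) <= e) -> 0 <= l.
Proof.
move=> ap; suff -> : l = (cm l)%:C by rewrite lecR cm_ge0.
apply/eqP; rewrite -subr_eq0; apply/eqP/cm_le0.
apply: (@le_eps _ _ _ 2) => e /ap[t t0 tl]; rewrite add0r mulr_natl mulr2n.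
rewrite (le_trans (cm_triangle _ t _))// lerD//; first by rewrite cmB.
rewrite (ge0_Re t0) -rcB cm_real ler_norml; have tE := ge0_cm t0.
have := cm_triangle t l 0; have := cm_triangle l t 0; rewrite !subr0 [cm (l - t)]cmB tE.
by move=> h1 h2; apply/andP; split; lra.
Qed.

Fact dscale_linear (c : R[i]) w (k : R[i]) a b :
  c * w (k *: a + b) = k * (c * w a) + c * w b.
Proof. by rewrite dual_linear; ring. Qed.

Fact dscale_bounded (c : R[i]) w : exists2 K, 0 <= K & dle (fun a => c * w a) K.
Proof.
have [K K0 wK] := dual_dle w.
exists (cm c * K) => [|a]; first by rewrite mulr_ge0 ?cm_ge0.
by rewrite cmM -mulrA ler_wpM2l ?cm_ge0.
Qed.

Definition dscale (c : R[i]) w : dual A := mkdual (dscale_linear c w) (dscale_bounded c w).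

Lemma dominated_self s : dpositive s -> exists s', dominated s s'.
Proof.
move=> s0; have [K K0 sK] := dual_dle s.
exists (dscale K%:C s); split=> [a|z] /=; first by rewrite mulr_ge0 ?lecR.
rewrite (le_trans (dpos_CS' Arep z s0 K0 sK))// /sn -sqrtrM//.
by rewrite /sq /formR /= ReZ.
Qed.

(** Domination passes to multipliers because the same z approximates m for w and, through z z^*, m
    m^* for s. *)
Lemma dual_ext_mul_adj w s m (M : R) : dominated w s -> 0 <= M -> mbound m M ->
  0 <= dual_ext s (mmul m (madj m)) /\
  cm (dual_ext w m) ^+ 2 <= complex.Re (dual_ext s (mmul m (madj m))).
Proof.
move=> ws M0 mM; have [s0 wsz] := ws.
have [s' ss'] := dominated_self s0.
have [k [C kC]] := dominated_strict ws; have [k' [C' kC']] := dominated_strict ss'.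
have [C0 _] := kC; have [C0' _] := kC'.
have mm := mbound_mmul M0 mM (mbound_madj mM).
have key (e : R) : 0 < e -> exists z,
    cm (w z - dual_ext w m) <= C * e /\
    cm (s (z *c cadj z) - dual_ext s (mmul m (madj m))) <= C' * e.
  move=> e0; have [z [_ zn zz]] := mnear_mmul_adj Arep [:: k; k'] M0 mM e0.
  exists z; split.
    have [_ h] := zn k (mem_head _ _).
    by rewrite (le_trans (dual_ext_spec kC M0 mM z))// ler_wpM2l.
  rewrite (le_trans (dual_ext_spec kC' (mulr_ge0 M0 M0) mm _))// ler_wpM2l//.
  by apply: zz; rewrite !inE eqxx orbT.
set L := dual_ext s _ in key *.
have L0 : 0 <= L.
  apply: ge0_approx => e e0; have C1 : 0 < C' + 1 by rewrite ltr_wpDl.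
  have [z [_ h]] := key _ (divr_gt0 e0 C1).
  exists (s (z *c cadj z)); first by rewrite -{1}(cadjK z).
  by rewrite (le_trans h)// mulrCA ler_piMr ?(ltW e0)// ler_pdivrMr// mul1r lerDl.
split=> //; rewrite -ler_sqrt ?Re_ge0// sqrtr_sqr ger0_norm ?cm_ge0//.
have HD (e : R) : 0 < e ->
   cm (dual_ext w m) <= Num.sqrt (complex.Re L + C' * e) + C * e.
  move=> e0; have [z [h1 h2]] := key e e0.
  rewrite -[dual_ext w m](subrK (w z)) addrC (le_trans (cmD _ _))// lerD//; last by rewrite cmB.
  rewrite (le_trans (wsz z))// /sn ler_wsqrtr// /sq /formR.
  rewrite -lerBlDl -ReB (le_trans (Re_le_cm _))//.
apply/ler_addgt0Pr => e e0.
have sqD (a b : R) : 0 <= a -> 0 <= b -> Num.sqrt (a + b) <= Num.sqrt a + Num.sqrt b :> R.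
  move=> a0 b0; rewrite -ler_sqr ?nnegrE ?addr_ge0 ?sqrtr_ge0// sqr_sqrtr ?addr_ge0//.
  rewrite sqrrD !sqr_sqrtr//.
  have := mulr_ge0 (sqrtr_ge0 a) (sqrtr_ge0 b); lra.
pose d := Num.min ((e / 2) ^+ 2 / (C' + 1)) (e / 2 / (C + 1)).
have e2 : 0 < e / 2 by rewrite divr_gt0.
have C1 : 0 < C + 1 by rewrite ltr_wpDl.
have C1' : 0 < C' + 1 by rewrite ltr_wpDl.
have d0 : 0 < d by rewrite lt_min !divr_gt0 ?exprn_gt0.
have dC' : C' * d <= (e / 2) ^+ 2.
  apply: (@le_trans _ _ ((C' + 1) * d)); first by rewrite ler_wpM2r ?(ltW d0)// lerDl.
  by rewrite mulrC -ler_pdivlMr// ge_min lexx.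
have dC : C * d <= e / 2.
  apply: (@le_trans _ _ ((C + 1) * d)); first by rewrite ler_wpM2r ?(ltW d0)// lerDl.
  by rewrite mulrC -ler_pdivlMr// ge_min lexx orbT.
rewrite (le_trans (HD d d0))// [e]splitr addrA lerD//.
rewrite (le_trans (sqD _ _ (Re_ge0 L0) (mulr_ge0 C0' (ltW d0))))// lerD2l.
by rewrite -[leRHS]ger0_norm ?(ltW e2)// -sqrtr_sqr ler_wsqrtr.
Qed.

Lemma dual_ext_dactl w s a m (M : R) : dominated (dactl a w) s -> 0 <= M -> mbound m M ->
  dual_ext (dactl a w) m = w (mleft m a).
Proof.
move=> ws M0 mM; have [k [C kC]] := dominated_strict ws.
have [K K0 wK] := dual_dle w; have K1 : 0 < K + 1 by rewrite ltr_wpDl.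
apply: (dual_ext_uniq kC M0 mM) => e e0.
have eK : e / (K + 1) <= e by rewrite ler_pdivrMr// ler_peMr ?(ltW e0)// lerDr.
have [z [_ zn]] := mnear_exists Arep [:: k; a] M0 mM (divr_gt0 e0 K1).
exists z; first by have [_ /le_trans->] := zn k (mem_head _ _).
have [za _] := zn a ltac:(by rewrite !inE eqxx orbT).
rewrite /= -dualB (le_trans (wK _))// (le_trans (ler_wpM2l K0 za))//.
by rewrite mulrCA ler_piMr ?(ltW e0)// ler_pdivrMr// mul1r lerDl.
Qed.

Lemma dual_ext_dactr w s a m (M : R) : dominated (dactr w a) s -> 0 <= M -> mbound m M ->
  dual_ext (dactr w a) m = w (mright m a).
Proof.
move=> ws M0 mM; have [k [C kC]] := dominated_strict ws.
have [K K0 wK] := dual_dle w; have K1 : 0 < K + 1 by rewrite ltr_wpDl.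
apply: (dual_ext_uniq kC M0 mM) => e e0.
have eK : e / (K + 1) <= e by rewrite ler_pdivrMr// ler_peMr ?(ltW e0)// lerDr.
have [z [_ zn]] := mnear_exists Arep [:: k; a] M0 mM (divr_gt0 e0 K1).
exists z; first by have [_ /le_trans->] := zn k (mem_head _ _).
have [_ za] := zn a ltac:(by rewrite !inE eqxx orbT).
rewrite /= -dualB (le_trans (wK _))// (le_trans (ler_wpM2l K0 za))//.
by rewrite mulrCA ler_piMr ?(ltW e0)// ler_pdivrMr// mul1r lerDl.
Qed.

Lemma dual_ext_dscale (c : R) s s' m (M : R) : dominated s s' -> 0 <= c ->
  0 <= M -> mbound m M -> dual_ext (dscale c%:C s) m = c%:C * dual_ext s m.
Proof.
move=> ss c0 M0 mM; have [k [C kC]] := dominated_strict ss; have [C0 sC] := kC.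
have kC' : strict_dom (dscale c%:C s) k (c * C).
  split=> [|z]; first exact: mulr_ge0.
  by rewrite /= cmM cm_real ger0_norm// -mulrA ler_wpM2l.
have c1 : 0 < c + 1 by rewrite ltr_wpDl.
apply: (dual_ext_uniq kC' M0 mM) => e e0.
have ec : e / (c + 1) <= e by rewrite ler_pdivrMr// ler_peMr ?(ltW e0)// lerDr.
have [z [_ zn zs]] := dual_ext_near ss [:: k] M0 mM (divr_gt0 e0 c1).
exists z; first by have [_ /le_trans->] := zn k (mem_head _ _).
rewrite /= -mulrBr cmM cm_real ger0_norm// (le_trans (ler_wpM2l c0 zs))//.
by rewrite mulrCA ler_piMr ?(ltW e0)// ler_pdivrMr// mul1r lerDl.
Qed.

(** The functional s(. y^* ) is dominated by s(y y^* ) s; its extension is evaluated at m^*. *)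
Lemma dual_ext_CS s m (M : R) y : dpositive s -> 0 <= M -> mbound m M ->
  cm (s (mright m y)) ^+ 2 <= sq (formR s) y * complex.Re (dual_ext s (mmul (madj m) m)).
Proof.
move=> s0 M0 mM; have F := formR_psd s0; have y0 := sq_ge0 F y.
have yd : dominated (dactl (cadj y) s) (dscale (sq (formR s) y)%:C s).
  split=> [a|z] /=; first by rewrite mulr_ge0 ?lecR.
  rewrite (le_trans (sn_CS F _ _))// mulrC /sn -sqrtrM//.
  by rewrite ler_wsqrtr// {3}/sq /formR /= ReZ.
have ma := mbound_madj mM.
have [_] := dual_ext_mul_adj yd M0 ma.
rewrite madjK (dual_ext_dactl yd M0 ma) /= cadjK (dpos_herm Arep _ s0) cmJ => /le_trans; apply.
have [s' ss'] := dominated_self s0.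
by rewrite (dual_ext_dscale ss' y0 (mulr_ge0 M0 M0) (mbound_mmul M0 ma mM)) ReZ.
Qed.

End DualExt.

Lemma le_eps1 (R : realType) (x y C : R) : 0 <= C ->
  (forall e, 0 < e -> e <= 1 -> x <= y + C * e) -> x <= y.
Proof.
move=> C0 xy; apply: (@le_eps _ _ _ C) => e e0.
have m0 : 0 < Num.min e 1 by rewrite lt_min e0 ltr01.
rewrite (le_trans (xy _ m0 _))//; first by rewrite ge_min lexx orbT.
by rewrite lerD2l ler_wpM2l// ge_min lexx.
Qed.

Lemma closed_span_approx (R : realType) (V : normedModType (CF R)) (S : set V) (x : V) (e : R) :
  closed_span S = setT -> 0 < e ->
  exists n (k : 'I_n -> R[i]) (y : 'I_n -> V),
    (forall i, S (y i)) /\ nm (x - \sum_(i < n) k i *: y i) <= e.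
Proof.
move=> ST e0; have : closed_span S x by rewrite ST.
move=> /(_ (ball x e%:C)) [|_ [[n [k [y [Sy ->]]]] xb]].
  by apply: nbhsx_ballx; rewrite ltcR.
exists n, k, y; split=> //; move: xb.
by rewrite -ball_normE /= nmE ltcR => /ltW.
Qed.

Section DualOps.
Variables (R : realType) (A : cstarAlgebra R).
Implicit Types (f g w s : dual A) (a c z : A).

Fact dsub_linear f g (k : R[i]) a b :
  f (k *: a + b) - g (k *: a + b) = k * (f a - g a) + (f b - g b).
Proof. by rewrite !dual_linear; ring. Qed.

Fact dsub_bounded f g : exists2 K, 0 <= K & dle (fun a => f a - g a) K.
Proof.
have [K K0 fK] := dual_dle f; have [L L0 gL] := dual_dle g.
exists (K + L) => [|a]; first exact: addr_ge0.
by rewrite (le_trans (cmD _ _))// cmN mulrDl lerD.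
Qed.

Definition dsub f g : dual A := mkdual (dsub_linear f g) (dsub_bounded f g).

Lemma dominated_dactr f s c : dominated f s ->
  dominated (dactr f c) (dactl (cadj c) (dactr s c)).
Proof.
move=> [s0 fs]; split=> [a|z] /=.
  rewrite (_ : c *c _ = cadj (a *c cadj c) *c (a *c cadj c))//.
  by rewrite cadjM cadjK !cmulA.
rewrite (le_trans (fs _))// /sn /sq /formR /= cadjM !cmulA//.
Qed.

Lemma dominated_dactl f s c : dominated f s ->
  dominated (dactl c f) (dscale (nm c ^+ 2)%:C s).
Proof.
move=> [s0 fs]; split=> [a|z] /=; first by rewrite mulr_ge0 ?lecR ?sqr_ge0.
rewrite (le_trans (fs _))// /sn ler_wsqrtr// !formR_adj cadjM.
rewrite (le_trans (act_contr (formL_action s0) _ _))// nm_cadj.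
by rewrite {2}/sq /formL /= ReZ /sq cadjK.
Qed.

Lemma dadj_dactr f c : dadj (dactr f c) = dactl (cadj c) (dadj f).
Proof. by apply: dual_ext_eq => a /=; rewrite cadjM cadjK. Qed.

Lemma dadj_dactl f c : dadj (dactl c f) = dactr (dadj f) (cadj c).
Proof. by apply: dual_ext_eq => a /=; rewrite cadjM cadjK. Qed.

Lemma dadjK f : dadj (dadj f) = f.
Proof. by apply: dual_ext_eq => a /=; rewrite cadjK conjCK. Qed.

(** [dominated] is one-sided and says nothing about the adjoint functional; both bounds are kept so
    that convolution commutes with [dadj]. *)
Definition bidominated f := (exists s, dominated f s) /\ (exists s, dominated (dadj f) s).

Lemma bidominated_dadj f : bidominated f -> bidominated (dadj f).
Proof. by move=> [h1 h2]; split; rewrite ?dadjK. Qed.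

Lemma bidominated_dactr f c : bidominated f -> bidominated (dactr f c).
Proof.
move=> [[s fs] [s' fs']]; split; first by eexists; exact: dominated_dactr fs.
by eexists; rewrite dadj_dactr; exact: dominated_dactl fs'.
Qed.

Lemma bidominated_dactl f c : bidominated f -> bidominated (dactl c f).
Proof.
move=> [[s fs] [s' fs']]; split; first by eexists; exact: dominated_dactl fs.
by eexists; rewrite dadj_dactl; exact: dominated_dactr fs'.
Qed.

Hypothesis Arep : representable A.

Lemma dadj_pos s : dpositive s -> dadj s = s.
Proof. by move=> s0; apply: dual_ext_eq => a /=; rewrite dpos_herm// conjCK. Qed.

Lemma bidominated_pos s : dpositive s -> bidominated s.
Proof. by move=> s0; split; rewrite ?dadj_pos//; exact: dominated_self. Qed.

Lemma dominated_approx f s (e : R) : dominated f s -> 0 < e ->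
  exists v, sn (formR s) v <= 1 + e /\
    forall x, cm (f x - s (x *c cadj v)) <= e * sn (formR s) x.
Proof.
move=> [s0 fs] e0; apply: (riesz_approx (formR_psd s0)) => //.
  by move=> k x y; rewrite dual_linear.
by move=> x; rewrite mul1r.
Qed.

End DualOps.

(** * Tensor products *)

Section Spatial.
Variables (R : realType) (A B T : cstarAlgebra R) (t : A -> B -> T).
Hypothesis tP : spatial_tensor t.
Implicit Types (a : A) (b : B) (z : T) (s : seq (A * B)).

Lemma spatial_repl : representable A.
Proof. by have [_ _ _ _ [H [K [HK [h [p1 [p2 [p [? ? ? ? ?]]]]]]]]] := tP; exists H, p1. Qed.

Lemma spatial_repr : representable B.
Proof. by have [_ _ _ _ [H [K [HK [h [p1 [p2 [p [? ? ? ? ?]]]]]]]]] := tP; exists K, p2. Qed.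

Lemma spatial_rep : representable T.
Proof. by have [_ _ _ _ [H [K [HK [h [p1 [p2 [p [? ? ? ? ?]]]]]]]]] := tP; exists HK, p. Qed.

Lemma tensM a b a' b' : t a b *c t a' b' = t (a *c a') (b *c b').
Proof. by have [_ h _ _ _] := tP. Qed.

Lemma tens_adj a b : cadj (t a b) = t (cadj a) (cadj b).
Proof. by have [_ _ h _ _] := tP. Qed.

Lemma tens_linl (k : R[i]) a a' b : t (k *: a + a') b = k *: t a b + t a' b.
Proof. by have [[h _] _ _ _ _] := tP. Qed.

Lemma tensDl a a' b : t (a + a') b = t a b + t a' b.
Proof. by have := tens_linl 1 a a' b; rewrite !scale1r. Qed.

Lemma tens0l b : t 0 b = 0.
Proof. by apply: (addrI (t 0 b)); rewrite -tensDl !addr0. Qed.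

Lemma tensZl (k : R[i]) a b : t (k *: a) b = k *: t a b.
Proof. by have := tens_linl k a 0 b; rewrite tens0l !addr0. Qed.

Lemma tensBl a a' b : t (a - a') b = t a b - t a' b.
Proof. by rewrite tensDl -scaleN1r tensZl scaleN1r. Qed.

Definition tsum s : T := \sum_(p <- s) t p.1 p.2.

Lemma tsum_approx z (e : R) : 0 < e -> exists s, nm (z - tsum s) <= e.
Proof.
have [_ _ _ dense _] := tP => e0.
have [n [k [y [yS zy]]]] := closed_span_approx z dense e0.
have yP i : exists p : A * B, y i = t p.1 p.2.
  by have [a _ [b _ ab]] := yS i; exists (a, b).
pose p i := xget (0, 0) [set p : A * B | y i = t p.1 p.2].
have pE i : y i = t (p i).1 (p i).2.
  by rewrite /p; case: xgetP => [q _ //|none]; have [q /none] := yP i.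
exists [seq (k i *: (p i).1, (p i).2) | i <- enum 'I_n].
rewrite /tsum big_map big_enum /=; congr (nm (z - _) <= e): zy.
by apply: eq_bigr => i _; rewrite tensZl pE.
Qed.

Lemma tsum_cat s s' : tsum (s ++ s') = tsum s + tsum s'.
Proof. exact: big_cat. Qed.

Lemma dual_tens_eq (w1 w2 : dual T) :
  (forall a b, w1 (t a b) = w2 (t a b)) -> w1 = w2.
Proof.
move=> e; apply: dual_ext_eq => z; apply/eqP; rewrite -subr_eq0; apply/eqP/cm_le0.
have [K K0 wK] := dual_dle (dsub w1 w2).
apply: (@le_eps _ _ _ K) => d d0; rewrite add0r.
have [s zs] := tsum_approx z d0.
have s0 : dsub w1 w2 (tsum s) = 0.
  by rewrite /tsum (dual_sum (dsub w1 w2)) big1// => p _ /=; rewrite e subrr.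
have -> : w1 z - w2 z = dsub w1 w2 (z - tsum s) by rewrite dualB s0 subr0.
by rewrite (le_trans (wK _))// ler_wpM2l.
Qed.

Section Slice.
Variables (w : dual B) (K : R).
Hypothesis (K0 : 0 <= K) (wK : dle w K).

Let sl s : A := \sum_(p <- s) w p.2 *: p.1.

(** Two rounds of matrix coefficients: those of the slice are values of w on an element of B, whose
    own coefficients are those of the tensor at x (x) k and y (x) k'. *)
Let sl_bound s : nm (sl s) <= K * nm (tsum s).
Proof.
have [_ _ _ _ [H1 [H2 [HK [h [p1 [p2 [p [[hb hip _] f1 f2 fp ph]]]]]]]]] := tP.
have a1 := rep_action f1.1; have a2 := rep_action f2.1; have ap := rep_action fp.1.
have P := ip_psd.
have hn x y : nm (h x y) = nm x * nm y.
  rewrite -[nm (h x y)]sn_ip /sn /sq hip !ip_norm !nmE -!rcX -rcM /=.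
  by rewrite -exprMn sqrtr_sqr ger0_norm// mulr_ge0 ?nm_ge0.
apply: (faithful_norm_ip f1) => [|x y]; first by rewrite mulr_ge0 ?nm_ge0.
have -> : ip (p1 (sl s) x) y = w (\sum_(q <- s) ip (p1 q.1 x) y *: q.2).
  rewrite /sl (act_sum a1) (psd_suml (P _ _)) dual_sum; apply: eq_bigr => q _.
  by rewrite (actZ a1) (psdZl (P _ _)) dualZ mulrC.
rewrite (le_trans (wK _))// -!mulrA ler_wpM2l// !mulrA.
apply: (faithful_norm_ip f2) => [|k k']; first by rewrite !mulr_ge0 ?nm_ge0.
have -> : ip (p2 (\sum_(q <- s) ip (p1 q.1 x) y *: q.2) k) k' =
    ip (p (tsum s) (h x k)) (h y k').
  rewrite /tsum (act_sum a2) (act_sum ap) !(psd_suml (P _ _)).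
  by apply: eq_bigr => q _; rewrite (actZ a2) (psdZl (P _ _)) ph hip.
rewrite (le_trans (ip_CS _ _))// (le_trans (ler_wpM2r (nm_ge0 _) (rep_contr fp.1 _ _)))//.
by rewrite !hn le_eqVlt; apply/orP; left; apply/eqP; ring.
Qed.

Let sl_diff s s' : nm (sl s - sl s') <= K * nm (tsum s - tsum s').
Proof.
pose s'' := [seq (- p.1, p.2) | p <- s'].
have -> : sl s - sl s' = sl (s ++ s'').
  rewrite /sl big_cat big_map /= -sumrN; congr (_ + _).
  by apply: eq_bigr => p _; rewrite scalerN.
have -> : tsum s - tsum s' = tsum (s ++ s'').
  rewrite tsum_cat /tsum big_map /= -sumrN; congr (_ + _).
  by apply: eq_bigr => p _; rewrite -scaleN1r -tensZl scaleN1r.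
exact: sl_bound.
Qed.

(** Extension by density. As [sl] lives on lists of pairs, [sl_diff] gives both its independence of
    the list and its continuity. *)
Lemma slice_exists : exists S : T -> A,
  [/\ forall (k : R[i]) x y, S (k *: x + y) = k *: S x + S y,
      forall z, nm (S z) <= K * nm z & forall a b, S (t a b) = w b *: a].
Proof.
have lim z : exists l, forall s, nm (l - sl s) <= K * nm (z - tsum s).
  have h2 n : 0 < 2^-1 ^+ n :> R by rewrite exprn_gt0// invr_gt0.
  pose u n := xget [::] [set s | nm (z - tsum s) <= 2^-1 ^+ n].
  have uP n : nm (z - tsum (u n)) <= 2^-1 ^+ n.
    rewrite /u; case: xgetP => [s _ //|none].
    by have [s /none] := tsum_approx z (h2 n).
  have uC m n : (m <= n)%N -> nm (sl (u n) - sl (u m)) <= 2 * K * 2^-1 ^+ m.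
    move=> mn; rewrite (le_trans (sl_diff _ _))// [2 * K]mulrC -mulrA ler_wpM2l//.
    rewrite (le_trans (nm_triangle _ z _))// mulr_natl mulr2n lerD// nmB.
    by rewrite (le_trans (uP n))// ler_wiXn2l// ?invr_ge0// invf_le1// ler1n.
  have r0 : tends0 (fun n => 2 * K * 2^-1 ^+ n).
    by apply: (tends0_le (C := 2 * K) (@tends0_geo R)) => //; rewrite mulr_ge0.
  have [l ul] := cvg_rate uC r0.
  exists l => s; apply: (@le_tends0 _ (fun n => 2 * K * 2^-1 ^+ n + K * 2^-1 ^+ n)).
    by apply: tends0D => //; apply: (tends0_le (C := K) (@tends0_geo R)).
  move=> n; have h1 := nm_triangle l (sl (u n)) (sl s); rewrite (nmB l (sl (u n))) in h1.
  have h3 := nm_triangle (tsum (u n)) z (tsum s); rewrite (nmB (tsum _) z) in h3.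
  have := ler_wpM2l K0 (le_trans h3 (lerD (uP n) (lexx _))).
  have := sl_diff (u n) s; have := ul n; rewrite [in X in _ -> _ -> X -> _]mulrDr; lra.
pose S z := xget 0 [set l | forall s, nm (l - sl s) <= K * nm (z - tsum s)].
have SP z s : nm (S z - sl s) <= K * nm (z - tsum s).
  rewrite /S; case: xgetP => [l _ //|none]; by have [l /none] := lim z.
have Suniq z l (C : R) : (forall e : R, 0 < e -> exists s,
    nm (z - tsum s) <= e /\ nm (l - sl s) <= C * e) -> S z = l.
  move=> zl; apply/eqP; rewrite -subr_eq0; apply/eqP/nm_le0.
  apply: (@le_eps _ _ _ (K + C)) => e /zl[s [s1 s2]]; rewrite add0r mulrDl.
  rewrite (le_trans (nm_triangle _ (sl s) _))// lerD//; last by rewrite nmB.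
  by rewrite (le_trans (SP z s))// ler_wpM2l.
exists S; split=> [k x y|z|a b].
- apply: (Suniq _ _ K) => e e0; have k1 : 0 < cm k + 1 by rewrite ltr_wpDl ?cm_ge0.
  have [s sx] := tsum_approx x (divr_gt0 e0 k1).
  have [s' sy] := tsum_approx y (divr_gt0 e0 k1).
  have eE : cm k * (e / (cm k + 1)) + e / (cm k + 1) = e by field; rewrite gt_eqF.
  exists ([seq (k *: p.1, p.2) | p <- s] ++ s'); split.
    have -> : tsum ([seq (k *: p.1, p.2) | p <- s] ++ s') = k *: tsum s + tsum s'.
      rewrite tsum_cat /tsum big_map /= scaler_sumr; congr (_ + _).
      by apply: eq_bigr => p _; rewrite tensZl.
    rewrite (_ : _ - _ = k *: (x - tsum s) + (y - tsum s')); last by calg T.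
    by rewrite -[leRHS]eE (le_trans (nmD _ _))// lerD// nmZ ler_wpM2l ?cm_ge0.
  have -> : sl ([seq (k *: p.1, p.2) | p <- s] ++ s') = k *: sl s + sl s'.
    rewrite /sl big_cat big_map /= scaler_sumr; congr (_ + _).
    by apply: eq_bigr => p _; rewrite !scalerA mulrC.
  rewrite (_ : _ - _ = k *: (S x - sl s) + (S y - sl s')); last by calg A.
  rewrite -[in leRHS]eE mulrDr (le_trans (nmD _ _))// lerD//.
    rewrite nmZ mulrCA ler_wpM2l ?cm_ge0// (le_trans (SP x s))// ler_wpM2l//.
  by rewrite (le_trans (SP y s'))// ler_wpM2l.
- by have := SP z [::]; rewrite /sl /tsum !big_nil !subr0.
- apply: (Suniq _ _ 0) => e e0; exists [:: (a, b)].
  by rewrite /tsum /sl !big_seq1 /= !subrr !nm0 mul0r ltW.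
Qed.

End Slice.
End Spatial.

Section TensorFunctionals.
Variables (R : realType) (A B T : cstarAlgebra R) (t : A -> B -> T).
Hypothesis tP : spatial_tensor t.
Implicit Types (a c : A) (b d : B) (z : T) (f s : dual A) (g r : dual B).

Local Notation "f (x) g" := (dual_tensor t f g) (at level 40).

(** Composing f with the slice by g shows that the set from which [xget] picks [dual_tensor] is
    inhabited, and gives a formula for the choice. *)
Lemma dual_tensor_slice g (K : R) : 0 <= K -> dle g K -> exists S : T -> A,
  [/\ forall (k : R[i]) x y, S (k *: x + y) = k *: S x + S y,
      forall z, nm (S z) <= K * nm z,
      forall a b, S (t a b) = g b *: a &
      forall f z, (f (x) g) z = f (S z)].
Proof.
move=> K0 gK; have [S [Sl Sb St]] := slice_exists tP K0 gK.
exists S; split=> // f z.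
have fl (k : R[i]) x y : f (S (k *: x + y)) = k * f (S x) + f (S y).
  by rewrite Sl dual_linear.
have fb : exists2 L, 0 <= L & dle (fun z => f (S z)) L.
  have [L L0 fL] := dual_dle f; exists (L * K) => [|x]; first exact: mulr_ge0.
  by rewrite (le_trans (fL _))// -mulrA ler_wpM2l.
have fS a b : mkdual fl fb (t a b) = f a * g b by rewrite /= St dualZ mulrC.
suff -> : f (x) g = mkdual fl fb by [].
apply: (dual_tens_eq tP) => a b; rewrite fS /dual_tensor.
by case: xgetP => [w _ ->//|none]; case: (none (mkdual fl fb)).
Qed.

Lemma dual_tensorE f g a b : (f (x) g) (t a b) = f a * g b.
Proof.
have [K K0 gK] := dual_dle g; have [S [_ _ St ->]] := dual_tensor_slice K0 gK.
by rewrite St dualZ mulrC.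
Qed.

Lemma dual_tensor_uniq f g (w : dual T) :
  (forall a b, w (t a b) = f a * g b) -> w = f (x) g.
Proof. by move=> e; apply: (dual_tens_eq tP) => a b; rewrite e dual_tensorE. Qed.

Lemma dle_dual_tensor f g (K L : R) : 0 <= K -> dle f K -> 0 <= L -> dle g L ->
  dle (f (x) g) (K * L).
Proof.
move=> K0 fK L0 gL z; have [S [_ Sb _ ->]] := dual_tensor_slice L0 gL.
by rewrite (le_trans (fK _))// -mulrA ler_wpM2l.
Qed.

Lemma dual_tensor_dactr f g c d : dactr f c (x) dactr g d = dactr (f (x) g) (t c d).
Proof.
by apply/esym/dual_tensor_uniq => a b /=; rewrite (tensM tP) dual_tensorE.
Qed.

Lemma dual_tensor_dactl f g c d : dactl c f (x) dactl d g = dactl (t c d) (f (x) g).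
Proof.
by apply/esym/dual_tensor_uniq => a b /=; rewrite (tensM tP) dual_tensorE.
Qed.

Lemma dual_tensor_dadj f g : dadj f (x) dadj g = dadj (f (x) g).
Proof.
by apply/esym/dual_tensor_uniq => a b /=; rewrite (tens_adj tP) dual_tensorE rmorphM.
Qed.

Lemma dual_tensor_subl f f' g z : (dsub f f' (x) g) z = (f (x) g) z - (f' (x) g) z.
Proof.
suff -> : dsub f f' (x) g = dsub (f (x) g) (f' (x) g) by [].
by apply/esym/dual_tensor_uniq => a b /=; rewrite !dual_tensorE; ring.
Qed.

Lemma dual_tensor_subr f g g' z : (f (x) dsub g g') z = (f (x) g) z - (f (x) g') z.
Proof.
suff -> : f (x) dsub g g' = dsub (f (x) g) (f (x) g') by [].
by apply/esym/dual_tensor_uniq => a b /=; rewrite !dual_tensorE; ring.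
Qed.

(** On finite sums of simple tensors this is the Schur product of the forms of s and r; density does
    the rest. *)
Lemma dual_tensor_pos s r : dpositive s -> dpositive r -> dpositive (s (x) r).
Proof.
move=> s0 r0 z; have [K K0 sK] := dual_dle (s (x) r).
have sum0 l : 0 <= (s (x) r) (cadj (tsum t l) *c tsum t l).
  have -> : (s (x) r) (cadj (tsum t l) *c tsum t l) =
      \sum_(p <- l) \sum_(q <- l) formL s p.1 q.1 * formL r p.2 q.2.
    rewrite /tsum cadj_sum cmul_suml dual_sum exchange_big /=; apply: eq_bigr => q _.
    rewrite cmul_sumr dual_sum; apply: eq_bigr => p _.
    by rewrite (tens_adj tP) (tensM tP) dual_tensorE.
  by apply: schur_psd; exact: formL_psd.
apply: ge0_approx => e e0; pose C := K * (2 * nm z + 1) + 1.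
have C0 : 0 < C by rewrite ltr_wpDl// mulr_ge0// addr_ge0// mulr_ge0 ?nm_ge0.
pose d := Num.min 1 (e / C); have d0 : 0 < d by rewrite lt_min ltr01 divr_gt0.
have [l zl] := tsum_approx tP z d0; set y := tsum t l in zl *.
exists ((s (x) r) (cadj y *c y)); first exact: (sum0 l).
rewrite -(dualB (s (x) r)) (le_trans (sK _))//.
have -> : cadj y *c y - cadj z *c z = - (cadj (z - y) *c y + cadj z *c (z - y)).
  by calg T.
have y1 : nm y <= nm z + 1.
  rewrite -[y](subrK z) (le_trans (nmD _ _))// addrC lerD2l nmB (le_trans zl)//.
  by rewrite ge_min lexx.
have : nm (- (cadj (z - y) *c y + cadj z *c (z - y))) <= d * (2 * nm z + 1).
  rewrite nmN (le_trans (nmD _ _))// (_ : d * _ = d * (nm z + 1) + nm z * d); last by ring.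
  rewrite lerD// (le_trans (nm_cmul _ _))// nm_cadj ler_pM ?nm_ge0//.
move=> /(ler_wpM2l K0) /le_trans; apply.
apply: (@le_trans _ _ (C * d)).
  have -> : C * d = K * (d * (2 * nm z + 1)) + d by rewrite /C; ring.
  by rewrite lerDl ltW.
by rewrite mulrC -ler_pdivlMr// ge_min lexx orbT.
Qed.

(** Replacing f by s(. v^* ) and g by r(. w^* ), with v and w of seminorm at most 1 + e, reduces the
    bound to Cauchy-Schwarz for the form of s (x) r. *)
Lemma dual_tensor_dominated f g s r : dominated f s -> dominated g r ->
  dominated (f (x) g) (s (x) r).
Proof.
move=> fs gr; have [s0 fsz] := fs; have [r0 grz] := gr.
have S0 := dual_tensor_pos s0 r0; split=> // z.
have [K K0 sK] := dual_dle s; have [L L0 rL] := dual_dle r.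
have F := formR_psd s0; have G := formR_psd r0; have P := formR_psd S0.
have snK a : sn (formR s) a <= Num.sqrt K * nm a.
  rewrite -[nm a]ger0_norm ?nm_ge0// -sqrtr_sqr -sqrtrM// /sn ler_wsqrtr//.
  by rewrite formR_adj -nm_cadj (formL_bound _ s0 K0 sK).
have snL b : sn (formR r) b <= Num.sqrt L * nm b.
  rewrite -[nm b]ger0_norm ?nm_ge0// -sqrtr_sqr -sqrtrM// /sn ler_wsqrtr//.
  by rewrite formR_adj -nm_cadj (formL_bound _ r0 L0 rL).
have k0 : 0 <= Num.sqrt K by exact: sqrtr_ge0.
have l0 : 0 <= Num.sqrt L by exact: sqrtr_ge0.
pose D := 3 * sn (formR (s (x) r)) z + 3 * (Num.sqrt K * Num.sqrt L * nm z).
apply: (@le_eps1 _ _ _ D).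
  by rewrite addr_ge0// mulr_ge0 ?sn_ge0// !mulr_ge0 ?nm_ge0.
move=> e e0 e1; have e0' := ltW e0.
have [v [v1 fv]] := dominated_approx fs e0; have [w [w1 gw]] := dominated_approx gr e0.
have b1 : dle (dsub f (dactl (cadj v) s)) (e * Num.sqrt K).
  by move=> a; rewrite (le_trans (fv a))// -mulrA ler_wpM2l.
have b2 : dle (dsub g (dactl (cadj w) r)) (e * Num.sqrt L).
  by move=> a; rewrite (le_trans (gw a))// -mulrA ler_wpM2l.
have b3 : dle g (Num.sqrt L) by move=> b; exact: le_trans (grz b) (snL b).
have b4 : dle (dactl (cadj v) s) (2 * Num.sqrt K).
  move=> a; rewrite (le_trans (sn_CS F _ _))// mulrC -mulrA ler_pM ?sn_ge0//.
  by rewrite (le_trans v1)//; lra.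
have := dle_dual_tensor (mulr_ge0 e0' k0) b1 l0 b3 z.
have := dle_dual_tensor (mulr_ge0 (ler0n _ 2) k0) b4 (mulr_ge0 e0' l0) b2 z.
rewrite dual_tensor_subl dual_tensor_subr dual_tensor_dactl.
set z1 := (f (x) g) z; set z2 := (_ (x) g) z; set z3 := dactl _ _ z => h1 h2.
have h3 : cm z3 <= (1 + e) ^+ 2 * sn (formR (s (x) r)) z.
  rewrite /z3 /= -(tens_adj tP) (le_trans (sn_CS P _ _))// mulrC ler_wpM2r ?sn_ge0//.
  rewrite (sn_le P) ?sqr_ge0// /sq /formR (tens_adj tP) (tensM tP) dual_tensorE.
  rewrite -/(formR s v v) -/(formR r w w) (sqE F) (sqE G) -rcM /= -(sn_sqr F) -(sn_sqr G).
  have e2 : 0 <= 1 + e by rewrite addr_ge0.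
  rewrite -exprMn ler_sqr ?nnegrE ?mulr_ge0 ?sn_ge0 ?sqr_ge0// expr2.
  by rewrite ler_pM ?sn_ge0.
have h4 := le_trans (cm_triangle z1 z2 0) (lerD h2 (cm_triangle z2 z3 0)).
rewrite !subr0 in h4.
have h5 : (1 + e) ^+ 2 * sn (formR (s (x) r)) z <= (1 + 3 * e) * sn (formR (s (x) r)) z.
  rewrite ler_wpM2r ?sn_ge0//; have : e ^+ 2 <= e by rewrite expr2 ger_pMl.
  by rewrite sqrrD expr1n mul1r; lra.
rewrite (le_trans h4)// (le_trans (lerD (lexx _) (lerD h1 (le_trans h3 h5))))//.
rewrite /D le_eqVlt; apply/orP; left; apply/eqP; ring.
Qed.

Lemma dual_tensor_bidominated f g : bidominated f -> bidominated g ->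
  bidominated (f (x) g).
Proof.
move=> [[s fs] [s' fs']] [[r gr] [r' gr']]; split.
  by exists (s (x) r); exact: dual_tensor_dominated.
by exists (s' (x) r'); rewrite -dual_tensor_dadj; exact: dual_tensor_dominated.
Qed.

End TensorFunctionals.

Section MultiplierHom.
Variables (R : realType) (A B : cstarAlgebra R) (f : A -> multiplier B).
Hypotheses (Brep : representable B) (fH : mstar_hom f).

(** For fixed y, left multiplication by f(a) is a star-action on B for the form <pi(x) y, pi(x') y>,
    so contractivity is automatic. *)
Lemma mstar_hom_bound a : mbound (f a) (nm a).
Proof.
have [H [pi Hpi]] := Brep; have [fl fM fadj] := fH; have P := @ip_psd R H.
have ac := rep_action Hpi.1.
move=> z; apply: (faithful_norm Hpi) => [|y]; first by rewrite mulr_ge0 ?nm_ge0.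
have adjE m (x x' : B) : cadj (mleft m x) *c x' = cadj x *c mleft (madj m) x'.
  by rewrite mcentral /= cadjK.
have S : star_action (fun x x' : B => ip (pi x y) (pi x' y)) (fun a x => mleft (f a) x).
  split=> [|k b c x|b c x|b x x'].
  - split=> [k u v w|u v|u].
    + by rewrite (act_linear ac) (psd_linear P).
    + exact: psd_conj.
    + exact: psd_ge0.
  - by rewrite fl.
  - by rewrite fM.
  - by rewrite !(act_adj ac) -!(actM ac) adjE fadj.
have := act_sn S a z.
rewrite -[sn _ (mleft _ _)]/(sn (@ip R H) (pi (mleft (f a) z) y)).
rewrite -[sn _ z]/(sn (@ip R H) (pi z y)) !sn_ip => /le_trans; apply.
by rewrite -mulrA ler_wpM2l ?nm_ge0// (rep_contr Hpi.1).
Qed.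

End MultiplierHom.

Section TensorNorm.
Variables (R : realType) (A B T : cstarAlgebra R) (t : A -> B -> T).
Hypothesis tP : spatial_tensor t.

(** The difference of the squared norms is a Schur product of the positive form |c|^2 <x, y> - <cx,
    cy> with the inner product of K. *)
Let tensor_op_bound (H K HK : hilbertSpace R) (h : H -> K -> HK) (C : cstarAlgebra R)
    (p : C -> H -> H) (c : C) (l : seq (H * K)) :
  (forall x1 y1 x2 y2, ip (h x1 y1) (h x2 y2) = ip x1 x2 * ip y1 y2) -> is_rep p ->
  nm (\sum_(q <- l) h (p c q.1) q.2) <= nm c * nm (\sum_(q <- l) h q.1 q.2).
Proof.
move=> hip rp; have P := @ip_psd R; have ac := rep_action rp.
rewrite -ler_sqr ?nnegrE ?mulr_ge0 ?nm_ge0// exprMn -!sq_ip /sq.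
have expand (F : H -> H) : ip (\sum_(q <- l) h (F q.1) q.2) (\sum_(q <- l) h (F q.1) q.2)
    = \sum_(q <- l) \sum_(r <- l) ip (F q.1) (F r.1) * ip q.2 r.2.
  rewrite (psd_suml (P _)); apply: eq_bigr => q _; rewrite (psd_sumr (P _)).
  by apply: eq_bigr => r _; rewrite hip.
rewrite (expand (p c)) (expand id) -ReZ -subr_ge0 -ReB; apply: Re_ge0.
rewrite mulr_sumr -sumrB.
pose B1 x y : R[i] := (nm c ^+ 2)%:C * ip x y - ip (p c x) (p c y).
have B1p : psd B1.
  split=> [k x y z|x y|x]; rewrite /B1.
  - by rewrite (rep_linear rp) !(psd_linear (P _)); ring.
  - by rewrite conjB conjM conjR -!(psd_conj (P _)).
  - rewrite !(sqE (P _)) -rcM -rcB ler0c subr_ge0.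
    exact: (act_contr ac).
have := schur_psd l B1p (P K); congr (0 <= _).
apply: eq_bigr => q _; rewrite mulr_sumr -sumrB; apply: eq_bigr => r _.
by rewrite /B1 /=; ring.
Qed.

Lemma hilbert_tensor_approx (H K HK : hilbertSpace R) (h : H -> K -> HK) (z : HK) (e : R) :
  hilbert_tensor h -> 0 < e -> exists l : seq (H * K), nm (z - \sum_(r <- l) h r.1 r.2) <= e.
Proof.
move=> [[hl _] _ dense] e0.
have [n [k [y [yS zy]]]] := closed_span_approx z dense e0.
have yP i : exists q : H * K, y i = h q.1 q.2.
  by have [u _ [v _ uv]] := yS i; exists (u, v).
pose q i := xget (0, 0) [set q : H * K | y i = h q.1 q.2].
have qE i : y i = h (q i).1 (q i).2.
  by rewrite /q; case: xgetP => [r _ //|none]; have [r /none] := yP i.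
have hZ c u v : h (c *: u) v = c *: h u v.
  have h0 : h 0 v = 0.
    by have := hl 1 0 0 v; rewrite scale1r addr0 scale1r => /esym/(canRL (addrK _)); rewrite subrr.
  by have := hl c u 0 v; rewrite h0 !addr0.
exists [seq (k i *: (q i).1, (q i).2) | i <- enum 'I_n].
rewrite big_map big_enum /=; congr (nm (z - _) <= e): zy.
by apply: eq_bigr => i _; rewrite qE hZ.
Qed.

Lemma rep_sum (C : cstarAlgebra R) (H K HK : hilbertSpace R) (h : H -> K -> HK)
    (p : C -> HK -> HK) (c : C) (l : seq (H * K)) : is_rep p ->
  p c (\sum_(r <- l) h r.1 r.2) = \sum_(r <- l) p c (h r.1 r.2).
Proof.
move=> rp; elim: l => [|r l IH].
  by rewrite !big_nil -{1}(subrr (0 : HK)) (repBr rp) subrr.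
by rewrite !big_cons -IH -[h r.1 r.2]scale1r (rep_linear rp) !scale1r.
Qed.

(* A comparison of operators need only be tested on finite sums of simple tensors. *)
Lemma faithful_norm_dense (H K HK : hilbertSpace R) (h : H -> K -> HK)
    (p : T -> HK -> HK) (x y : T) (M : R) : hilbert_tensor h -> faithful_rep p -> 0 <= M ->
  (forall l : seq (H * K), let w := \sum_(r <- l) h r.1 r.2 in
     nm (p x w) <= M * nm (p y w)) -> nm x <= M * nm y.
Proof.
move=> hT fp M0 xy; apply: (faithful_norm fp) => [|z]; first by rewrite mulr_ge0 ?nm_ge0.
apply: (@le_eps _ _ _ (nm x + M * nm y)) => e e0.
have [l zl] := hilbert_tensor_approx z hT e0; have /= := xy l; set w := \sum_(r <- l) _ in zl * => pw.
have wz : nm w <= nm z + e.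
  by rewrite -[w](subrK z) addrC (le_trans (nmD _ _))// lerD2l nmB.
rewrite -[z in p _ z](subrK w) addrC -[w]scale1r (rep_linear fp.1) !scale1r.
rewrite (le_trans (nmD _ _))//.
have := le_trans (rep_contr fp.1 x (z - w)) (ler_wpM2l (nm_ge0 _) zl).
have h1 := ler_wpM2l M0 (le_trans (rep_contr fp.1 y w) (ler_wpM2l (nm_ge0 _) wz)).
move: pw h1; lra.
Qed.

Let tensor_op_boundr (H K HK : hilbertSpace R) (h : H -> K -> HK) (C : cstarAlgebra R)
    (p : C -> K -> K) (c : C) (l : seq (H * K)) :
  (forall x1 y1 x2 y2, ip (h x1 y1) (h x2 y2) = ip x1 x2 * ip y1 y2) -> is_rep p ->
  nm (\sum_(q <- l) h q.1 (p c q.2)) <= nm c * nm (\sum_(q <- l) h q.1 q.2).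
Proof.
move=> hip rp; pose h' y x := h x y.
have h'ip x1 y1 x2 y2 : ip (h' x1 y1) (h' x2 y2) = ip x1 x2 * ip y1 y2.
  by rewrite /h' hip mulrC.
by have := tensor_op_bound c [seq (r.2, r.1) | r <- l] h'ip rp; rewrite !big_map.
Qed.

Lemma tens_norm a b : nm (t a b) <= nm a * nm b.
Proof.
have [_ _ _ _ [H [K [HK [h [p1 [p2 [p [hT f1 f2 fp ph]]]]]]]]] := tP.
have [_ hip _] := hT; have ab0 : 0 <= nm a * nm b by rewrite mulr_ge0 ?nm_ge0.
apply: (faithful_norm fp) => // z; apply: (@le_eps _ _ _ (nm (t a b) + nm a * nm b)) => e e0.
have [l zy] := hilbert_tensor_approx z hT e0; set w := \sum_(r <- l) _ in zy.
have pw : nm (p (t a b) w) <= nm a * nm b * nm w.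
  rewrite /w (rep_sum _ _ _ fp.1); under eq_bigr => r _ do rewrite ph.
  have := tensor_op_bound a [seq (r.1, p2 b r.2) | r <- l] hip f1.1.
  rewrite !(big_map (fun r => (r.1, p2 b r.2))) /= => /le_trans; apply.
  by rewrite -mulrA ler_wpM2l ?nm_ge0//; exact: (tensor_op_boundr b l hip f2.1).
rewrite -[z in p _ z](subrK w) addrC -[w]scale1r (rep_linear fp.1) !scale1r.
have wz : nm w <= nm z + e.
  by rewrite -[w](subrK z) addrC (le_trans (nmD _ _))// lerD2l nmB.
rewrite (le_trans (nmD _ _))//.
have := le_trans (rep_contr fp.1 (t a b) (z - w)) (ler_wpM2l (nm_ge0 _) zy).
have := ler_wpM2l ab0 wz; move: pw; lra.
Qed.

Lemma tsum_mulr_norm (c : B) (l : seq (A * B)) :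
  nm (\sum_(q <- l) t q.1 (c *c q.2)) <= nm c * nm (tsum t l).
Proof.
have [_ _ _ _ [H [K [HK [h [p1 [p2 [p [hT f1 f2 fp ph]]]]]]]]] := tP.
have [_ hip _] := hT; apply: (faithful_norm_dense hT fp (nm_ge0 c)) => l' /=.
have expand (F : A * B -> T) : p (\sum_(q <- l) F q) (\sum_(r <- l') h r.1 r.2) =
    \sum_(q <- l) \sum_(r <- l') p (F q) (h r.1 r.2).
  rewrite (act_sum (rep_action fp.1)); apply: eq_bigr => q _.
  exact: (rep_sum _ _ _ fp.1).
have e1 : \sum_(q <- l) \sum_(r <- l') p (t q.1 (c *c q.2)) (h r.1 r.2) =
    \sum_(q <- l) \sum_(r <- l') h (p1 q.1 r.1) (p2 c (p2 q.2 r.2)).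
  apply: eq_bigr => q _; apply: eq_bigr => r _.
  by rewrite ph (actM (rep_action f2.1)).
have e2 : \sum_(q <- l) \sum_(r <- l') p (t q.1 q.2) (h r.1 r.2) =
    \sum_(q <- l) \sum_(r <- l') h (p1 q.1 r.1) (p2 q.2 r.2).
  by apply: eq_bigr => q _; apply: eq_bigr => r _; rewrite ph.
have := tensor_op_boundr c [seq (p1 q.1 r.1, p2 q.2 r.2) | q <- l, r <- l'] hip f2.1.
by rewrite !big_allpairs_dep /= /tsum !expand e1 e2.
Qed.

(** It transfers statements about one leg to the other. *)
Lemma spatial_tensor_flip : spatial_tensor (fun b a => t a b).
Proof.
have [[l r] tM tadj dense [H [K [HK [h [p1 [p2 [p [[[hl hr] hip hd] f1 f2 fp ph]]]]]]]]] := tP.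
have swap (X Y Z : Type) (g : X -> Y -> Z) :
    [set g x y | y in [set: Y] & x in [set: X]] = [set g x y | x in [set: X] & y in [set: Y]].
  by apply/seteqP; split=> z [u _ [v _ <-]]; exists v => //; exists u.
split=> //; first by rewrite (swap _ _ _ t).
exists K, H, HK, (fun y x => h x y), p2, p1, p; split=> //.
split=> //; first by move=> x1 y1 x2 y2; rewrite hip mulrC.
by rewrite (swap _ _ _ h).
Qed.

End TensorNorm.

Section DualExtMore.
Variables (R : realType) (A : cstarAlgebra R).
Hypothesis Arep : representable A.
Implicit Types (m n : multiplier A) (w s : dual A).

Lemma dual_ext_diff w k (C M N : R) m n : strict_dom w k C ->
  0 <= M -> mbound m M -> 0 <= N -> mbound n N ->
  cm (dual_ext w m - dual_ext w n) <= C * nm (mright m k - mright n k).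
Proof.
move=> wk M0 mM N0 nN; have [C0 _] := wk.
apply: (@le_eps _ _ _ (2 * C)) => e e0.
have [z [_ /(_ k (mem_head _ _))[_ zm]]] := mnear_exists Arep [:: k] M0 mM e0.
have h1 := dual_ext_spec Arep wk M0 mM z; have h2 := dual_ext_spec Arep wk N0 nN z.
have h3 := cm_triangle (dual_ext w m) (w z) (dual_ext w n); rewrite (cmB _ (w z)) in h3.
have h4 := nm_triangle (k *c z) (mright m k) (mright n k).
have h5 := ler_wpM2l C0 (le_trans h4 (lerD zm (lexx _))); rewrite mulrDr in h5.
have h6 := ler_wpM2l C0 zm; lra.
Qed.

Lemma dual_ext_dadj w m (M : R) : bidominated w -> 0 <= M -> mbound m M ->
  dual_ext (dadj w) (madj m) = (dual_ext w m)^*.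
Proof.
move=> [[s ws] [s' ws']] M0 mM.
have [k [C kC]] := dominated_strict Arep ws'.
apply: (dual_ext_uniq Arep kC M0 (mbound_madj mM)) => e e0.
have [z [_ zn zw]] := dual_ext_near Arep ws [:: cadj k] M0 mM e0.
have [h _] := zn _ (mem_head _ _).
exists (cadj z); last by rewrite /= cadjK -conjB cmJ.
by rewrite /= -nm_cadj cadjB cadjM !cadjK.
Qed.

End DualExtMore.

Section TensorMultiplier.
Variables (R : realType) (A B T : cstarAlgebra R) (t : A -> B -> T).
Hypothesis tP : spatial_tensor t.
Let Arep := spatial_repl tP.
Let Brep := spatial_repr tP.
Let Trep := spatial_rep tP.

(** The element k of the strict bound is replaced by a finite sum of simple tensors; if z
    approximates m on their first legs, z (x) b approximates m (x) b. *)
Lemma dual_ext_mtensorl (f s : dual A) (h r : dual B) (m : multiplier A) (b : B)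
    (n : multiplier T) (M N : R) : dominated f s -> dominated h r ->
  0 <= M -> mbound m M -> 0 <= N -> mbound n N -> is_mtensor t m (membed b) n ->
  dual_ext (dual_tensor t f h) n = dual_ext f m * h b.
Proof.
move=> fs hr M0 mM N0 nN mn.
have [k [C kC]] := dominated_strict Trep (dual_tensor_dominated tP fs hr).
apply: (dual_ext_uniq Trep kC N0 nN) => e e0.
pose D := M * nm b + N + 1.
have D0 : 0 < D by rewrite ltr_wpDl// addr_ge0// mulr_ge0 ?nm_ge0.
have [l kl] := tsum_approx tP k (divr_gt0 e0 (mulr_gt0 (ltr0Sn _ 1) D0)).
pose E := \sum_(p <- l) nm (p.2 *c b) + cm (h b) + 1.
have S0 : 0 <= \sum_(p <- l) nm (p.2 *c b) by rewrite sumr_ge0// => p _; exact: nm_ge0.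
have E0 : 0 < E by rewrite ltr_wpDl// addr_ge0 ?cm_ge0.
have d0 : 0 < e / (2 * E) by rewrite divr_gt0 ?mulr_gt0.
have [z [z1 zn zf]] := dual_ext_near Arep fs (map fst l) M0 mM d0.
have hE : e / (2 * E) * E = e / 2 by field; rewrite gt_eqF.
have hD : e / (2 * D) * D = e / 2 by field; rewrite gt_eqF.
exists (t z b); last first.
  rewrite dual_tensorE// -mulrBl cmM (le_trans (ler_wpM2r (cm_ge0 _) zf))//.
  apply: (@le_trans _ _ (e / (2 * E) * E)); last by rewrite hE; lra.
  by rewrite ler_wpM2l ?(ltW d0)// /E; lra.
have k' : nm (tsum t l *c t z b - mright n (tsum t l)) <=
    e / (2 * E) * \sum_(p <- l) nm (p.2 *c b).
  have : {subset map fst l <= map fst l} by [].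
  rewrite /tsum; elim: {1 3 4 5}l => [_|p l' IH sub].
    by rewrite !big_nil cmul0 mright0 subrr nm0 mulr0.
  rewrite !big_cons cmulDl mrightD mulrDr opprD addrACA (le_trans (nmD _ _))// lerD//.
    have [_ ->] := mn p.1 p.2; rewrite (tensM tP) /= -(tensBl tP).
    rewrite (le_trans (tens_norm tP _ _))// ler_wpM2r ?nm_ge0//.
    by have [_] := zn p.1 (sub _ (mem_head _ _)).
  by apply: IH => q ql; apply: sub; rewrite inE ql orbT.
have -> : k *c t z b - mright n k = (k - tsum t l) *c t z b - mright n (k - tsum t l) +
    (tsum t l *c t z b - mright n (tsum t l)).
  by rewrite mrightB; calg T.
rewrite (le_trans (nmD _ _))// [e]splitr lerD//; last first.
  rewrite (le_trans k')// -hE ler_wpM2l ?(ltW d0)// /E.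
  by have := cm_ge0 (h b); lra.
rewrite -hD (le_trans (nmD _ _))// nmN.
have q0 : 0 <= e / (2 * D) by rewrite divr_ge0 ?(ltW e0)// mulr_ge0// ltW.
apply: (@le_trans _ _ (e / (2 * D) * (M * nm b) + N * (e / (2 * D)))); last first.
  rewrite /D; set q := e / _ in q0 *; set x := M * nm b; nra.
rewrite lerD//.
  rewrite (le_trans (nm_cmul _ _))// ler_pM ?nm_ge0//.
  by rewrite (le_trans (tens_norm tP _ _))// ler_wpM2r ?nm_ge0.
by rewrite (le_trans (mbound_right _ nN))// ler_wpM2l.
Qed.

End TensorMultiplier.

Lemma dual_ext_mtensorr (R : realType) (A B T : cstarAlgebra R) (t : A -> B -> T)
    (f s : dual A) (h r : dual B) (m : multiplier B) (a : A) (n : multiplier T) (M N : R) :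
  spatial_tensor t -> dominated f s -> dominated h r ->
  0 <= M -> mbound m M -> 0 <= N -> mbound n N -> is_mtensor t (membed a) m n ->
  dual_ext (dual_tensor t f h) n = f a * dual_ext h m.
Proof.
move=> tP fs hr M0 mM N0 nN mn; have fP := spatial_tensor_flip tP.
have -> : dual_tensor t f h = dual_tensor (fun b a => t a b) h f.
  by apply: (dual_tensor_uniq fP) => b c; rewrite (dual_tensorE tP) mulrC.
rewrite mulrC; apply: (dual_ext_mtensorl fP hr fs M0 mM N0 nN) => x y.
exact: mn.
Qed.

(** * Convolution *)

Section Convolution.
Variables (R : realType) (G : lcqg R).
Let A := C0 G.
Let T := C0xC0 G.
Let t := @ctens R G.
Let D := @comult R G.
Let tP : spatial_tensor t := @ctensP R G.
Implicit Types (f g h s r : dual A) (a b c d x : A).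

Lemma C0_rep : representable A. Proof. exact: spatial_repl tP. Qed.
Lemma C0xC0_rep : representable T. Proof. exact: spatial_rep tP. Qed.
Let Arep := C0_rep.
Let Trep := C0xC0_rep.

Lemma comult_bound a : mbound (D a) (nm a).
Proof. exact: (mstar_hom_bound Trep (@comult_hom R G)). Qed.

Lemma comultM a b : D (a *c b) = mmul (D a) (D b).
Proof. by have [_ h _] := @comult_hom R G. Qed.

Lemma comult_adj a : D (cadj a) = madj (D a).
Proof. by have [_ _ h] := @comult_hom R G. Qed.

Lemma comult_linear (k : R[i]) a b : D (k *: a + b) = madd (mscale k (D a)) (D b).
Proof. by have [h _ _] := @comult_hom R G. Qed.

(** [convolution] is a bare function; this packs it as an element of the dual, legitimately so for
    bidominated functionals by [convE]. *)
Definition conv f g : dual A :=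
  xget dual0 [set w : dual A | forall a, w a = convolution f g a].

Lemma convE f g a : bidominated f -> bidominated g ->
  conv f g a = dual_ext (dual_tensor t f g) (D a).
Proof.
move=> fd gd; have [[S FS] _] := dual_tensor_bidominated tP fd gd.
have [K K0 fK] := dual_dle f; have [L L0 gL] := dual_dle g.
have lin (k : R[i]) x y : dual_ext (dual_tensor t f g) (D (k *: x + y)) =
    k * dual_ext (dual_tensor t f g) (D x) + dual_ext (dual_tensor t f g) (D y).
  have kb := mbound_mscale k (comult_bound x).
  rewrite comult_linear (dual_ext_madd Trep FS _ kb _ (comult_bound y)) ?nm_ge0//.
    by rewrite (dual_ext_mscale Trep FS _ _ (comult_bound x))// nm_ge0.
  by rewrite mulr_ge0 ?cm_ge0 ?nm_ge0.
have bd : exists2 M, 0 <= M & dle (fun x => dual_ext (dual_tensor t f g) (D x)) M.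
  exists (K * L) => [|x]; first exact: mulr_ge0.
  apply: (dual_ext_le Trep FS (nm_ge0 x) (comult_bound x)); first exact: mulr_ge0.
  exact: dle_dual_tensor.
by rewrite /conv; case: xgetP => [w _ ->//|/(_ (mkdual lin bd))[]].
Qed.

Lemma dle_conv f g (K L : R) : bidominated f -> bidominated g ->
  0 <= K -> dle f K -> 0 <= L -> dle g L -> dle (conv f g) (K * L).
Proof.
move=> fd gd K0 fK L0 gL x; have [[S FS] _] := dual_tensor_bidominated tP fd gd.
rewrite convE//; apply: (dual_ext_le Trep FS (nm_ge0 x) (comult_bound x)).
  exact: mulr_ge0.
exact: dle_dual_tensor.
Qed.

Lemma conv_pos s r : dpositive s -> dpositive r -> dpositive (conv s r).
Proof.
move=> s0 r0 a; have S0 := dual_tensor_pos tP s0 r0.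
have bs := bidominated_pos Arep s0; have br := bidominated_pos Arep r0.
rewrite convE// comultM -{2}(cadjK a) [D (cadj (cadj a))]comult_adj.
(* Zero is dominated by any positive functional; the positivity half of [dual_ext_mul_adj] is what
   is wanted. *)
have Z : dominated (dual0 : dual T) (dual_tensor t s r).
  by split=> // z; rewrite /= cm0 sn_ge0.
by have [] := dual_ext_mul_adj Trep Z (nm_ge0 _) (comult_bound (cadj a)).
Qed.

Lemma conv_dominated f g s r : dominated f s -> dominated g r ->
  bidominated f -> bidominated g -> dominated (conv f g) (conv s r).
Proof.
move=> fs gr fd gd; have [s0 _] := fs; have [r0 _] := gr.
split=> [|z]; first exact: conv_pos.
have bs := bidominated_pos Arep s0; have br := bidominated_pos Arep r0.
have FS := dual_tensor_dominated tP fs gr.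
have [_ h] := dual_ext_mul_adj Trep FS (nm_ge0 z) (comult_bound z).
rewrite convE// /sn -[cm _]ger0_norm ?cm_ge0// -sqrtr_sqr ler_wsqrtr// (le_trans h)//.
by rewrite /sq /formR convE// comultM comult_adj.
Qed.

Lemma conv_dadj f g : bidominated f -> bidominated g ->
  conv (dadj f) (dadj g) = dadj (conv f g).
Proof.
move=> fd gd; have fd' := bidominated_dadj fd; have gd' := bidominated_dadj gd.
apply: dual_ext_eq => a; rewrite /= !convE//.
rewrite (dual_tensor_dadj tP) -[a in LHS]cadjK comult_adj.
exact: (dual_ext_dadj Trep (dual_tensor_bidominated tP fd gd) (nm_ge0 _) (comult_bound _)).
Qed.

Lemma conv_bidominated f g : bidominated f -> bidominated g -> bidominated (conv f g).
Proof.
move=> fd gd; have [[s fs] [s' fs']] := fd; have [[r gr] [r' gr']] := gd.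
split; first by exists (conv s r); exact: conv_dominated.
exists (conv s' r'); rewrite -conv_dadj//.
by apply: conv_dominated => //; exact: bidominated_dadj.
Qed.

Lemma conv_dactr f g c d x : bidominated f -> bidominated g ->
  conv (dactr f c) (dactr g d) x = dual_tensor t f g (mright (D x) (t c d)).
Proof.
move=> fd gd.
have [[S FS] _] := dual_tensor_bidominated tP (bidominated_dactr c fd) (bidominated_dactr d gd).
rewrite convE; [|exact: bidominated_dactr..].
rewrite (dual_tensor_dactr tP) in FS *.
exact: (dual_ext_dactr Trep FS (nm_ge0 x) (comult_bound x)).
Qed.

Lemma conv_dactl f g c d x : bidominated f -> bidominated g ->
  conv (dactl c f) (dactl d g) x = dual_tensor t f g (mleft (D x) (t c d)).
Proof.
move=> fd gd.
have [[S FS] _] := dual_tensor_bidominated tP (bidominated_dactl c fd) (bidominated_dactl d gd).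
rewrite convE; [|exact: bidominated_dactl..].
rewrite (dual_tensor_dactl tP) in FS *.
exact: (dual_ext_dactl Trep FS (nm_ge0 x) (comult_bound x)).
Qed.

(** F = f (x) g (x) h is strictly continuous, and Delta (x) id and id (x) Delta send Delta(a) to the
    same multiplier [m]. Since [strict_ext] is convergence along neighbourhoods of Delta(a), a
    single z close to Delta(a) compares both sides. *)
Lemma conv_assoc f g h : bidominated f -> bidominated g -> bidominated h ->
  conv (conv f g) h = conv f (conv g h).
Proof.
move=> fd gd hd; apply: dual_ext_eq => a.
have [T3 [t1 [t2 [D1 [D2 [[t1P t2P t12] [H1 _ D1E] [H2 _ D2E] /(_ a)[m [m1 m2]]]]]]]] :=
  @comult_coassociative R G.
have T3rep := spatial_rep t1P.
have fgd := dual_tensor_bidominated tP fd gd; have ghd := dual_tensor_bidominated tP gd hd.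
set F := dual_tensor t1 (dual_tensor t f g) h.
have FE : F = dual_tensor t2 f (dual_tensor t g h).
  apply/esym/(dual_tensor_uniq t1P) => z c.
  have tc_lin (k : R[i]) (x y : T) : dual_tensor t2 f (dual_tensor t g h) (t1 (k *: x + y) c) =
     k * dual_tensor t2 f (dual_tensor t g h) (t1 x c) +
     dual_tensor t2 f (dual_tensor t g h) (t1 y c).
    by rewrite (tens_linl t1P) dual_linear.
  have tc_bd : exists2 K, 0 <= K &
     dle (fun x : T => dual_tensor t2 f (dual_tensor t g h) (t1 x c)) K.
    have [K K0 FK] := dual_dle (dual_tensor t2 f (dual_tensor t g h)).
    exists (K * nm c) => [|x]; first by rewrite mulr_ge0 ?nm_ge0.
    rewrite (le_trans (FK _))// -mulrA ler_wpM2l// mulrC.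
    exact: tens_norm.
  suff -> : dual_tensor t2 f (dual_tensor t g h) (t1 z c) = dscale (h c) (dual_tensor t f g) z.
    by rewrite /= mulrC.
  suff -> : dscale (h c) (dual_tensor t f g) = mkdual tc_lin tc_bd by [].
  apply: (dual_tens_eq tP) => x y /=.
  rewrite t12 (dual_tensorE t2P) !(dual_tensorE tP); ring.
have Fd : bidominated F by exact: dual_tensor_bidominated.
have [[S FS] _] := Fd.
have b1 z := mstar_hom_bound T3rep H1 z; have b2 z := mstar_hom_bound T3rep H2 z.
have [KF KF0 FK] := dual_dle F.
have ext_lin (E : T -> multiplier T3) (EH : mstar_hom E) (k : R[i]) (x y : T) :
    dual_ext F (E (k *: x + y)) = k * dual_ext F (E x) + dual_ext F (E y).
  have eb := mstar_hom_bound T3rep EH; have [el _ _] := EH.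
  have kb := mbound_mscale k (eb x).
  rewrite el (dual_ext_madd T3rep FS _ kb _ (eb y)) ?nm_ge0//.
    by rewrite (dual_ext_mscale T3rep FS _ _ (eb x))// nm_ge0.
  by rewrite mulr_ge0 ?cm_ge0 ?nm_ge0.
have ext_bd (E : T -> multiplier T3) (EH : mstar_hom E) :
    exists2 K, 0 <= K & dle (fun x : T => dual_ext F (E x)) K.
  exists KF => // x.
  exact: (dual_ext_le T3rep FS (nm_ge0 x) (mstar_hom_bound T3rep EH x)).
(* F composed with Delta (x) id has the right values on simple tensors; likewise for [W2] with id
   (x) Delta. *)
have W1 : dual_tensor t (conv f g) h = mkdual (ext_lin D1 H1) (ext_bd D1 H1).
  apply/esym/(dual_tensor_uniq tP) => x y /=; rewrite convE//.
  have [[s fgs] _] := fgd; have [[r hr] _] := hd.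
  exact: (dual_ext_mtensorl t1P fgs hr (nm_ge0 _) (comult_bound x) (nm_ge0 _) (b1 _) (D1E x y)).
have W2 : dual_tensor t f (conv g h) = mkdual (ext_lin D2 H2) (ext_bd D2 H2).
  apply/esym/(dual_tensor_uniq tP) => x y /=; rewrite convE// FE.
  have [[s fs] _] := fd; have [[r ghr] _] := ghd.
  exact: (dual_ext_mtensorr t2P fs ghr (nm_ge0 _) (comult_bound y) (nm_ge0 _) (b2 _) (D2E x y)).
have [k [C kC]] := dominated_strict T3rep FS; have [C0 _] := kC.
have [[S1 WS1] _] := dual_tensor_bidominated tP (conv_bidominated fd gd) hd.
have [[S2 WS2] _] := dual_tensor_bidominated tP fd (conv_bidominated gd hd).
have fgd' := conv_bidominated fd gd; have ghd' := conv_bidominated gd hd.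
rewrite !convE//; apply/eqP; rewrite -subr_eq0; apply/eqP/cm_le0.
apply: (@le_eps _ _ _ (2 + 2 * C)) => e e0; rewrite add0r.
have nbhs_of (E : T -> multiplier T3) : strict_ext E (D a) m -> exists (l : seq T) (d : R),
    0 < d /\ forall z, mnear (D a) l d z -> nm (mright (E z) k - mright m k) <= e.
  move=> /(_ k)[_]; have PF := strict_filter Trep (nm_ge0 a) (comult_bound a).
  move=> /cvgrPdist_lt/(_ e%:C); rewrite ltcR => /(_ e0)[l [d [d0 ld]]].
  have dR : 0 < complex.Re d by move: d0; rewrite ltcE => /andP[].
  exists l, (complex.Re d / 2); split; first by rewrite divr_gt0.
  move=> z zl; have := ld z; rewrite nmE ltcR nmB => h'; apply/ltW/h' => b /zl[z1 z2].
  rewrite !nmE (ge0_Re (ltW d0)) !ltcR.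
  by rewrite !(le_lt_trans z1, le_lt_trans z2)// ltr_pdivrMr// ltr_pMr// ltr1n.
have [l1 [d1 [d10 n1]]] := nbhs_of D1 m1; have [l2 [d2 [d20 n2]]] := nbhs_of D2 m2.
have [k1 [C1 kC1]] := dominated_strict Trep WS1; have [C10 _] := kC1.
have [k2 [C2 kC2]] := dominated_strict Trep WS2; have [C20 _] := kC2.
pose d := Num.min (Num.min d1 d2) (Num.min (e / (C1 + 1)) (e / (C2 + 1))).
have C1p : 0 < C1 + 1 by rewrite ltr_wpDl.
have C2p : 0 < C2 + 1 by rewrite ltr_wpDl.
have d0 : 0 < d by rewrite !lt_min d10 d20 !divr_gt0.
have [z [_ zn]] := mnear_exists Trep (k1 :: k2 :: l1 ++ l2) (nm_ge0 a) (comult_bound a) d0.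
have z1 : nm (mright (D1 z) k - mright m k) <= e.
  apply: n1 => b bl; have [h1 h2] := zn b ltac:(by rewrite !inE mem_cat bl !orbT).
  by split; [apply: le_trans h1 _|apply: le_trans h2 _]; rewrite !ge_min lexx.
have z2 : nm (mright (D2 z) k - mright m k) <= e.
  apply: n2 => b bl; have [h1 h2] := zn b ltac:(by rewrite !inE mem_cat bl !orbT).
  by split; [apply: le_trans h1 _|apply: le_trans h2 _]; rewrite !ge_min lexx !orbT.
have e1 : cm (dual_tensor t (conv f g) h z - dual_ext (dual_tensor t (conv f g) h) (D a)) <= e.
  rewrite (le_trans (dual_ext_spec Trep kC1 (nm_ge0 a) (comult_bound a) z))//.
  have [_ h1] := zn k1 (mem_head _ _).
  apply: (@le_trans _ _ (C1 * (e / (C1 + 1)))).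
    by rewrite ler_wpM2l// (le_trans h1)// !ge_min lexx !orbT.
  by rewrite mulrCA ler_piMr ?(ltW e0)// ler_pdivrMr// mul1r lerDl.
have e2 : cm (dual_tensor t f (conv g h) z - dual_ext (dual_tensor t f (conv g h)) (D a)) <= e.
  rewrite (le_trans (dual_ext_spec Trep kC2 (nm_ge0 a) (comult_bound a) z))//.
  have [_ h1] := zn k2 ltac:(by rewrite !inE eqxx orbT).
  apply: (@le_trans _ _ (C2 * (e / (C2 + 1)))).
    by rewrite ler_wpM2l// (le_trans h1)// !ge_min lexx !orbT.
  by rewrite mulrCA ler_piMr ?(ltW e0)// ler_pdivrMr// mul1r lerDl.
have e3 : cm (dual_tensor t (conv f g) h z - dual_tensor t f (conv g h) z) <= C * (e + e).
  rewrite W1 W2 /= (le_trans (dual_ext_diff T3rep kC (nm_ge0 z) (b1 z) (nm_ge0 z) (b2 z)))//.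
  rewrite ler_wpM2l// (le_trans (nm_triangle _ (mright m k) _))// lerD//.
  by rewrite nmB.
set x1 := dual_ext _ _ in e1 *; set x2 := dual_ext _ _ in e2 *.
set y1 := dual_tensor t _ h z in e1 e3; set y2 := dual_tensor t f _ z in e2 e3.
have h1 := cm_triangle x1 y1 x2; have h2 := cm_triangle y1 y2 x2.
rewrite (cmB x1 y1) in h1; lra.
Qed.

End Convolution.

(** The right action is bounded on finite sums of simple tensors. Pairing y = m z with such an
    approximation of y^* moves the bound to the left action at an arbitrary z. *)
Lemma mtensor_one_bound (R : realType) (A B T : cstarAlgebra R) (t : A -> B -> T)
    (c : B) (m : multiplier T) :
  spatial_tensor t -> is_mtensor t mone (membed c) m -> mbound m (nm c).
Proof.
move=> tP mc z; set y := mleft m z.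
have right_sum l : nm (mright m (tsum t l)) <= nm c * nm (tsum t l).
  have -> : mright m (tsum t l) =
      cadj (\sum_(q <- [seq (cadj p.1, cadj p.2) | p <- l]) t q.1 (cadj c *c q.2)).
    rewrite big_map cadj_sum /tsum; elim: l => [|p l IH]; first by rewrite !big_nil mright0.
    rewrite !big_cons mrightD IH; congr (_ + _); have [_ ->] := mc p.1 p.2.
    by rewrite (tens_adj tP) /= cadjM !cadjK.
  rewrite nm_cadj (le_trans (tsum_mulr_norm tP _ _))// nm_cadj ler_wpM2l ?nm_ge0//.
  rewrite -nm_cadj /tsum big_map cadj_sum le_eqVlt; apply/orP; left; apply/eqP; congr nm.
  by apply: eq_bigr => p _; rewrite (tens_adj tP) /= !cadjK.
have : nm y ^+ 2 <= nm c * nm z * nm y.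
  apply: (@le_eps _ _ _ (nm y + nm c * nm z)) => e e0.
  have [l yl] := tsum_approx tP (cadj y) e0; set x := tsum t l in yl.
  have x1 : nm x <= nm y + e.
    rewrite -[x](subrK (cadj y)) addrC (le_trans (nmD _ _))// nm_cadj lerD2l nmB//.
  rewrite -nm_cstar -[cadj y](subrK x) cmulDl (le_trans (nmD _ _))//.
  have h1 : nm ((cadj y - x) *c y) <= e * nm y.
    by rewrite (le_trans (nm_cmul _ _))// ler_wpM2r ?nm_ge0.
  have h2 : nm (x *c y) <= nm c * nm z * (nm y + e).
    rewrite /y mcentral (le_trans (nm_cmul _ _))// mulrAC ler_wpM2r ?nm_ge0//.
    by rewrite (le_trans (right_sum l))// ler_wpM2l ?nm_ge0.
  by move: h1 h2; lra.
have := nm_ge0 y; rewrite le0r => /orP[/eqP->|y0]; first by rewrite mulr_ge0 ?nm_ge0.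
by rewrite expr2 ler_pM2r.
Qed.

Lemma dual_ext_close (R : realType) (A : cstarAlgebra R) (w w' s s' : dual A)
    (m : multiplier A) (L M : R) : representable A ->
  dominated w s -> dominated w' s' -> 0 <= M -> mbound m M -> 0 <= L ->
  (forall z, cm (w z - w' z) <= L * nm z) ->
  cm (dual_ext w m - dual_ext w' m) <= L * M.
Proof.
move=> Arep ws ws' M0 mM L0 wL.
have [k [C kC]] := dominated_strict Arep ws; have [k' [C' kC']] := dominated_strict Arep ws'.
have [C0 _] := kC; have [C0' _] := kC'.
apply: (@le_eps _ _ _ (C + C')) => e e0.
have [z [z1 zn]] := mnear_exists Arep [:: k; k'] M0 mM e0.
have [_ h1] := zn k (mem_head _ _).
have [_ h2] := zn k' ltac:(by rewrite !inE eqxx orbT).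
have h3 := le_trans (dual_ext_spec Arep kC M0 mM z) (ler_wpM2l C0 h1).
have h4 := le_trans (dual_ext_spec Arep kC' M0 mM z) (ler_wpM2l C0' h2).
have h5 := le_trans (wL z) (ler_wpM2l L0 z1).
have h6 := cm_triangle (dual_ext w m) (w z) (dual_ext w' m).
have h7 := cm_triangle (w z) (w' z) (dual_ext w' m).
rewrite (cmB _ (w z)) in h6; lra.
Qed.

Lemma dual_span_eq (R : realType) (A : cstarAlgebra R) (S : set A) (w w' : dual A) :
  closed_span S = setT -> (forall x, S x -> w x = w' x) -> w = w'.
Proof.
move=> ST e; apply: dual_ext_eq => z; apply/eqP; rewrite -subr_eq0; apply/eqP/cm_le0.
have [K K0 wK] := dual_dle (dsub w w'); apply: (@le_eps _ _ _ K) => d d0; rewrite add0r.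
have [n [k [y [yS zy]]]] := closed_span_approx z ST d0.
have y0 : dsub w w' (\sum_(i < n) k i *: y i) = 0.
  rewrite dual_sum big1// => i _; rewrite dualZ /= e ?subrr ?mulr0//.
have -> : w z - w' z = dsub w w' (z - \sum_(i < n) k i *: y i) by rewrite dualB y0 subr0.
by rewrite (le_trans (wK _))// ler_wpM2l.
Qed.

(** * Vector functionals and slices of the comultiplication *)

Section VectorFunctional.
Variables (R : realType) (A : cstarAlgebra R) (H : hilbertSpace R) (pi : A -> H -> H).
Hypothesis Hpi : is_rep pi.

Fact vecf_linear (x y : H) (k : R[i]) a b :
  ip (pi (k *: a + b) x) y = k * ip (pi a x) y + ip (pi b x) y.
Proof. by rewrite (act_linear (rep_action Hpi)) ip_linear. Qed.

Fact vecf_bounded (x y : H) : exists2 K, 0 <= K & dle (fun a => ip (pi a x) y) K.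
Proof.
exists (nm x * nm y) => [|a]; first by rewrite mulr_ge0 ?nm_ge0.
rewrite (le_trans (ip_CS _ _))// (_ : _ * nm a = nm a * nm x * nm y); last by ring.
by rewrite ler_wpM2r ?nm_ge0//; exact: rep_contr.
Qed.

(** A supply of bidominated functionals large enough to compute norms in the algebra. *)
Definition vecf (x y : H) : dual A := mkdual (vecf_linear x y) (vecf_bounded x y).

Lemma dle_vecf x y : dle (vecf x y) (nm x * nm y).
Proof.
move=> a /=; rewrite (le_trans (ip_CS _ _))//.
rewrite (_ : _ * nm a = nm a * nm x * nm y); last by ring.
by rewrite ler_wpM2r ?nm_ge0//; exact: rep_contr.
Qed.

Lemma vecf_dominated x y : dominated (vecf x y) (dscale (nm x ^+ 2)%:C (vecf y y)).
Proof.
have P := @ip_psd R H; have ac := rep_action Hpi.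
have yy a : 0 <= ip (pi (a *c cadj a) y) y.
  by rewrite (actM ac) (act_adj ac) (psd_ge0 P).
split=> [a|z] /=; first by rewrite mulr_ge0 ?lecR ?sqr_ge0// -{2}(cadjK a).
rewrite (act_adj ac) (le_trans (ip_CS _ _))//.
rewrite /sn /sq /formR /= ReZ sqrtrM ?sqr_ge0// sqrtr_sqr ger0_norm ?nm_ge0//.
rewrite ler_wpM2l ?nm_ge0// (actM ac) (act_adj ac) -/(sq _ _) sq_ip sqrtr_sqr.
by rewrite ger0_norm ?nm_ge0.
Qed.

Lemma vecf_bidominated x y : bidominated (vecf x y).
Proof.
split; first by eexists; exact: vecf_dominated.
suff -> : dadj (vecf x y) = vecf y x by eexists; exact: vecf_dominated.
apply: dual_ext_eq => a /=.
by rewrite (act_adj (rep_action Hpi)) cadjK -ip_conj.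
Qed.

End VectorFunctional.

Section Slices.
Variables (R : realType) (G : lcqg R).
Let A := C0 G.
Let T := C0xC0 G.
Let t := @ctens R G.
Let D := @comult R G.
Let tP : spatial_tensor t := @ctensP R G.
Let Arep : representable A := @C0_rep R G.
Let Trep : representable T := @C0xC0_rep R G.
Implicit Types (f g s r : dual A) (a b c x : A).

Lemma conv_close f g g' x (K L : R) :
  bidominated f -> bidominated g -> bidominated g' -> 0 <= K -> dle f K ->
  0 <= L -> dle (dsub g g') L -> cm (conv f g x - conv f g' x) <= K * L * nm x.
Proof.
move=> fd gd gd' K0 fK L0 gL; rewrite !convE//.
have [[S FS] _] := dual_tensor_bidominated tP fd gd.
have [[S' FS'] _] := dual_tensor_bidominated tP fd gd'.
apply: (dual_ext_close Trep FS FS' (nm_ge0 x) (comult_bound x)); first exact: mulr_ge0.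
by move=> z; rewrite -dual_tensor_subr//; exact: dle_dual_tensor.
Qed.

Let conv_cancel (W F : dual T) (m : multiplier T) (x : A) (z : T) (M : R) :
  bidominated W -> bidominated F -> 0 <= M -> mbound m M ->
  (forall y, W y = F (mright m y)) -> membed z = mmul (D x) m ->
  dual_ext W (D x) = F z.
Proof.
move=> [[S WS] _] [[S' FS] _] M0 mM WF zE.
have [k [C [C0 kC]]] := dominated_strict Trep FS.
have kW : dual_ext W (D x) - F z = 0; last by apply/eqP; rewrite -subr_eq0 kW.
apply: cm_le0; apply: (@le_eps _ _ _ (1 + C * M)) => e e0; rewrite add0r.
have [y [_ yn yW]] := dual_ext_near Trep WS [:: k] (nm_ge0 x) (comult_bound x) e0.
have [_ h] := yn k (mem_head _ _).
rewrite (le_trans (cm_triangle _ (W y) _))// mulrDl mul1r lerD//; first by rewrite cmB.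
rewrite WF -dualB (le_trans (kC _))// -mulrA ler_wpM2l//.
have -> : k *c (mright m y - z) = mright m (k *c y - mright (D x) k).
  rewrite cmulBr mrightB mrightM; congr (_ - _).
  by have := congr1 (fun n => mright n k) zE.
by rewrite (le_trans (mbound_right _ mM))// ler_wpM2l.
Qed.

Lemma conv_rcancel f g x c z : bidominated f -> bidominated g -> is_rcancel t D x c z ->
  conv f (dactl c g) x = dual_tensor t f g z.
Proof.
move=> fd gd [m mc zE]; have mM := mtensor_one_bound tP mc.
have cgd := bidominated_dactl c gd; rewrite convE//.
have [K K0 FK] := dual_dle (dual_tensor t f g).
have lin (k : R[i]) (y y' : T) : dual_tensor t f g (mright m (k *: y + y')) =
    k * dual_tensor t f g (mright m y) + dual_tensor t f g (mright m y').
  by rewrite mright_linear dual_linear.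
have bd : exists2 L, 0 <= L & dle (fun y : T => dual_tensor t f g (mright m y)) L.
  exists (K * nm c) => [|y]; first by rewrite mulr_ge0 ?nm_ge0.
  by rewrite (le_trans (FK _))// -mulrA ler_wpM2l//; exact: mbound_right.
have WE : dual_tensor t f (dactl c g) = mkdual lin bd.
  apply/esym/(dual_tensor_uniq tP) => a b /=; have [_ ->] := mc a b.
  by rewrite (dual_tensorE tP).
apply: (conv_cancel _ _ (nm_ge0 c) mM _ zE); try exact: dual_tensor_bidominated.
by move=> y; rewrite WE.
Qed.

Lemma conv_lcancel f g x c z : bidominated f -> bidominated g -> is_lcancel t D x c z ->
  conv (dactl c f) g x = dual_tensor t f g z.
Proof.
move=> fd gd [m mc zE]; have fP := spatial_tensor_flip tP.
have mM : mbound m (nm c) by apply: (mtensor_one_bound fP) => b a; exact: mc.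
have cfd := bidominated_dactl c fd; rewrite convE//.
have [K K0 FK] := dual_dle (dual_tensor t f g).
have lin (k : R[i]) (y y' : T) : dual_tensor t f g (mright m (k *: y + y')) =
    k * dual_tensor t f g (mright m y) + dual_tensor t f g (mright m y').
  by rewrite mright_linear dual_linear.
have bd : exists2 L, 0 <= L & dle (fun y : T => dual_tensor t f g (mright m y)) L.
  exists (K * nm c) => [|y]; first by rewrite mulr_ge0 ?nm_ge0.
  by rewrite (le_trans (FK _))// -mulrA ler_wpM2l//; exact: mbound_right.
have WE : dual_tensor t (dactl c f) g = mkdual lin bd.
  apply/esym/(dual_tensor_uniq tP) => a b /=; have [_ ->] := mc a b.
  by rewrite (dual_tensorE tP).
apply: (conv_cancel _ _ (nm_ge0 c) mM _ zE); try exact: dual_tensor_bidominated.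
by move=> y; rewrite WE.
Qed.

(* b = (id (x) g)Delta(x) *)
Definition conv_slice g x b := forall f, bidominated f -> f b = conv f g x.

(* Approximating g by s(. c) gives elements (id (x) s)(Delta(x)(1 (x) c)) of C0(G),
   which form a Cauchy sequence. *)
Lemma conv_slice_exists g x : bidominated g -> exists b, conv_slice g x b.
Proof.
move=> gd; have [[s gs] _] := gd; have [s0 _] := gs.
have [K K0 sK] := dual_dle s; have sd := bidominated_pos Arep s0.
have snK y : sn (formR s) y <= Num.sqrt K * nm y.
  rewrite -[nm y]ger0_norm ?nm_ge0// -sqrtr_sqr -sqrtrM// /sn ler_wsqrtr//.
  by rewrite formR_adj -nm_cadj (formL_bound _ s0 K0 sK).
have e2 n : 0 < 2^-1 ^+ n :> R by rewrite exprn_gt0// invr_gt0.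
pose c n : A := xget 0 [set c | dle (dsub g (dactl c s)) (Num.sqrt K * 2^-1 ^+ n)].
have cP n : dle (dsub g (dactl (c n) s)) (Num.sqrt K * 2^-1 ^+ n).
  rewrite /c; case: xgetP => [? _ //|none].
  have [v [_ vP]] := dominated_approx gs (e2 n).
  case: (none (cadj v)) => y /=; rewrite (le_trans (vP y))// mulrC mulrAC ler_wpM2r ?(ltW (e2 n))//.
have cd n : bidominated (dactl (c n) s) by exact: bidominated_dactl.
have [_ _ rc _] := @comult_cancellation R G.
pose z n : T := xget 0 [set z | is_rcancel t D x (c n) z].
have zP n : is_rcancel t D x (c n) (z n).
  by rewrite /z; case: xgetP => [? _ //|none]; have [y /none] := rc x (c n).
have [S [Sl Sb St Sf]] := dual_tensor_slice tP K0 sK.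
pose b n := S (z n).
have bE n f : bidominated f -> f (b n) = conv f (dactl (c n) s) x.
  by move=> fd; rewrite -Sf (conv_rcancel fd sd (zP n)).
pose rho n := 2 * Num.sqrt K * nm x * 2^-1 ^+ n.
have C0 : 0 <= 2 * Num.sqrt K * nm x by rewrite !mulr_ge0 ?nm_ge0 ?sqrtr_ge0.
have r0 : tends0 rho by apply: (tends0_le (C := 2 * Num.sqrt K * nm x) (@tends0_geo R)).
have mono m n : (m <= n)%N -> 2^-1 ^+ n <= 2^-1 ^+ m :> R.
  by move=> mn; rewrite ler_wiXn2l// ?invr_ge0// invf_le1// ler1n.
have bC m n : (m <= n)%N -> nm (b n - b m) <= rho m.
  (* Matrix coefficients of the slices are convolutions with vector functionals, to which
     [conv_close] applies. *)
  move=> mn; have [H [pi Hpi]] := Arep.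
  apply: (faithful_norm_ip Hpi) => [|u v]; first by rewrite mulr_ge0// ltW.
  have fd := vecf_bidominated Hpi.1 u v.
  have uv : 0 <= nm u * nm v by rewrite mulr_ge0 ?nm_ge0.
  have e := bE n _ fd; have e' := bE m _ fd.
  rewrite (actB (rep_action Hpi.1)) (psdBl (@ip_psd R H)).
  move: e e' => /= -> ->.
  have L0 : 0 <= 2 * Num.sqrt K * 2^-1 ^+ m by rewrite !mulr_ge0 ?sqrtr_ge0// ltW.
  apply: le_trans (conv_close x fd (cd n) (cd m) uv (dle_vecf Hpi.1 u v) L0 _) _ => [y|].
    have h1 := cP n y; have h2 := cP m y; rewrite /= in h1 h2 *.
    have h3 := cm_triangle (s (y *c c n)) (g y) (s (y *c c m)).
    rewrite (cmB (s (y *c c n)) (g y)) in h3.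
    have := ler_wpM2r (nm_ge0 y) (ler_wpM2l (sqrtr_ge0 K) (mono m n mn)).
    by move: h1 h2 h3; lra.
  by rewrite /rho le_eqVlt; apply/orP; left; apply/eqP; ring.
have [l bl] := cvg_rate bC r0.
exists l => f fd; apply/eqP; rewrite -subr_eq0; apply/eqP/cm_le0.
have [L L0 fL] := dual_dle f.
have q0 n : 0 <= Num.sqrt K * 2^-1 ^+ n by rewrite mulr_ge0 ?sqrtr_ge0// ltW.
apply: (@le_tends0 _ (fun n => L * rho n + L * (Num.sqrt K * 2^-1 ^+ n) * nm x)).
  apply: tends0D; first by apply: (tends0_le (C := L) r0).
  apply: (tends0_le (C := L * Num.sqrt K * nm x) (@tends0_geo R)) => [n|].
    by rewrite le_eqVlt; apply/orP; left; apply/eqP; ring.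
  by rewrite !mulr_ge0 ?nm_ge0 ?sqrtr_ge0.
move=> n; rewrite add0r (le_trans (cm_triangle _ (f (b n)) _))// lerD//.
  by rewrite -dualB (le_trans (fL _))// ler_wpM2l// nmB.
by rewrite bE// cmB; exact: conv_close.
Qed.

Lemma conv_slice_adj g x b : bidominated g -> conv_slice g x b ->
  conv_slice (dadj g) (cadj x) (cadj b).
Proof.
move=> gd gb f fd; have fd' := bidominated_dadj fd.
have := gb _ fd' => /= /(congr1 (fun z : R[i] => z^*)); rewrite conjCK => ->.
by rewrite -{2}(dadjK f) (conv_dadj fd' gd) /= cadjK.
Qed.

End Slices.

(** * Contractive idempotents *)

Section AbsUnique.
Variables (R : realType) (A : cstarAlgebra R).
Hypothesis Arep : representable A.
Implicit Types (w q : dual A) (a b y : A).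

Lemma sn_formR_le q y : dpositive q -> dle q 1 -> sn (formR q) y <= nm y.
Proof.
move=> q0 q1; rewrite -[leRHS]ger0_norm ?nm_ge0// -sqrtr_sqr /sn ler_wsqrtr//.
by rewrite formR_adj -[nm y]nm_cadj (le_trans (formL_bound _ q0 _ q1))// mul1r.
Qed.

(* Cauchy-Schwarz in the GNS space of q with its cyclic vector adjoined *)
Lemma dpos_dist q (rho : R) c : dpositive q -> 0 <= rho -> dle q rho ->
  let d := rho - 2 * complex.Re (q c) + complex.Re (q (cadj c *c c)) in
  0 <= d /\ forall x, cm (q x - q (x *c c)) <= Num.sqrt rho * Num.sqrt d * nm x.
Proof.
move=> q0 rho0 qr d; have U := uform_action Arep q0 rho0 qr.
have P := act_psd U; pose p : R[i]^o * A := (1, - c).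
have pE : sq (uform q rho) p = d.
  rewrite /sq /uform /p /= !dualN rmorphN /= conjC1 !mul1r.
  have -> : cadj (- c) *c - c = cadj c *c c by calg A.
  by rewrite !(ReD, ReN) ReJ /= /d; ring.
have oneE : sq (uform q rho) (1, 0) = rho.
  rewrite /sq /uform /= conjC1 dualw0 conjC0 cmulr0 dualw0 !mulr0 !addr0 !mul1r //.
split=> [|x]; first by rewrite -pE; exact: sq_ge0.
have -> : q x - q (x *c c) = uform q rho (uact x p) (1, 0).
  rewrite -dualB /uform /= conjC1 dualw0 conjC0 [cadj 0](_ : _ = 0); last by calg A.
  by rewrite cmul0 dualw0 !mul0r !mul1r add0r !addr0 scale1r; congr (q _); calg A.
rewrite (le_trans (sn_CS P _ _))// mulrC -mulrA {1}/sn oneE ler_wpM2l ?sqrtr_ge0//.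
by rewrite (le_trans (act_sn U _ _))// mulrC {1}/sn pE.
Qed.

(** Let Omega be the cyclic vector of q. As w is close to q(. b) and w(a) to 1, q(ab) is close to 1
    while |ab Omega| is at most 1 + e. Hence ab Omega is close to Omega, and q(y) to q(yab), that is
    to w(ya). *)
Lemma dominated_near w q a (t e : R) y : dpositive q -> dle q 1 -> dominated w q ->
  nm a <= 1 -> w a = t%:C -> 1 - e < t -> 0 < e -> e <= 1 ->
  cm (q y - w (y *c a)) <= (Num.sqrt (7 * e) + e) * nm y.
Proof.
move=> q0 q1 wq a1 wa te e0 e1; have [v [v1 vw]] := dominated_approx wq e0.
set b := cadj v in vw.
have qb : sq (formL q) (a *c b) <= (1 + e) ^+ 2.
  apply: (@le_trans _ _ (sq (formL q) b)).
    have h := act_contr (formL_action q0) a b; rewrite (le_trans h)//.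
    rewrite ler_piMl ?exprn_ile1 ?nm_ge0//; exact: sq_ge0 (formL_psd q0) _.
  rewrite -formR_adj -sn_sqr; [|exact: formR_psd].
  by rewrite ler_sqr ?nnegrE ?sn_ge0// addr_ge0// ltW.
have qab : 1 - e - e <= complex.Re (q (a *c b)).
  have h1 := vw a; have h2 := sn_formR_le a q0 q1.
  have h3 := Re_le_cm (w a - q (a *c b)); rewrite ReB {1}wa /= in h3.
  have h4 := ler_wpM2l (ltW e0) (le_trans h2 a1); lra.
have [_ /(_ y) h1] := dpos_dist (a *c b) q0 ler01 q1; move: h1.
set d := 1 - 2 * _ + _ => h1.
(* 1 - 2 (1 - 2e) + (1 + e)^2 = 6e + e^2 <= 7e. *)
have h2 : Num.sqrt d <= Num.sqrt (7 * e).
  rewrite ler_wsqrtr// /d; move: qb; rewrite /sq /formL => qb.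
  have : e ^+ 2 <= e by rewrite expr2 ler_piMr// ltW.
  by rewrite sqrrD in qb; move: qb qab; lra.
have h3 : cm (w (y *c a) - q (y *c a *c b)) <= e * nm y.
  rewrite (le_trans (vw _))// ler_wpM2l ?(ltW e0)//.
  rewrite (le_trans (sn_formR_le _ q0 q1))// (le_trans (nm_cmul _ _))//.
  by rewrite ler_piMr ?nm_ge0.
rewrite (le_trans (cm_triangle _ (q (y *c (a *c b))) _))// mulrDl lerD//.
  by rewrite (le_trans h1)// sqrtr1 mul1r ler_wpM2r ?nm_ge0.
by rewrite cmulA cmB.
Qed.

(** Both functionals are close to w(. a), for a nearly norming [a] chosen from w alone. *)
Lemma dominated_uniq w q q' : dnorm w = 1 -> dpositive q -> dle q 1 -> dominated w q ->
  dpositive q' -> dle q' 1 -> dominated w q' -> q = q'.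
Proof.
move=> w1 q0 q1 wq q0' q1' wq'; apply: dual_ext_eq => y.
apply/eqP; rewrite -subr_eq0; apply/eqP/cm_le0.
apply: (@le_eps1 _ _ _ (8 * nm y)) => [|d d0 d1]; first by rewrite mulr_ge0 ?nm_ge0.
(* The choice e = d^2 absorbs the square root: each functional contributes at most 4d, hence the
   8. *)
have e0 : 0 < d ^+ 2 by rewrite exprn_gt0.
have e1 : d ^+ 2 <= 1 by rewrite exprn_ile1// ltW.
have [a [a1 [t + wa]]] := dnorm_approx w e0; rewrite w1 => te.
have h1 := dominated_near y q0 q1 wq a1 wa te e0 e1.
have h2 := dominated_near y q0' q1' wq' a1 wa te e0 e1.
have h3 : Num.sqrt (7 * d ^+ 2) + d ^+ 2 <= 4 * d.
  have s3 : Num.sqrt (7 * d ^+ 2) <= 3 * d.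
    rewrite -[leRHS]ger0_norm ?mulr_ge0 ?(ltW d0)// -sqrtr_sqr ler_wsqrtr//.
    by rewrite exprMn ler_wpM2r ?(ltW e0)//; lra.
  have : d ^+ 2 <= d by rewrite expr2 ler_piMr ?(ltW d0).
  by lra.
have h4 := ler_wpM2r (nm_ge0 y) h3.
have h5 := cm_triangle (q y) (w (y *c a)) (q' y); rewrite (cmB (w _) (q' y)) in h5.
by rewrite add0r; move: h1 h2 h4 h5; lra.
Qed.

End AbsUnique.

Lemma madj_membed (R : realType) (A : cstarAlgebra R) (a : A) :
  madj (membed a) = membed (cadj a).
Proof. by apply: multiplier_eq => b /=; rewrite cadjM cadjK. Qed.

Lemma madj_msub (R : realType) (A : cstarAlgebra R) (m n : multiplier A) :
  madj (msub m n) = msub (madj m) (madj n).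
Proof. by apply: multiplier_eq => b /=; calg A. Qed.

(** As y is in the algebra, so are all terms of the square except m^* m; a strict extension then
    splits into one genuine extension and ordinary values. *)
Lemma msub_membed_sqr (R : realType) (A : cstarAlgebra R) (m : multiplier A) (y : A) :
  mmul (madj (msub m (membed y))) (msub m (membed y)) = madd (mmul (madj m) m)
    (membed (cadj y *c y - mleft (madj m) y - cadj (mleft (madj m) y))).
Proof.
have pE : cadj (mleft (madj m) y) = mright m (cadj y) by rewrite /= cadjK.
rewrite madj_msub madj_membed pE; move: (madj m) => m' {pE}.
apply: multiplier_eq => a /=.
  rewrite mleftD mleftZ !cmulBl -mleftM -mcentral.
  set x1 := mleft _ (mleft _ _); set x2 := mleft _ (y *c a); set x3 := mleft _ a.
  by clearbody x1 x2 x3; calg A.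
rewrite mrightD mrightZ !cmulBr -mrightM mcentral.
set x1 := mright _ (mright _ _); set x2 := mright _ (a *c _); set x3 := mright _ a.
by clearbody x1 x2 x3; calg A.
Qed.

(** * Idempotency of the absolute value and slices by an idempotent *)

Section Core.
Variables (R : realType) (G : lcqg R).
Let A := C0 G.
Let T := C0xC0 G.
Let t := @ctens R G.
Let D := @comult R G.
Let tP : spatial_tensor t := @ctensP R G.
Let Arep : representable A := @C0_rep R G.
Let Trep : representable T := @C0xC0_rep R G.
Implicit Types (f g s : dual A) (a b c d x y : A).

(** The squared distance of Delta(b) to y for s (x) s, needed for y = b (x) v and for y = b (x)
    b. *)
Lemma conv_defect s b (y : T) : dpositive s ->
  dual_ext (dual_tensor t s s)
    (mmul (madj (msub (D b) (membed y))) (msub (D b) (membed y))) =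
  conv s s (cadj b *c b) - dual_tensor t s s (mleft (D (cadj b)) y)
  - (dual_tensor t s s (mleft (D (cadj b)) y))^* + dual_tensor t s s (cadj y *c y).
Proof.
move=> s0; set S := dual_tensor t s s; have S0 : dpositive S by exact: dual_tensor_pos.
have sd := bidominated_pos Arep s0; have [s' SS] := dominated_self Trep S0.
rewrite msub_membed_sqr -comult_adj -comultM.
rewrite (dual_ext_madd Trep SS (nm_ge0 _) (comult_bound _) (nm_ge0 _) (mbound_membed _)).
rewrite (dual_ext_membed Trep SS) -convE// !dualB (dpos_herm Trep _ S0) -/S; ring.
Qed.

Variables (w r : dual A).
Hypothesis (r0 : dpositive r) (r1 : dle r 1) (wr : dominated w r) (wd : bidominated w).
Hypothesis wid : idempotent_functional w.
Let rd : bidominated r := bidominated_pos Arep r0.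

Lemma conv_idem : conv w w = w.
Proof.
have [_ ww] := wid; apply: dual_ext_eq => a; rewrite -[RHS]ww /convolution.
exact: convE.
Qed.

(** The norm is submultiplicative for convolution. *)
Lemma idem_dnorm_ge1 f : bidominated f -> conv f f = f -> (exists a, f a != 0) ->
  1 <= dnorm f.
Proof.
move=> fd ff [a fa].
have n0 : 0 < dnorm f.
  rewrite lt0r dnorm_ge0 andbT; apply: contra_neq fa => n0; apply: cm_le0.
  by rewrite (le_trans (@dnorm_dle _ _ f a))// n0 mul0r.
have : dnorm f <= dnorm f * dnorm f.
  apply: dnorm_le; first by rewrite mulr_ge0 ?dnorm_ge0.
  rewrite -{1}ff; apply: dle_conv => //; try exact: dnorm_ge0; exact: dnorm_dle.
by rewrite -{1}[dnorm f]mulr1 ler_pM2l.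
Qed.

Lemma idem_dnorm : dnorm w = 1.
Proof.
apply/eqP; rewrite eq_le; apply/andP; split; last first.
  by apply: idem_dnorm_ge1 => //; [exact: conv_idem|case: wid].
apply: dnorm_le => // z; rewrite mul1r; have [_ h] := wr.
exact: le_trans (h z) (sn_formR_le _ r0 r1).
Qed.

Lemma conv_abs_idem : conv r r = r.
Proof.
apply: (dominated_uniq Arep idem_dnorm) => //; first exact: conv_pos.
  by rewrite -[1]mulr1; exact: dle_conv.
by rewrite -{1}conv_idem; exact: conv_dominated.
Qed.

Lemma abs_neq0 : exists a, r a != 0.
Proof.
have [[a wa] _] := wid; exists (a *c cadj a); apply: contra_neq wa => ra.
by apply: cm_le0; have [_ h] := wr; rewrite (le_trans (h a))// /sn /sq /formR ra sqrtr0.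
Qed.

Lemma abs_idempotent_state : idempotent_state r.
Proof.
split; first split; first exact: abs_neq0.
  by move=> a; rewrite -[RHS](congr1 (fun f : dual A => f a) conv_abs_idem) convE.
split=> //; apply/eqP; rewrite eq_le (dnorm_le _ r1)//=.
exact: idem_dnorm_ge1 conv_abs_idem abs_neq0.
Qed.

(** The cross term (r (x) r)(Delta(b)(b^* (x) v)) is a convolution of r(. b^* ) with r(. v), close
    to that with w, which the hypothesis on b evaluates to r(b b^* ). As r(v^* v) is at most about
    1, the squared defect is at most about r(b b^* )(1 - 2 + 1). *)
Lemma conv_dactr_slice b c d : (forall f, bidominated f -> conv f w b = f b) ->
  conv (dactr r c) (dactr r d) (cadj b) = r (c *c cadj b) * w d.
Proof.
move=> bw; apply/eqP; rewrite -subr_eq0; apply/eqP/cm_le0.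
set N := nm b; have N0 : 0 <= N by exact: nm_ge0.
set s := dual_tensor t r r; have s0 : dpositive s by exact: dual_tensor_pos.
have sF := formR_psd s0.
set X := sn (formR s) (t c d); have X0 : 0 <= X by exact: sn_ge0.
set Q := cm (r (c *c cadj b)) * nm d.
apply: (@le_eps1 _ _ _ (X * (3 * N) + Q)) => [|e e0 e1]; rewrite ?add0r.
  by rewrite !addr_ge0 ?mulr_ge0 ?cm_ge0 ?nm_ge0.
(* An approximation to within e^2 gives a squared defect of order e^2, hence a defect of order e. *)
have d0 : 0 < e ^+ 2 by rewrite exprn_gt0.
have [v' [v1 vw]] := dominated_approx wr d0; set v := cadj v' in vw.
have rb : 0 <= complex.Re (r (b *c cadj b)).
  by apply: Re_ge0; rewrite -{1}(cadjK b); exact: r0.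
have rbN : complex.Re (r (b *c cadj b)) <= N ^+ 2.
  rewrite -[complex.Re _]/(sq (formR r) b) -(sn_sqr (formR_psd r0)).
  rewrite ler_sqr ?nnegrE ?sn_ge0//; exact: sn_formR_le.
have rv : complex.Re (r (cadj v *c v)) <= (1 + e ^+ 2) ^+ 2.
  rewrite /v cadjK -[complex.Re _]/(sq (formR r) v') -(sn_sqr (formR_psd r0)).
  by rewrite ler_sqr ?nnegrE ?sn_ge0// addr_ge0 ?(ltW d0).
have vwn : dle (dsub (dactl v r) w) (e ^+ 2).
  move=> y /=; rewrite cmB (le_trans (vw _))// ler_wpM2l ?(ltW d0)//.
  exact: sn_formR_le.
pose m := msub (D (cadj b)) (membed (t (cadj b) v)).
have mM : mbound m (nm (cadj b) + cm (-1) * nm (t (cadj b) v)).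
  by apply: mbound_madd; [exact: comult_bound|apply: mbound_mscale; exact: mbound_membed].
have M0 : 0 <= nm (cadj b) + cm (-1) * nm (t (cadj b) v).
  by rewrite addr_ge0 ?mulr_ge0 ?cm_ge0 ?nm_ge0.
have defect : complex.Re (dual_ext s (mmul (madj m) m)) <= 9 * e ^+ 2 * N ^+ 2.
  rewrite conv_defect// cadjK conv_abs_idem (tens_adj tP) (tensM tP) cadjK (dual_tensorE tP).
  rewrite -(conv_dactl _ _ _ rd rd).
  set p := conv _ _ b.
  have pE : cm (p - r (b *c cadj b)) <= N * e ^+ 2 * N.
    have <- : conv (dactl (cadj b) r) w b = r (b *c cadj b).
      by rewrite bw//; exact: bidominated_dactl.
    apply: conv_close => //; try exact: bidominated_dactl; rewrite ?(ltW d0)// => y /=.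
    rewrite (le_trans (r1 _))// mul1r (le_trans (nm_cmul _ _))// nm_cadj mulrC//.
  have rbE : r (b *c cadj b) = (complex.Re (r (b *c cadj b)))%:C.
    by apply: ge0_Re; rewrite -{1}(cadjK b); exact: r0.
  have rvE : r (cadj v *c v) = (complex.Re (r (cadj v *c v)))%:C by apply: ge0_Re; exact: r0.
  rewrite rbE in pE *; rewrite rvE -rcM !(ReD, ReN) ReJ /=.
  have h1 := Re_le_cm (- (p - (complex.Re (r (b *c cadj b)))%:C)).
  rewrite cmN ReN ReB /= in h1.
  set rho := complex.Re (r (b *c cadj b)) in rb rbN pE h1 *.
  set kap := complex.Re (r (cadj v *c v)) in rv *.
  have h2 := ler_wpM2l rb rv.
  have h3 : (1 + e ^+ 2) ^+ 2 <= 1 + 3 * e ^+ 2.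
    have : e ^+ 2 * e ^+ 2 <= e ^+ 2 by rewrite ler_piMr ?(ltW d0)// exprn_ile1// ltW.
    by rewrite sqrrD; lra.
  have h4 := ler_wpM2l rb h3.
  have h5 := ler_wpM2r (ltW d0) rbN.
  have h6 : N * e ^+ 2 * N = N ^+ 2 * e ^+ 2 by ring.
  have h7 : 0 <= N ^+ 2 * e ^+ 2 by rewrite mulr_ge0 ?sqr_ge0.
  lra.
have ext := dual_ext_CS Trep (t c d) s0 M0 mM.
have h1 : cm (s (mright m (t c d))) <= X * (3 * N) * e.
  have q0 : 0 <= X * (3 * N) * e by rewrite !mulr_ge0 ?(ltW e0).
  apply: cm_le_sqr => //; rewrite (le_trans ext)// -(sn_sqr sF) -/X.
  by rewrite (le_trans (ler_wpM2l (sqr_ge0 X) defect))// le_eqVlt; apply/orP; left; apply/eqP; ring.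
have h2 : s (mright m (t c d)) =
    conv (dactr r c) (dactr r d) (cadj b) - r (c *c cadj b) * r (d *c v).
  rewrite (conv_dactr _ _ _ rd rd) -(dual_tensorE tP) -(tensM tP) -/s -dualB.
  by rewrite /m /= scaleN1r.
have h3 : cm (r (d *c v) - w d) <= e * nm d.
  by have := vwn d => /= h; rewrite (le_trans h)// ler_wpM2r ?nm_ge0// expr2 ler_piMr ?(ltW e0).
rewrite (le_trans (cm_triangle _ (r (c *c cadj b) * r (d *c v)) _))// mulrDl lerD//.
  by rewrite -h2.
by rewrite -mulrBr cmM /Q mulrAC -mulrA ler_wpM2l ?cm_ge0.
Qed.

(** Applied to all slices, the product formula reads r.c * (r.d * w^* ) = w(d) (r.c * w^* ) for
    every c. Cancellation upgrades it to r (x) (r.d * w^* ) = w(d) r (x) w^*, from which the nonzero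
    r is removed. *)
Lemma abs_slice x b d : conv_slice (dadj w) x b -> r (d *c b) = w d * dadj w x.
Proof.
have wd' := bidominated_dadj wd; have rr' := dadj_pos Arep r0.
(* The adjoint of b' is a slice by w, so w * w = w makes it invariant under convolution by w, as
   [conv_dactr_slice] requires. *)
have slice_act y c b' : conv_slice (dadj w) y b' ->
    conv (dactr r c) (dactr r d) b' = r (c *c b') * w d.
  move=> yb; have := conv_slice_adj wd' yb; rewrite dadjK => bw.
  rewrite -{1 2}(cadjK b') conv_dactr_slice// => f fd.
  have fwd := conv_bidominated fd wd.
  by rewrite (bw _ fwd) conv_assoc// conv_idem -(bw _ fd).
have key y c : conv (dactr r c) (conv (dactr r d) (dadj w)) y =
    w d * conv (dactr r c) (dadj w) y.
  have [b' yb] := conv_slice_exists y wd'.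
  have cd := bidominated_dactr c rd; have dd := bidominated_dactr d rd.
  rewrite -conv_assoc// -(yb _ (conv_bidominated cd dd)) -(yb _ cd) (slice_act y)//.
  exact: mulrC.
(* The cancellation law has c to the right of Delta(y), [key] has it to the left; r being hermitian,
   adjoints exchange the two. *)
have hE : dual_tensor t r (dadj (conv (dactr r d) (dadj w))) =
    dscale (w d)^* (dual_tensor t r w).
  have [_ span _ _] := @comult_cancellation R G.
  apply: (dual_span_eq span) => z [y [c yz]].
  have hd := conv_bidominated (bidominated_dactr d rd) wd'.
  rewrite -(conv_lcancel rd (bidominated_dadj hd) yz) /= -(conv_lcancel rd wd yz).
  have := key (cadj y) (cadj c) => /(congr1 (fun z : R[i] => z^*)).
  have cd := bidominated_dactr (cadj c) rd.
  have conjE g : bidominated g -> conv (dactl c r) (dadj g) y =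
      (conv (dactr r (cadj c)) g (cadj y))^*.
    by move=> gd; rewrite -{1}rr' -{1}(cadjK c) -dadj_dactr conv_dadj.
  by rewrite -conjE// => ->; rewrite conjM -conjE// dadjK.
move=> xb; have dd := bidominated_dactr d rd; rewrite -[LHS]/(dactr r d b) xb//.
have [a ra] := abs_neq0.
have := congr1 (fun f : dual T => f (t a (cadj x))) hE.
rewrite /= !(dual_tensorE tP) /= cadjK mulrCA => /(mulfI ra).
by move=> /(congr1 (fun z : R[i] => z^*)); rewrite conjM !conjCK.
Qed.

Lemma abs_null b : (forall d, r (d *c b) = w d) ->
  null_space (dual_tensor t r r) (msub (D b) (membed (t b b))).
Proof.
move=> bw; have wE : dactl b r = w by apply: dual_ext_eq.
have kE := ge0_Re (r0 b); set k := complex.Re _ in kE.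
have k0 : 0 <= k by apply: Re_ge0; exact: r0.
(* As w = r(. b), domination at b^* gives k <= sqrt k, and |w| = 1 gives 1 <= sqrt k by
   Cauchy-Schwarz. *)
have k1 : k = 1.
  have h1 : k <= Num.sqrt k.
    have [_ /(_ (cadj b))] := wr; rewrite -bw kE cm_real ger0_norm// => h.
    by rewrite (le_trans h)// /sn formR_adj cadjK /sq /formL kE.
  have h2 : 1 <= Num.sqrt k.
    rewrite -idem_dnorm; apply: dnorm_le; first exact: sqrtr_ge0.
    move=> y; rewrite -wE /=; have := sn_CS (formR_psd r0) y (cadj b).
    rewrite /formR cadjK => /le_trans; apply; rewrite mulrC ler_pM ?sn_ge0//.
      by rewrite /sn formR_adj cadjK /sq /formL kE.
    exact: sn_formR_le.
  have h3 : k = Num.sqrt k ^+ 2 by rewrite sqr_sqrtr.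
  have h4 : Num.sqrt k <= 1.
    by rewrite {1}h3 expr2 ger_pMr// (lt_le_trans ltr01 h2) in h1.
  by rewrite h3 (_ : Num.sqrt k = 1) ?expr1n//; apply/eqP; rewrite eq_le h4.
rewrite /null_space /= conv_defect// conv_abs_idem (tens_adj tP) (tensM tP).
rewrite -(conv_dactl _ _ _ rd rd) wE conv_idem (dual_tensorE tP) -bw kE k1.
by rewrite conjR; ring.
Qed.

End Core.

Lemma sqrtrD_le (R : realType) (x y : R) : 0 <= x -> 0 <= y ->
  Num.sqrt (x + y) <= Num.sqrt x + Num.sqrt y.
Proof.
move=> x0 y0; rewrite -ler_sqr ?nnegrE ?addr_ge0 ?sqrtr_ge0// sqrrD !sqr_sqrtr ?addr_ge0//.
by have := mulr_ge0 (sqrtr_ge0 x) (sqrtr_ge0 y); lra.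
Qed.

(** * Polar decompositions *)

Section Lact.
Variables (R : realType) (A : cstarAlgebra R).
Implicit Types (f g w r : dual A) (a b c x y : A) (u : bidual A) (K e : R).

Lemma bidualB u f g : u (dsub f g) = u f - u g.
Proof.
rewrite (@bidual_linear _ _ u (-1) g f (dsub f g)) ?mulN1r; first exact: addrC.
by move=> a /=; rewrite mulN1r addrC.
Qed.

Lemma bidual_le u : exists2 C : R, 0 <= C &
  forall f K, 0 <= K -> dle f K -> cm (u f) <= C * K.
Proof.
have [C C0 uC] := bidual_bounded u; exists (complex.Re C); first exact: Re_ge0.
move=> f K K0 fK; rewrite -lecR -cmE rcM -(ge0_Re C0); apply: uC; first by rewrite lecR.
by move=> a; have := fK a; rewrite -lecR rcM -cmE -nmE.
Qed.

Lemma bidual_close u : exists2 C : R, 0 <= C &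
  forall f g K, 0 <= K -> dle (dsub f g) K -> cm (u f - u g) <= C * K.
Proof.
have [C C0 uC] := bidual_le u; exists C => // f g K K0 fg.
by rewrite -bidualB; exact: uC.
Qed.

Lemma sn_formR_adj r x : sn (formR r) x = sn (formL r) (cadj x).
Proof. by rewrite /sn formR_adj. Qed.

Lemma sn_formL_bound r K x : dpositive r -> 0 <= K -> dle r K ->
  sn (formL r) x <= Num.sqrt K * nm x.
Proof.
move=> r0 K0 rK; rewrite -[nm x]ger0_norm ?nm_ge0// -sqrtr_sqr -sqrtrM// /sn ler_wsqrtr//.
exact: formL_bound.
Qed.

Lemma sn_formR_bound r K x : dpositive r -> 0 <= K -> dle r K ->
  sn (formR r) x <= Num.sqrt K * nm x.
Proof. by move=> *; rewrite sn_formR_adj -[nm x]nm_cadj; exact: sn_formL_bound. Qed.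

Hypothesis Arep : representable A.

Section Fixed.
Variables (u : bidual A) (r : dual A) (rho : R).
Hypothesis (r0 : dpositive r) (rho0 : 0 <= rho) (rr : dle r rho).
Hypothesis uur : badj u (lact u r) = rho%:C.
Let w := lact u r.
Let F := formR_psd r0.
Let L := formL_psd r0.

(** In GNS terms v Omega approaches u Omega, with Omega the cyclic vector of r, and [uur] says that
    |u Omega|^2 = rho. Boundedness of u on the dual supplies the hypothesis of [riesz_approx]. *)
Lemma lact_approx : exists2 C : R, 0 <= C & forall e, 0 < e -> e <= 1 -> exists v,
  [/\ forall x, cm (w x - r (x *c v)) <= e * sn (formR r) x,
      cm (r (cadj v *c v) - rho%:C) <= C * e & sn (formL r) v <= C].
Proof.
have [C C0 uB] := bidual_le u; pose K := C * Num.sqrt rho.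
have K0 : 0 <= K by rewrite mulr_ge0 ?sqrtr_ge0.
have wK x : cm (w x) <= K * sn (formR r) x.
  rewrite -mulrA; apply: uB => [|b /=]; first by rewrite mulr_ge0 ?sqrtr_ge0 ?sn_ge0.
  have := sn_CS F x (cadj b); rewrite /formR cadjK => /le_trans; apply.
  rewrite mulrC mulrAC ler_wpM2r ?sn_ge0// -[nm b]nm_cadj.
  exact: sn_formR_bound.
exists (2 * K + 1) => [|e e0 e1]; first by lra.
have wlin (k : R[i]) x y : w (k *: x + y) = k * w x + w y by rewrite dual_linear.
have [v0 [v01 wv]] := riesz_approx F wlin K0 e0 wK; exists (cadj v0).
have v02 : sn (formR r) v0 <= K + 1 by lra.
split=> //; last by rewrite -sn_formR_adj; lra.
rewrite cadjK -[r _]/(formR r v0 v0).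
have h1 : cm (formR r v0 v0 - w v0) <= e * (K + 1).
  by rewrite cmB (le_trans (wv v0))// ler_wpM2l// ltW.
have h2 : cm (w v0 - rho%:C) <= e * K.
  have -> : rho%:C = u (dadj w) by rewrite -[RHS]conjCK -[(u _)^*]/(badj u w) uur conjR.
  rewrite mulrCA -bidualB; apply: uB => [|b /=]; first by rewrite mulr_ge0 ?sqrtr_ge0// ltW.
  rewrite -cmJ conjB -dpos_herm// conjCK cmB cadjM.
  have := wv (cadj b); rewrite /formR => /le_trans; apply.
  by rewrite -mulrA ler_wpM2l ?(ltW e0)// -[nm b]nm_cadj; exact: sn_formR_bound.
by rewrite (le_trans (cm_triangle _ (w v0) _))//; lra.
Qed.

(** d = |(g - u) Omega|^2, computed with v in place of u. *)
Lemma lact_dist (g : A) : let d := complex.Re (r (cadj g *c g)) - 2 * complex.Re (w (cadj g)) + rho in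
  0 <= d /\ forall x, cm (w x - r (x *c g)) <= sn (formR r) x * Num.sqrt d.
Proof.
move=> d; have [C C0 ap] := lact_approx.
pose M := C + 2 * sn (formR r) (cadj g).
have M0 : 0 <= M by rewrite addr_ge0 ?mulr_ge0 ?sn_ge0.
have near e (v : A) : (forall x, cm (w x - r (x *c v)) <= e * sn (formR r) x) ->
    cm (r (cadj v *c v) - rho%:C) <= C * e -> sq (formL r) (v - g) <= d + M * e.
  move=> h1 h2; rewrite (sqB L).
  have h3 := le_trans (Re_le_cm _) h2; rewrite ReB /= in h3.
  have h4 := le_trans (Re_le_cm _) (h1 (cadj g)); rewrite ReB in h4.
  by move: h3 h4; rewrite /sq /formL /M /d; lra.
have d0 : 0 <= d.
  apply: (@le_eps1 _ _ _ M) => // e e0 e1; have [v [h1 h2 _]] := ap e e0 e1.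
  exact: le_trans (sq_ge0 L _) (near _ _ h1 h2).
split=> // x; apply: (@le_eps1 _ _ _ (sn (formR r) x * (1 + Num.sqrt M))) => [|e e0 e1].
  by rewrite mulr_ge0 ?sn_ge0// addr_ge0 ?sqrtr_ge0.
have e20 : 0 < e ^+ 2 by rewrite exprn_gt0.
have e21 : e ^+ 2 <= e by rewrite expr2 ler_piMr ?(ltW e0).
have [v [h1 h2 _]] := ap _ e20 (le_trans e21 e1).
rewrite (le_trans (cm_triangle _ (r (x *c v)) _))//.
have h3 : cm (r (x *c v) - r (x *c g)) <= sn (formR r) x * (Num.sqrt d + Num.sqrt M * e).
  rewrite -dualB -cmulBr; have := sn_CS F x (cadj (v - g)).
  rewrite /formR cadjK => /le_trans; apply; rewrite ler_wpM2l ?sn_ge0//.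
  rewrite sn_formR_adj cadjK /sn.
  have Me : 0 <= M * e ^+ 2 by rewrite mulr_ge0 // ltW.
  rewrite (le_trans (ler_wsqrtr (near _ _ h1 h2)))// (le_trans (sqrtrD_le d0 Me))//.
  by rewrite lerD2l sqrtrM// sqrtr_sqr ger0_norm// ltW.
have h4 := ler_wpM2r (sn_ge0 (formR r) x) e21; have := h1 x; lra.
Qed.

(** The case g = 0 of [lact_dist], where d = rho. *)
Lemma lact_le x : cm (w x) <= Num.sqrt rho * sn (formR r) x.
Proof.
have [_ /(_ x)] := lact_dist 0.
have c0 : cadj 0 = 0 :> A by calg A.
by rewrite c0 !cmulr0 !dualw0 /= mulr0 !subr0 add0r mulrC.
Qed.

Let l := left_abs u r.

(** l(a) = <a u Omega, u Omega>, so v may replace both occurrences of u: one inside the argument of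
    u, the other in w itself. *)
Lemma left_abs_approx : exists2 C : R, 0 <= C & forall e, 0 < e -> e <= 1 -> exists v,
  [/\ forall x, cm (w x - r (x *c v)) <= e * sn (formR r) x,
      cm (r (cadj v *c v) - rho%:C) <= C * e,
      sn (formL r) v <= C
    & forall a, cm (l a - r (cadj v *c a *c v)) <= C * e * nm a].
Proof.
have [C C0 ap] := lact_approx; have [D D0 uD] := bidual_close u.
pose S := Num.sqrt rho; have S0 : 0 <= S by exact: sqrtr_ge0.
exists (C + D * S) => [|e e0 e1]; first by rewrite addr_ge0 ?mulr_ge0.
have e0' := ltW e0; have DS := mulr_ge0 D0 S0.
have [v [h1 h2 h3]] := ap e e0 e1; exists v; split=> // [||a].
- by rewrite (le_trans h2)// ler_wpM2r// lerDl.
- by rewrite (le_trans h3)// lerDl.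
have -> : l a = (u (dadj (dactl a w)))^* by [].
have -> : r (cadj v *c a *c v) = (r (cadj v *c cadj a *c v))^*.
  by rewrite -dpos_herm//; congr (r _); calg A.
rewrite -conjB cmJ (le_trans (cm_triangle _ (w (cadj v *c cadj a)) _))//.
have k1 : cm (u (dadj (dactl a w)) - w (cadj v *c cadj a)) <= D * (e * S * nm a).
  apply: uD => [|b /=]; first by rewrite !mulr_ge0 ?nm_ge0.
  have -> : r (cadj v *c cadj a *c b) = (r (cadj b *c a *c v))^*.
    by rewrite -dpos_herm//; congr (r _); calg A.
  rewrite -conjB cmJ (le_trans (h1 _))// -!mulrA ler_wpM2l//.
  rewrite (le_trans (sn_formR_bound _ r0 rho0 rr))// ler_wpM2l//.
  by rewrite (le_trans (nm_cmul _ _))// nm_cadj mulrC.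
have k2 : cm (w (cadj v *c cadj a) - r (cadj v *c cadj a *c v)) <= e * (nm a * C).
  rewrite (le_trans (h1 _))// ler_wpM2l// sn_formR_adj.
  have -> : cadj (cadj v *c cadj a) = a *c v by calg A.
  by rewrite (le_trans (act_sn (formL_action r0) _ _))// ler_wpM2l ?nm_ge0.
by move: k1 k2; lra.
Qed.

Lemma left_abs_pos : dpositive l.
Proof.
move=> a; have [C C0 ap] := left_abs_approx.
apply: ge0_approx => e e0; pose M := C * nm (cadj a *c a) + 1.
have M0 : 0 < M by rewrite ltr_wpDl// mulr_ge0 ?nm_ge0.
pose d := Num.min 1 (e / M).
have d0 : 0 < d by rewrite lt_min ltr01 divr_gt0.
have [v [_ _ _ h]] := ap d d0 ltac:(by rewrite ge_min lexx).
exists (r (cadj v *c (cadj a *c a) *c v)).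
  have -> : cadj v *c (cadj a *c a) *c v = cadj (a *c v) *c (a *c v) by calg A.
  exact: r0.
rewrite cmB (le_trans (h _))// mulrAC (@le_trans _ _ (M * d))//.
  by rewrite ler_wpM2r ?(ltW d0)// lerDl.
by rewrite mulrC -ler_pdivlMr// ge_min lexx orbT.
Qed.

Lemma left_abs_le : dle l rho.
Proof.
move=> a; have [C C0 ap] := left_abs_approx.
apply: (@le_eps1 _ _ _ (2 * C * nm a)) => [|e e0 e1]; first by rewrite !mulr_ge0 ?nm_ge0.
have [v [_ h1 _ h2]] := ap e e0 e1.
have h3 : cm (r (cadj v *c a *c v)) <= nm a * (rho + C * e).
  have := sn_CS L (a *c v) v; rewrite /formL cmulA => /le_trans; apply.
  apply: (@le_trans _ _ (nm a * sn (formL r) v * sn (formL r) v)).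
    by rewrite ler_wpM2r ?sn_ge0//; exact: act_sn (formL_action r0) _ _.
  rewrite -mulrA ler_wpM2l ?nm_ge0// -expr2 (sn_sqr L).
  by have := le_trans (Re_le_cm _) h1; rewrite ReB /sq /formL /=; lra.
have h4 := cm_triangle (l a) (r (cadj v *c a *c v)) 0; rewrite !subr0 in h4.
by have := h2 a; move: h3 h4; lra.
Qed.

End Fixed.
End Lact.

(** * Supports and the norm of the absolute values *)

Section Support.
Variables (R : realType) (A : cstarAlgebra R).
Hypothesis Arep : representable A.
Implicit Types (f g w r : dual A) (a b c x y : A) (u p : bidual A) (e : R).

Lemma dnorm_unit r e : dpositive r -> 0 < e ->
  exists a, nm a <= 1 /\ forall x, cm (r x - r (x *c a)) <= e * nm x.
Proof.
move=> r0 e0; set rho := dnorm r; have rho0 : 0 <= rho by exact: dnorm_ge0.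
have rr := @dnorm_dle _ _ r; rewrite -/rho in rr.
pose d := e ^+ 2 / (2 * rho + 1).
have rho1 : 0 < 2 * rho + 1 by lra.
have d0 : 0 < d by rewrite divr_gt0 ?exprn_gt0.
have [a [a1 [t tr ra]]] := dnorm_approx r d0; exists a; split=> // x.
have [k0 /(_ x) h] := dpos_dist Arep a r0 rho0 rr; rewrite (le_trans h)//.
rewrite ler_wpM2r ?nm_ge0// -sqrtrM// -[leRHS]ger0_norm ?(ltW e0)// -sqrtr_sqr ler_wsqrtr//.
have := formL_bound a r0 rho0 rr; rewrite /sq /formL => ha.
have a2 : nm a ^+ 2 <= 1 by rewrite exprn_ile1 ?nm_ge0.
have h2 := ler_wpM2l rho0 a2.
rewrite ra /=; rewrite -/rho in tr.
apply: (@le_trans _ _ (rho * (2 * d))); first by rewrite ler_wpM2l//; lra.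
have dE : d * (2 * rho + 1) = e ^+ 2 by rewrite /d divfK// gt_eqF.
by rewrite -dE; lra.
Qed.

(** p Omega = Omega because <p Omega, Omega> = |Omega|^2. On functionals, [lact_dist] is applied
    with p in place of u and with an element nearly fixing Omega, for which d is small. *)
Lemma support_dactr p r c : dpositive r -> is_projection p -> p r = (dnorm r)%:C ->
  p (dactr r c) = r c.
Proof.
move=> r0 [pp pa] pr; have rho0 := dnorm_ge0 r; have rr := @dnorm_dle _ _ r.
have ppr : badj p (lact p r) = (dnorm r)%:C by rewrite pa -[p (lact p r)]/(bmul p p r) pp.
have [D D0 pD] := bidual_close p.
apply/eqP; rewrite -subr_eq0; apply/eqP/cm_le0.
apply: (@le_eps1 _ _ _ (sn (formR r) c * Num.sqrt (2 * D) + nm c)) => [|e e0 e1].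
  by rewrite !addr_ge0 ?mulr_ge0 ?sn_ge0 ?nm_ge0 ?sqrtr_ge0.
rewrite add0r; have d0 : 0 < e ^+ 2 by rewrite exprn_gt0.
have [a [a1 ra]] := dnorm_unit r0 d0.
have [_ /(_ c)] := lact_dist Arep r0 rho0 rr ppr a; set d := _ + dnorm r => h1.
have h2 : d <= 2 * D * e ^+ 2.
  have k1 : cm (p (dactr r (cadj a)) - p r) <= D * e ^+ 2.
    apply: pD => [|b /=]; first exact: ltW.
    have -> : r (cadj a *c b) - r b = - (r (cadj b) - r (cadj b *c a))^*.
      rewrite conjB -!dpos_herm// cadjK opprB; congr (r _ - _); calg A.
    by rewrite cmN cmJ (le_trans (ra _))// nm_cadj.
  rewrite pr cmB in k1; have k2 := le_trans (Re_le_cm _) k1; rewrite ReB /= in k2.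
  have := formL_bound a r0 rho0 rr; rewrite /sq /formL => k3.
  have a2 : nm a ^+ 2 <= 1 by rewrite exprn_ile1 ?nm_ge0.
  by have := ler_wpM2l rho0 a2; rewrite /d /=; lra.
have h3 : Num.sqrt d <= Num.sqrt (2 * D) * e.
  rewrite (le_trans (ler_wsqrtr h2))// sqrtrM ?mulr_ge0// sqrtr_sqr ger0_norm//; exact: ltW.
have h4 : cm (r (c *c a) - r c) <= e * nm c.
  by rewrite cmB (le_trans (ra c))// ler_wpM2r ?nm_ge0// expr2 ler_piMr// ltW.
rewrite (le_trans (cm_triangle _ (r (c *c a)) _))//.
have := ler_wpM2l (sn_ge0 (formR r) c) h3; lra.
Qed.

Lemma lact_dactr u r c : lact u (dactr r c) = dactr (lact u r) c.
Proof.
apply: dual_ext_eq => b /=; congr (u _).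
by apply: dual_ext_eq => a /=; rewrite cmulA.
Qed.

Section Fixed.
Variables (u : bidual A) (r : dual A).
Hypothesis (r0 : dpositive r) (ru : is_support r (bmul (badj u) u)).
Let rho := dnorm r.
Let w := lact u r.
Let l := left_abs u r.
Let rho0 : 0 <= rho := dnorm_ge0 r.
Let rr : dle r rho := @dnorm_dle _ _ r.

Lemma support_lact : badj u (lact u r) = rho%:C.
Proof. by have [_ h _] := ru. Qed.
Let uur := support_lact.
Let l0 := left_abs_pos Arep r0 rho0 rr uur.
Let lr := left_abs_le Arep r0 rho0 rr uur.

(** Replacing l by r(v^* . v) leads to u^* u evaluated at r.(v^* g), where the support acts as a
    unit; what remains is r(v^* g), close to w^* (g). *)
Lemma lact_left_abs : lact (badj u) l = dadj w.
Proof.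
have [C C0 ap] := left_abs_approx Arep r0 rho0 rr uur; have [D D0 uD] := bidual_close (badj u).
apply: dual_ext_eq => g; apply/eqP; rewrite -subr_eq0; apply/eqP/cm_le0.
rewrite -[dadj w g]/((w (cadj g))^*).
apply: (@le_eps1 _ _ _ (D * (2 * C * nm g) + sn (formR r) (cadj g))) => [|e e0 e1].
  by rewrite addr_ge0 ?sn_ge0// !mulr_ge0 ?nm_ge0.
rewrite add0r; have [v [h1 h2 h3 h4]] := ap e e0 e1.
have k1 : cm (badj u (dactr l g) - badj u (dactr w (cadj v *c g))) <= D * (2 * C * e * nm g).
  apply: uD => [|b]; first by rewrite !mulr_ge0 ?nm_ge0 ?(ltW e0).
  rewrite -[dsub _ _ b]/(l (g *c b) - w (cadj v *c g *c b)).
  rewrite (le_trans (cm_triangle _ (r (cadj v *c (g *c b) *c v)) _))//.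
  have j1 := h4 (g *c b); have j2 := h1 (cadj v *c g *c b); rewrite cmB in j2.
  have j3 : sn (formR r) (cadj v *c g *c b) <= nm (g *c b) * C.
    rewrite sn_formR_adj (_ : cadj _ = cadj (g *c b) *c v); last by calg A.
    rewrite (le_trans (act_sn (formL_action r0) _ _))// nm_cadj.
    by rewrite ler_wpM2l ?nm_ge0.
  have j4 := ler_wpM2l (ltW e0) j3.
  have j5 := ler_wpM2l (mulr_ge0 C0 (ltW e0)) (nm_cmul g b).
  rewrite (cmulA (cadj v)) in j1 *.
  by move: j1 j2 j4 j5; lra.
have k2 : badj u (dactr w (cadj v *c g)) = (r (cadj g *c v))^*.
  rewrite -lact_dactr -[badj u (lact u _)]/(bmul (badj u) u _).
  have [pj pr _] := ru; rewrite support_dactr// -dpos_herm//; congr (r _); calg A.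
rewrite (le_trans (cm_triangle _ (r (cadj g *c v))^* _))//.
rewrite k2 in k1; rewrite -(conjB (r _)) cmJ (cmB (r _)).
have := h1 (cadj g); rewrite -[lact (badj u) l g]/(badj u (dactr l g)); move: k1; lra.
Qed.

Let w' := dadj w.
(** This is [uur] for the pair (u^*, l): the bounds on w in terms of r then hold for w^* in terms of
    l. *)
Let uul : badj (badj u) (lact (badj u) l) = rho%:C.
Proof.
rewrite lact_left_abs -[LHS]/(((u (dadj (dadj w')))^*)^*) dadjK conjCK.
by rewrite -[LHS]conjCK -[(u _)^*]/(badj u w) uur conjR.
Qed.

(** d = |(g - u)^* u Omega|^2, since l(g g^* ) = |g^* u Omega|^2 and u^* u Omega = Omega. *)
Lemma lact_adj_dist (g : A) :
  let d := complex.Re (l (g *c cadj g)) - 2 * complex.Re (w (cadj g)) + rho in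
  0 <= d /\ forall x, cm (w (x *c cadj g) - r x) <= Num.sqrt rho * Num.sqrt d * nm x.
Proof.
move=> d; have [C C0 ap] := left_abs_approx Arep r0 rho0 rr uur.
pose M := C * nm (g *c cadj g) + 2 * sn (formR r) (cadj g).
have M0 : 0 <= M by rewrite addr_ge0 ?mulr_ge0 ?nm_ge0 ?sn_ge0.
have near e (v : A) : (forall x, cm (w x - r (x *c v)) <= e * sn (formR r) x) ->
    (forall a, cm (l a - r (cadj v *c a *c v)) <= C * e * nm a) ->
    rho - 2 * complex.Re (r (cadj g *c v)) + complex.Re (r (cadj (cadj g *c v) *c (cadj g *c v)))
      <= d + M * e.
  move=> h1 h2.
  have -> : cadj (cadj g *c v) *c (cadj g *c v) = cadj v *c (g *c cadj g) *c v by calg A.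
  have h3 := h2 (g *c cadj g); rewrite cmB in h3; have h4 := h1 (cadj g).
  have h5 := le_trans (Re_le_cm _) h3; rewrite ReB in h5.
  have h6 := le_trans (Re_le_cm _) h4; rewrite ReB in h6.
  by move: h5 h6; rewrite /M /d; lra.
have d0 : 0 <= d.
  apply: (@le_eps1 _ _ _ M) => // e e0 e1; have [v [h1 h2 h3 h4]] := ap e e0 e1.
  have [k0 _] := dpos_dist Arep (cadj g *c v) r0 rho0 rr.
  exact: le_trans k0 (near _ _ h1 h4).
split=> // x; set S := Num.sqrt rho; have S0 : 0 <= S by exact: sqrtr_ge0.
apply: (@le_eps1 _ _ _ (sn (formR r) (x *c cadj g) + S * Num.sqrt M * nm x)) => [|e e0 e1].
  by rewrite addr_ge0 ?sn_ge0// !mulr_ge0 ?nm_ge0 ?sqrtr_ge0.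
have e20 : 0 < e ^+ 2 by rewrite exprn_gt0.
have e21 : e ^+ 2 <= e by rewrite expr2 ler_piMr ?(ltW e0).
have [v [h1 h2 _ h3]] := ap _ e20 (le_trans e21 e1).
have [_ /(_ x) h4] := dpos_dist Arep (cadj g *c v) r0 rho0 rr.
have Me : 0 <= M * e ^+ 2 by rewrite mulr_ge0// ltW.
have h5 := le_trans (ler_wsqrtr (near _ _ h1 h3)) (sqrtrD_le d0 Me).
rewrite (sqrtrM _ M0) sqrtr_sqr ger0_norm ?(ltW e0)// in h5.
have h6 := ler_wpM2r (nm_ge0 x) (ler_wpM2l S0 h5).
have h7 := h1 (x *c cadj g); rewrite -cmulA in h7.
have h8 := ler_wpM2r (sn_ge0 (formR r) (x *c cadj g)) e21.
rewrite (le_trans (cm_triangle _ (r (x *c (cadj g *c v))) _))// (cmB _ (r x)).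
by move: h4 h6 h7 h8; rewrite -/S; lra.
Qed.

(* If (g - u)xi and (g - u)^*u xi are small, xi being the cyclic vector of r, then so is
   w(z^* - g^* ) for the contraction z = 2g(1 + g^*g)^-1, while w(g^* ) is close to rho. *)
Lemma contraction_near (g : A) (d : R) :
  complex.Re (r (cadj g *c g)) - 2 * complex.Re (w (cadj g)) + rho <= d ->
  complex.Re (l (g *c cadj g)) - 2 * complex.Re (w (cadj g)) + rho <= d ->
  complex.Re (w (cadj g)) <= dnorm w + 2 * Num.sqrt rho * Num.sqrt d.
Proof.
move=> d1 d2; have [H [pi Hpi]] := Arep; have hp := opos_cstar Hpi g.
have [m [msa hm hm']] := resolvent Hpi hp; set h := cadj g *c g in hp hm hm'.
have m1 := nm_resolvent Hpi hp hm.
(* g - gm = g (1 + h)^-1, and t / (1 + t^2) <= 1/2. *)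
have z1 : nm (g - g *c m) <= 2^-1.
  apply: (faithful_norm Hpi) => [|x]; first by rewrite invr_ge0.
  rewrite -[leLHS]ger0_norm ?nm_ge0// -[leRHS]ger0_norm ?mulr_ge0 ?invr_ge0 ?nm_ge0//.
  rewrite -!sqrtr_sqr ler_wsqrtr// exprMn.
  have ac := rep_action Hpi.1.
  rewrite -sq_ip /sq (actB ac) (actM ac) -(repBr Hpi.1) (act_adj ac) (psd_conj (@ip_psd R H)).
  rewrite ReJ -(actM ac) (le_trans (resolvent_quarter Hpi hm x))//.
  by rewrite mulrC ler_wpM2r ?sqr_ge0//; lra.
set y := cadj g - m *c cadj g.
have yE : cadj (g - g *c m) = y by rewrite /y; rewrite -{2}msa; calg A.
have y1 : nm y <= 2^-1 by rewrite -yE nm_cadj.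
have [_ /(_ y) e1] := lact_dist Arep r0 rho0 rr uur g.
have [_ /(_ m) e2] := lact_adj_dist g.
(* With y = (1 + h)^-1 g^*, both w(y) and w(m g^* ) are close to r(m). As they add up to w(g^* ),
   the latter is close to w(2y), and 2y is a contraction. *)
have yg : y *c g = m.
  have -> : y *c g = h - m *c h by rewrite /y /h; calg A.
  by rewrite {1}hm' addrK.
rewrite yg in e1.
have h1 := @dnorm_ub _ _ w (y + y) ltac:(by rewrite (le_trans (nmD _ _))//; lra).
have S0 := sqrtr_ge0 rho.
have h2 := sn_formR_bound y r0 rho0 rr.
have h3 : Num.sqrt rho * nm y <= Num.sqrt rho * 1 by rewrite ler_wpM2l//; lra.
set D1 := _ + rho in d1 e1; set D2 := _ + rho in d2 e2.
have h4 := ler_pM (sn_ge0 _ _) (sqrtr_ge0 D1) (le_trans h2 h3) (ler_wsqrtr d1).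
have h5 := ler_pM (mulr_ge0 S0 (sqrtr_ge0 D2)) (nm_ge0 m) (ler_wpM2l S0 (ler_wsqrtr d2)) m1.
rewrite cmB in e1; have k1 := le_trans (Re_le_cm _) e1.
have k2 := le_trans (Re_le_cm _) e2; have k3 := le_trans (Re_le_cm _) h1.
have k4 : w y = w (cadj g) - w (m *c cadj g) by rewrite -dualB.
rewrite dualD ReD in k3; rewrite ReB in k1; rewrite ReB in k2.
rewrite k4 ReB in k1 k3; lra.
Qed.

(** [contraction_near] needs g close to u in both senses at once. Hence the Riesz vector is taken
    for the sum of two semi-inner products and for 2 w^*, a problem whose exact solution would be u
    itself. *)
Lemma polar_norm_le : rho <= dnorm w.
Proof.
have [D D0 uD] := bidual_le u; have S0 := sqrtr_ge0 rho.
have P : psd (fun x y => formL r x y + formR l x y).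
  have F := formL_psd r0; have F' := formR_psd l0.
  split=> [k x y z|x y|x].
  - by rewrite (psd_linear F) (psd_linear F'); ring.
  - by rewrite rmorphD /= -(psd_conj F) -(psd_conj F').
  - by rewrite addr_ge0 ?(psd_ge0 F) ?(psd_ge0 F').
set B := fun _ => _ in P; pose K := 2 * Num.sqrt rho.
have K0 : 0 <= K by rewrite mulr_ge0.
have BE x : sq B x = sq (formL r) x + sq (formR l) x by rewrite /sq /B ReD.
have FK x : cm (2 * w' x) <= K * sn B x.
  rewrite cmM -[2]/(2%:R) cm_nat -mulrA ler_wpM2l//.
  have h := lact_le Arep l0 rho0 lr uul x; rewrite lact_left_abs in h.
  rewrite (le_trans h)// ler_wpM2l// /sn ler_wsqrtr// BE lerDr.
  exact: sq_ge0 (formL_psd r0) _.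
have Flin (k : R[i]) (x y : A) : 2 * w' (k *: x + y) = k * (2 * w' x) + 2 * w' y.
  by rewrite dual_linear; ring.
have Bx x : sn B x <= K * nm x.
  rewrite (sn_le P) ?mulr_ge0 ?nm_ge0// BE exprMn /K exprMn sqr_sqrtr//.
  have h1 := formL_bound x r0 rho0 rr; have h2 := formL_bound (cadj x) l0 rho0 lr.
  rewrite -formR_adj nm_cadj in h2; have := mulr_ge0 rho0 (sqr_ge0 (nm x)); lra.
pose M := D * K + (K + 1).
have M0 : 0 <= M by rewrite !addr_ge0// mulr_ge0.
apply: (@le_eps1 _ _ _ (2 * Num.sqrt rho * Num.sqrt M + M)) => [|e e0 e1].
  by rewrite addr_ge0// !mulr_ge0 ?sqrtr_ge0.
have e20 : 0 < e ^+ 2 by rewrite exprn_gt0.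
have e21 : e ^+ 2 <= e by rewrite expr2 ler_piMr ?(ltW e0).
have [g [g1 gF]] := riesz_approx P Flin K0 e20 FK.
have wg : (dadj w g) = (w (cadj g))^* by [].
have ul : u (dactl (cadj g) l) = w (cadj g).
  rewrite -[LHS]conjCK -{1}(dadjK (dactl (cadj g) l)) -[(u _)^*]/(badj u _).
  rewrite dadj_dactl cadjK (dadj_pos Arep l0) -[badj u _]/(lact (badj u) l g).
  by rewrite lact_left_abs wg conjCK.
have uw : u (dadj w) = rho%:C by rewrite -[LHS]conjCK -[(u _)^*]/(badj u w) uur conjR.
(* u is evaluated on the residual functional: it sends w^* to rho and both parts of the form to
   w(g^* ). *)
have h1 : cm (2 * (rho%:C - w (cadj g))) <= D * (e ^+ 2 * K).
  have -> : 2 * (rho%:C - w (cadj g)) = u (dsub (dsub (dadj w) (dactr r (cadj g)))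
      (dsub (dactl (cadj g) l) (dadj w))).
    by rewrite !bidualB ul uw -[u (dactr r _)]/(w (cadj g)); ring.
  apply: uD => [|x]; first by rewrite mulr_ge0// ltW.
  rewrite -mulrA (le_trans _ (ler_wpM2l (ltW e20) (Bx x)))// (le_trans _ (gF x))//.
  rewrite le_eqVlt; apply/orP; left; apply/eqP; congr cm.
  by rewrite /= /B /formL /formR -/w' -[(w (cadj x))^*]/(w' x); ring.
have h2 := le_trans (Re_le_cm _) h1.
have h3 : sq B g <= 2 * complex.Re (w (cadj g)) + e ^+ 2 * (K + 1).
  have := gF g; rewrite cmB => /(le_trans (Re_le_cm _)); rewrite ReB.
  have -> : complex.Re (2 * w' g) = 2 * complex.Re (w (cadj g)).
    by rewrite /w' wg -[2 : R[i]]/(2%:R) mulr_natl mulr2n ReD ReJ; ring.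
  have h4 := ler_wpM2l (ltW e20) (le_trans g1 (lerD (lexx K) (le_trans e21 e1))).
  rewrite -[complex.Re (B g g)]/(sq B g); lra.
have [d10 _] := lact_dist Arep r0 rho0 rr uur g.
have [d20 _] := lact_adj_dist g.
have rg : complex.Re (2 * (rho%:C - w (cadj g))) = 2 * rho - 2 * complex.Re (w (cadj g)).
  by rewrite -[2 : R[i]]/(2%:R) mulr_natl mulr2n !(ReD, ReN) /=; ring.
rewrite rg in h2; rewrite BE in h3.
have e3 : M * e ^+ 2 = D * (e ^+ 2 * K) + e ^+ 2 * (K + 1) by rewrite /M; ring.
have h4 : complex.Re (w (cadj g)) <= dnorm w + 2 * Num.sqrt rho * Num.sqrt (M * e ^+ 2).
  (* Both squared distances are nonnegative and their sum is at most M e^2. *)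
  apply: contraction_near; rewrite e3; move: h2 h3 d10 d20.
    by rewrite /sq /formL /formR; lra.
  by rewrite /sq /formL /formR; lra.
rewrite sqrtrM// sqrtr_sqr (ger0_norm (ltW e0)) in h4.
have h5 := ler_wpM2l M0 e21; have h6 : 0 <= e ^+ 2 * (K + 1) by rewrite mulr_ge0 ?addr_ge0// ltW.
lra.
Qed.

Lemma polar_abs :
  [/\ dle r (dnorm w), dpositive l, dle l (dnorm w),
      forall x, cm (w x) <= Num.sqrt (dnorm w) * sn (formR r) x
    & forall x, cm (dadj w x) <= Num.sqrt (dnorm w) * sn (formR l) x].
Proof.
have le K (f : dual A) : dle f rho -> dle f (dnorm w).
  move=> fr x; rewrite (le_trans (fr x))// ler_wpM2r ?nm_ge0//; exact: polar_norm_le.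
have S : Num.sqrt rho <= Num.sqrt (dnorm w) by rewrite ler_wsqrtr// polar_norm_le.
split=> //; [exact: le|exact: le|..] => x.
- rewrite (le_trans (lact_le Arep r0 rho0 rr uur x))// ler_wpM2r// sn_ge0//.
- have h := lact_le Arep l0 rho0 lr uul x; rewrite lact_left_abs in h.
  by rewrite (le_trans h)// ler_wpM2r// sn_ge0.
Qed.

End Fixed.
End Support.

Lemma idempotent_dadj (R : realType) (G : lcqg R) (w : dual (C0 G)) :
  bidominated w -> idempotent_functional w -> idempotent_functional (dadj w).
Proof.
move=> wd wid; have ww := conv_idem wd wid; have wd' := bidominated_dadj wd.
have [[a wa] _] := wid; split=> [|b]; last by rewrite /convolution -convE// conv_dadj// ww.
by exists (cadj a); rewrite /= cadjK conjC_eq0.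
Qed.

Theorem theorem2p3 (R : realType) (G : lcqg R)
    (omega : dual (C0 G)) (u : bidual (C0 G)) (abs_r abs_l : dual (C0 G)) :
  coamenable G ->
  contractive_idempotent omega ->
  polar_decomposition omega u abs_r ->
  abs_l = left_abs u abs_r ->
  idempotent_state abs_r /\ idempotent_state abs_l /\
  exists v : C0 G,
    [/\ omega = dactr abs_l v,
        omega = dactl v abs_r
      & (null_space (dual_tensor (@ctens R G) abs_r abs_r) `&`
         [set madj x |
           x in null_space (dual_tensor (@ctens R G) abs_l abs_l)])
        (msub (comult v) (membed (ctens v v)))].
Proof.
move=> _ [wid w1] [r0 ru wE] lE; pose Arep := @C0_rep R G.
have [rw l0 lw wr wl] := polar_abs Arep r0 ru; rewrite -lE -wE in l0 lw wr wl rw.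
set r := abs_r in r0 ru rw wr lE wE *; set l := abs_l in l0 lw wl lE *; set w := omega in wid w1 wE rw lw wr wl *.
have le1 (f : dual (C0 G)) : dle f (dnorm w) -> dle f 1.
  by move=> fw x; rewrite (le_trans (fw x))// ler_wpM2r ?nm_ge0.
have s1 : Num.sqrt (dnorm w) <= 1 by rewrite -sqrtr1 ler_wsqrtr.
have wr' : dominated w r.
  by split=> // x; rewrite (le_trans (wr x))// ler_piMl ?sn_ge0.
have wl' : dominated (dadj w) l.
  by split=> // x; rewrite (le_trans (wl x))// ler_piMl ?sn_ge0.
have wd : bidominated w by split; [exists r|exists l].
have wd' := bidominated_dadj wd; have wid' := idempotent_dadj wd wid.
split; first exact: (abs_idempotent_state r0 (le1 _ rw) wr' wd wid).
split; first exact: (abs_idempotent_state l0 (le1 _ lw) wl' wd' wid').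
have [[a wa] _] := wid'; pose x := (dadj w a)^-1 *: a.
have wx : dadj w x = 1 by rewrite dualZ mulVf.
have [v xv] := conv_slice_exists x wd'.
have rv d : r (cmul d v) = w d.
  by rewrite (abs_slice r0 (le1 _ rw) wr' wd wid d xv) wx mulr1.
(* v^* is the slice of x^* by w, so the argument for (w^*, l) yields the same v. *)
have lv d : l (cmul d (cadj v)) = dadj w d.
  have xv' := conv_slice_adj wd' xv.
  rewrite (abs_slice l0 (le1 _ lw) wl' wd' wid' d xv') dadjK.
  by rewrite -[w (cadj x)]conjCK -[(w (cadj x))^*]/(dadj w x) wx conjC1 mulr1.
exists v; split; [| |split].
- apply: dual_ext_eq => d /=; rewrite -[RHS]conjCK -dpos_herm// cadjM lv.
  by rewrite /= cadjK conjCK.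
- by apply: dual_ext_eq => d /=; rewrite rv.
- exact: (abs_null r0 (le1 _ rw) wr' wd wid rv).
(* The defect of v is the adjoint of the defect of v^*, which is null for l (x) l. *)
exists (msub (comult (cadj v)) (membed (ctens (cadj v) (cadj v)))).
  exact: (abs_null l0 (le1 _ lw) wl' wd' wid' lv).
by rewrite madj_msub madj_membed comult_adj madjK (tens_adj (@ctensP R G)) cadjK.
Qed.
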